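(* Let $\tau\in\mathbb{R}$ and let $\Gamma$ be a curve (a finite collection of pairwise disjoint simple closed curves) in $\partial_\infty\widetilde{\mathrm{SL}}_2(\mathbb{R})$. Working in the half space model, assume that there exist a vertical line $L$ in the vertical boundary $\partial_\infty\mathbb{H}^2\times\mathbb{R}$ and a subarc $\Gamma'\subset\Gamma$ such that: (1) $\Gamma'\cap L\neq\emptyset$ and $\partial\Gamma'\cap L=\emptyset$, where $\partial\Gamma'$ denotes the endpoints of $\Gamma'$; (2) $\Gamma'$ lies on one side of $L$; (3) there is $t_0\in\mathbb{R}$ such that $\Gamma'$ is contained in $\{(x,0,t):\ x\in\mathbb{R},\ t_0<t<t_0+\sqrt{1+4\tau^2}\,\pi\}$. Then there is no properly immersed minimal surface in $\widetilde{\mathrm{SL}}_2(\mathbb{R})$ (with possibly finite boundary) with asymptotic boundary $\Gamma$.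
   Context: Fix $\tau\in\mathbb{R}$ (the case $\tau=0$ is allowed). $\widetilde{\mathrm{SL}}_2(\mathbb{R})$ denotes the homogeneous space $\mathbb{E}(-1,\tau)$ (equal to $\mathbb{H}^2\times\mathbb{R}$ if $\tau=0$): the set $\{(x,y,t)\in\mathbb{R}^3:\lambda(x,y)>0\}$ with the metric $\lambda^2(dx^2+dy^2)+\left(2\tau\left(\frac{\lambda_y}{\lambda}dx-\frac{\lambda_x}{\lambda}dy\right)+dt\right)^2$, where $\lambda=\frac1y$ on $\{y>0\}$ (half space model $\mathcal H$) or $\lambda=\frac{2}{1-x^2-y^2}$ on $\{x^2+y^2<1\}$ (cylinder model $\mathcal C$). The map $\Pi(x,y,t)=(x,y)$ is a Riemannian submersion onto $\mathbb{H}^2$. With $z=x+iy$, an isometry $\mathcal H\to\mathcal C$ is $\phi(z,t)=\left(\frac{z-i}{z+i},\,t-4\tau\arctan\left(\frac{x}{y+1}\right)\right)$; it extends to the ideal points $(x,0,t)$. Identifying the space topologically with $\mathbb{H}^2\times\mathbb{R}$ and using the product compactification, the asymptotic boundary $\partial_\infty\widetilde{\mathrm{SL}}_2(\mathbb{R})$ consists of the vertical boundary $\partial_\infty\mathbb{H}^2\times\mathbb{R}$ and the horizontal boundaries $\mathbb{H}^2\times\{\pm\infty\}$. In the half space model the vertical boundary is $(\{y=0\}\cup\{\infty\})\times\mathbb{R}\equiv(\mathbb{R}\cup\{\infty\})\times\mathbb{R}$; a vertical line is a set $\{p\}\times\mathbb{R}$ with $p\in\partial_\infty\mathbb{H}^2$.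 For $L=\{(x_0,0,t):t\in\mathbb{R}\}$, lying on one side of $L$ means being contained in $\{x\le x_0\}$ or in $\{x\ge x_0\}$. The asymptotic boundary of a surface is the set of its accumulation points in $\partial_\infty\widetilde{\mathrm{SL}}_2(\mathbb{R})$. ''With possibly finite boundary'' means that the surface is allowed to have a nonempty compact boundary located in $\widetilde{\mathrm{SL}}_2(\mathbb{R})$ itself (as opposed to its asymptotic boundary). *)

(* Defs.v *)
From HB Require Import structures.
From mathcomp Require Import all_boot all_order all_algebra.
From mathcomp Require Import all_classical all_reals all_analysis.

Set Implicit Arguments.
Unset Strict Implicit.
Unset Printing Implicit Defensive.

Import Order.TTheory GRing.Theory Num.Theory.
Import numFieldNormedType.Exports.

Local Open Scope classical_set_scope.
Local Open Scope ring_scope.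

Section HomogeneousSpace.
Variables (R : realType) (tau : R).

Definition xcoord (p : 'rV[R]_3) : R := p 0 0.
Definition ycoord (p : 'rV[R]_3) : R := p 0 1.
Definition tcoord (p : 'rV[R]_3) : R := p 0 2.

Definition half_space : set 'rV[R]_3 := [set p | 0 < ycoord p].

Definition lambda (x y : R) : R := y^-1.
Definition lambda_x (x y : R) : R := derive1 (lambda ^~ y) x.
Definition lambda_y (x y : R) : R := derive1 (lambda x) y.

Definition dx : 'rV[R]_3 := delta_mx 0 0.
Definition dy : 'rV[R]_3 := delta_mx 0 1.
Definition dt : 'rV[R]_3 := delta_mx 0 2.

Definition theta (p : 'rV[R]_3) : 'rV[R]_3 :=
  let x := xcoord p in let y := ycoord p in
  (2 * tau) *: ((lambda_y x y / lambda x y) *: dx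
                - (lambda_x x y / lambda x y) *: dy) + dt.

(* Gram matrix of the metric in the coordinates (x, y, t); for a row vector w
   of coefficients of a 1-form, w^T *m w is the matrix of its square. *)
Definition metric (p : 'rV[R]_3) : 'M[R]_3 :=
  lambda (xcoord p) (ycoord p) ^+ 2 *: (dx^T *m dx + dy^T *m dy)
  + (theta p)^T *m theta p.

Definition inner (p v w : 'rV[R]_3) : R := (v *m metric p *m w^T) 0 0.

Definition partial_metric (i j l : 'I_3) (p : 'rV[R]_3) : R :=
  'D_(delta_mx 0 i) (fun q : 'rV[R]_3 => metric q j l : R) p.

(* christoffel k i j p is the symbol with upper index k. *)
Definition christoffel (k i j : 'I_3) (p : 'rV[R]_3) : R :=
  2^-1 * \sum_(l < 3) invmx (metric p) k l *
    (partial_metric i j l p + partial_metric j i l p - partial_metric l i j p).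

End HomogeneousSpace.

(* On an open set U of a finite-dimensional space V, continuity of all
   iterated directional derivatives of order k amounts to F being C^k. *)
Fixpoint Ck {R : realType} {V W : normedModType R} (k : nat) (U : set V)
    (F : V -> W) : Prop :=
  match k with
  | 0%N => forall u, U u -> {for u, continuous F}
  | k'.+1 => (forall u v, U u -> derivable F u v) /\
             (forall v, Ck k' U ('D_v F))
  end.

Definition smooth_on {R : realType} {V W : normedModType R} (U : set V)
  (F : V -> W) : Prop := forall k, Ck k U F.

Section ParametrizedSurface.
Variables (R : realType) (tau : R) (F : 'rV[R]_2 -> 'rV[R]_3).

Definition tangent (i : 'I_2) (u : 'rV[R]_2) : 'rV[R]_3 :=
  'D_(delta_mx 0 i) F u.

Definition immersive_at (u : 'rV[R]_2) : Prop :=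
  row_free (\matrix_(i < 2) tangent i u).

Definition first_form (u : 'rV[R]_2) : 'M[R]_2 :=
  \matrix_(i, j) inner tau (F u) (tangent i u) (tangent j u).

(* Levi-Civita derivative of the field [tangent j] along the i-th coordinate. *)
Definition covariant_tangent (i j : 'I_2) (u : 'rV[R]_2) : 'rV[R]_3 :=
  'D_(delta_mx 0 i) (tangent j) u +
  \row_(k < 3) \sum_(a < 3) \sum_(b < 3)
     christoffel tau k a b (F u) * tangent i u 0 a * tangent j u 0 b.

Definition unit_normal (u : 'rV[R]_2) (nu : 'rV[R]_3) : Prop :=
  inner tau (F u) nu nu = 1 /\
  forall i, inner tau (F u) (tangent i u) nu = 0.

Definition second_form (u : 'rV[R]_2) (nu : 'rV[R]_3) : 'M[R]_2 :=
  \matrix_(i, j) inner tau (F u) (covariant_tangent i j u) nu.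

Definition mean_curvature (u : 'rV[R]_2) (nu : 'rV[R]_3) : R :=
  2^-1 * \tr (invmx (first_form u) *m second_form u nu).

Definition minimal_at (u : 'rV[R]_2) : Prop :=
  forall nu, unit_normal u nu -> mean_curvature u nu = 0.

End ParametrizedSurface.

Section ImmersedSurface.
Variables (R : realType) (tau : R) (S : topologicalType) (X : S -> 'rV[R]_3).

Definition half_plane : set 'rV[R]_2 := [set u | 0 <= u 0 1].

(* h parametrizes the open set W of S homeomorphically (with inverse k) by the
   relatively open subset U `&` half_plane of the closed half-plane, and F is
   a smooth extension of X \o h to the open set U; U may lie in the open
   half-plane, which gives the interior charts.  No compatibility between
   charts is required: F being immersive, transition maps are automatically
   smooth, so that S carries the smooth structure induced by X. *)
Definition surface_chart (U : set 'rV[R]_2) (W : set S) (h : 'rV[R]_2 -> S)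
    (k : S -> 'rV[R]_2) (F : 'rV[R]_2 -> 'rV[R]_3) : Prop :=
  [/\ open U, open W,
      [/\ set_fun (U `&` half_plane) W h, set_fun W (U `&` half_plane) k,
          {in U `&` half_plane, cancel h k} & {in W, cancel k h}],
      {within U `&` half_plane, continuous h} /\ {within W, continuous k} &
      [/\ smooth_on U F, {in U `&` half_plane, F =1 X \o h} &
          {in U `&` half_plane, forall u, immersive_at F u}]].

Definition surface_boundary : set S :=
  [set p | exists U W h k F,
     [/\ surface_chart U W h k F, W p & k p 0 1 = 0]].

Definition immersed_surface : Prop :=
  [/\ hausdorff_space S, @second_countable S, range X `<=` half_space (R := R) &
      forall p, exists U W h k F, surface_chart U W h k F /\ W p].

Definition minimal_immersion : Prop :=
  forall U W h k F, surface_chart U W h k F ->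
    forall u, (U `&` half_plane) u -> minimal_at tau F u.

Definition proper_immersion : Prop :=
  forall K : set 'rV[R]_3, compact K -> K `<=` half_space (R := R) ->
    compact (X @^-1` K).

Definition properly_immersed_minimal_surface : Prop :=
  [/\ immersed_surface, minimal_immersion, proper_immersion &
      compact surface_boundary].

End ImmersedSurface.

(* The closed half-plane {y >= 0} together with the ideal point at infinity is
   viewed inside the one-point compactification of R^2, so that the product
   compactification of the half-space model is a subspace of this type. *)
Notation ambient R := (one_point_compactification (R * R) * \bar R)%type.

Section AsymptoticBoundary.
Variable R : realType.

Definition planar_point (x y : R) : one_point_compactification (R * R) :=
  Some (x, y).

Definition hyperbolic_plane : set (one_point_compactification (R * R)) :=
  [set z | exists x y, 0 < y /\ z = planar_point x y].

Definition ideal_points : set (one_point_compactification (R * R)) :=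
  [set z | z = None \/ exists x, z = planar_point x 0].

Definition embed (p : 'rV[R]_3) : ambient R :=
  (planar_point (xcoord p) (ycoord p), (tcoord p)%:E).

(* Closed half-plane times [-oo, +oo], minus the space itself: the vertical
   boundary, the two horizontal boundaries, and the two circles
   ideal_points `*` [set -oo; +oo] along which their closures meet. *)
Definition asymptotic_space : set (ambient R) :=
  [set q : ambient R | (hyperbolic_plane `|` ideal_points) q.1 /\
     ~ (hyperbolic_plane q.1 /\ q.2 \is a fin_num)].

Definition asymptotic_boundary (A : set 'rV[R]_3) : set (ambient R) :=
  asymptotic_space `&` limit_point (embed @` A).

Definition vertical_point (x t : R) : ambient R := (planar_point x 0, t%:E).

Definition vertical_line (x0 : R) : set (ambient R) := range (vertical_point x0).

Definition one_side (x0 : R) (A : set (ambient R)) : Prop :=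
  A `<=` [set q | exists x t, x <= x0 /\ q = vertical_point x t] \/
  A `<=` [set q | exists x t, x0 <= x /\ q = vertical_point x t].

Definition vertical_slab (t0 t1 : R) : set (ambient R) :=
  [set q | exists x t, t0 < t < t1 /\ q = vertical_point x t].

Definition simple_closed_curve (C : set (ambient R)) : Prop :=
  exists c : R -> ambient R,
    [/\ {within `[0, 1], continuous c}, c 0 = c 1,
        {in `[0, 1[ &, injective c} & C = c @` `[0, 1]].

(* A is an arc with endpoints p and q. *)
Definition is_arc (A : set (ambient R)) (p q : ambient R) : Prop :=
  exists c : R -> ambient R,
    [/\ {within `[0, 1], continuous c}, {in `[0, 1] &, injective c},
        A = c @` `[0, 1], c 0 = p & c 1 = q].

Definition asymptotic_curve (G : set (ambient R)) : Prop :=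
  exists (n : nat) (C : 'I_n -> set (ambient R)),
    [/\ forall i, simple_closed_curve (C i), trivIset setT C,
        G = \bigcup_i C i & G `<=` asymptotic_space].

End AsymptoticBoundary.

(* Main.v *)
(* Proof. On a minimal surface a function F has no local maximum at an interior
   point where the Hessian of F has positive trace on the kernel of dF, so that
   such functions serve as barriers.  Put m = sqrt (1 + 4 tau^2).

   Near an interior point of Gamma' all of Gamma is Gamma'.  Hence there are
   a < b in the slab and a point of Gamma on L at a height between a and b, such
   that, close to L, Gamma avoids the heights a and b and, between them, one open
   side of L, say x < x0 up to reflection.  Take x0 = 0.  Three sweeps show that S
   stays away from {0} x ]a, b[, a contradiction.  The first two are carried out in
   the coordinates (x', y', t') given by the isometry
     (z, t) |-> (- 1 / (z - x1), t + 4 tau arg (z - x1))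
   for an ideal point x1 < 0, with estimates that do not depend on x1:
     - ± t' - ln (1 + N y' / (m^2 x'^2 + y'^2)) / 24 shows that t' lies in
       [a - ep, b + ep] near x1;
     - y' / cos (om (t' - tm)) with om m > 1 shows that y <= C |z - x1|^2 there; its
       range of definition in t', of length pi / om, can be taken larger than
       b - a + 2 ep because b - a < m pi;
     - finally y / cos (om (t - tm)) - k (x - x2)^2, where x2 is the x-coordinate
       of a hypothetical point of S near {0} x ]a, b[, would have an interior
       maximum on S, since y <= C |z|^2. *)

Require Import Defs.
From HB Require Import structures.
From mathcomp Require Import all_boot all_order all_algebra.
From mathcomp Require Import all_classical all_reals all_analysis.
From mathcomp Require Import ring lra.

Set Implicit Arguments.
Unset Strict Implicit.
Unset Printing Implicit Defensive.

Import Order.TTheory GRing.Theory Num.Theory.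
Import numFieldNormedType.Exports.

Local Open Scope classical_set_scope.
Local Open Scope ring_scope.

(** * Level curvature and barriers *)

(** The width m pi is that of the minimal surfaces y = c cos (t / m): the level curvature of y / cos
    (om t) has the sign of m^2 om^2 - 1, so om > 1 / m gives a strict barrier at the price of a slab
    narrower than m pi. Nothing is known of [Gamma] on the side x > 0, and points of [Gamma] lie on
    L, so a superlevel set could escape to L. This is why the poles x1 are negative: S stays off the
    ideal boundary near x1, and bounds uniform in x1 survive the limit x1 -> 0. Inverting at x1
    costs a twist t' - t = 4 tau arg (z - x1), which can exceed what the slab leaves free; the
    logarithmic sweep absorbs it. There y / (m^2 x^2 + y^2) is, up to a factor, the Poisson kernel
    with pole at 0 of d_xx + m^2 d_yy, and y^2 (d_xx + m^2 d_yy) is the linearization of the level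
    curvature at t or - t on functions of x and y. Applying - ln, a convex function, turns this
    solution into a strict subsolution. *)

Record jet (R : realType) := Jet {
  jx : R; jy : R; jt : R;
  jxx : R; jyy : R; jtt : R; jxy : R; jxt : R; jyt : R }.

(* Up to the factor |dF|^2, the trace of the Hessian of F on the kernel of dF, for
   F with 2-jet J at height y; [e_i] and [e_ij] are E_i F and E_i E_j F in the
   orthonormal frame E_1 = y d/dx + 2 tau d/dt, E_2 = y d/dy, E_3 = d/dt. *)
Definition level_curvature (R : realType) (tau y : R) (J : jet R) : R :=
  let e1 := y * jx J + 2 * tau * jt J in
  let e2 := y * jy J in
  let e3 := jt J in
  let e11 := y ^+ 2 * jxx J + 4 * tau * y * jxt J + 4 * tau ^+ 2 * jtt J in
  let e12 := y * (y * jxy J + 2 * tau * jyt J) in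
  let e21 := e12 + y * jx J in
  let e22 := y * jy J + y ^+ 2 * jyy J in
  let e13 := y * jxt J + 2 * tau * jtt J in
  let e23 := y * jyt J in
  let e33 := jtt J in
  (e1 ^+ 2 + e2 ^+ 2 + e3 ^+ 2) * (e11 + e22 + e33 - e2)
  - (e1 ^+ 2 * e11 + e2 ^+ 2 * e22 + e3 ^+ 2 * e33
     + e1 * e2 * (e12 + e21) + 2 * e1 * e3 * e13 + 2 * e2 * e3 * e23).

(* 2-jet of F \o Phi for Phi = (X, Y, T) the isometry
   (z, t) |-> (- 1 / z, t + 4 tau arg z). *)
Definition inversion_jet (R : realType) (tau x y : R) (J : jet R) : jet R :=
  let r := x ^+ 2 + y ^+ 2 in
  let a := (x ^+ 2 - y ^+ 2) / r ^+ 2 in let b := 2 * x * y / r ^+ 2 in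
  let c := - (4 * tau * y) / r in let d := 4 * tau * x / r in
  let p := 2 * x * (3 * y ^+ 2 - x ^+ 2) / r ^+ 3 in
  let q := 2 * y * (y ^+ 2 - 3 * x ^+ 2) / r ^+ 3 in
  (* X_x = a, X_y = b, Y_x = - b, Y_y = a, T_x = c, T_y = d *)
  let jx' := a * jx J - b * jy J + c * jt J in
  let jy' := b * jx J + a * jy J + d * jt J in
  let H (u1 u2 u3 v1 v2 v3 : R) :=
    u1 * v1 * jxx J + u2 * v2 * jyy J + u3 * v3 * jtt J
    + (u1 * v2 + u2 * v1) * jxy J + (u1 * v3 + u3 * v1) * jxt J
    + (u2 * v3 + u3 * v2) * jyt J in
  Jet jx' jy' (jt J)
    (H a (- b) c a (- b) c + p * jx J - q * jy J + 4 * tau * b * jt J)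
    (H b a d b a d - p * jx J + q * jy J - 4 * tau * b * jt J)
    (jtt J)
    (H a (- b) c b a d + q * jx J + p * jy J - 4 * tau * a * jt J)
    (a * jxt J - b * jyt J + c * jtt J)
    (b * jxt J + a * jyt J + d * jtt J).

(** Invariance under an isometry, checked in coordinates: the inversion moves height y to y / (x^2 +
    y^2) and preserves both the gradient norm and the Hessian. *)
Lemma level_curvature_inversion (R : realType) (tau x y : R) (J : jet R) :
  0 < y ->
  level_curvature tau y (inversion_jet tau x y J) =
  level_curvature tau (y / (x ^+ 2 + y ^+ 2)) J.
Proof.
move=> y0.
have r0 : x ^+ 2 + y ^+ 2 != 0 by rewrite gt_eqF// ltr_wpDl ?sqr_ge0// exprn_gt0.
case: J => fx fy ft fxx fyy ftt fxy fxt fyt.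
rewrite /level_curvature /inversion_jet /=.
field.
exact: r0.
Qed.

(** * The Hessian of a function and its trace on a tangent plane *)

Section Contact.
Variable R : realType.
Implicit Types (J : jet R) (u v w : R * R * R).

Definition vx u := u.1.1.
Definition vy u := u.1.2.
Definition vt u := u.2.

Definition jet_linear J u := jx J * vx u + jy J * vy u + jt J * vt u.

Definition jet_bilinear J u v :=
  jxx J * vx u * vx v + jyy J * vy u * vy v + jtt J * vt u * vt v
  + jxy J * (vx u * vy v + vy u * vx v)
  + jxt J * (vx u * vt v + vt u * vx v)
  + jyt J * (vy u * vt v + vt u * vy v).

Variables (tau y : R).

(* The metric, [christoffel_form u v]^k = Gamma^k_ij u^i v^j and the gradient at
   height y. *)
Definition metric_form u v :=
  (1 + 4 * tau ^+ 2) / y ^+ 2 * (vx u * vx v) + y ^- 2 * (vy u * vy v)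
  + vt u * vt v - 2 * tau / y * (vx u * vt v + vt u * vx v).

Definition christoffel_form u v : R * R * R :=
  let m := 1 + 4 * tau ^+ 2 in
  let xy := vx u * vy v + vy u * vx v in
  let xt := vx u * vt v + vt u * vx v in
  let yt := vy u * vt v + vt u * vy v in
  ((2 * tau ^+ 2 - m) / y * xy + tau * yt,
   m / y * (vx u * vx v) - tau * xt - y^-1 * (vy u * vy v),
   - (tau * m / y ^+ 2) * xy + 2 * tau ^+ 2 / y * yt).

Definition gradient_form J : R * R * R :=
  (y ^+ 2 * jx J + 2 * tau * y * jt J, y ^+ 2 * jy J,
   2 * tau * y * jx J + (1 + 4 * tau ^+ 2) * jt J).

Lemma metric_gradient J u : y != 0 ->
  metric_form u (gradient_form J) = jet_linear J u.
Proof.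
by move=> y0; rewrite /metric_form /jet_linear /vx /vy /vt /=; field.
Qed.

(* Components in the frame (E_1, E_2, E_3) of the differential and of the Hessian
   (A, B, C standing for 1, 2, 3). *)
Let E1 J := y * jx J + 2 * tau * jt J.
Let E2 J := y * jy J.
Let E3 J := jt J.
Let bAA J := y ^+ 2 * jxx J + 4 * tau * y * jxt J + 4 * tau ^+ 2 * jtt J - E2 J.
Let bBB J := y * jy J + y ^+ 2 * jyy J.
Let bCC J := jtt J.
Let bAB J := y * (y * jxy J + 2 * tau * jyt J) + y * jx J / 2 + E1 J / 2.
Let bAC J := y * jxt J + 2 * tau * jtt J + tau * E2 J.
Let bBC J := y * jyt J - tau * E1 J.
Let bform J a b c a' b' c' :=
  bAA J * (a * a') + bBB J * (b * b') + bCC J * (c * c')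
  + bAB J * (a * b' + b * a') + bAC J * (a * c' + c * a')
  + bBC J * (b * c' + c * b').

(** Every term of [level_curvature] is quadratic in the differential, so positivity excludes a
    critical point. *)
Lemma metric_gradient_gt0 J : y != 0 -> level_curvature tau y J > 0 ->
  0 < metric_form (gradient_form J) (gradient_form J).
Proof.
move=> y0 Q.
have -> : metric_form (gradient_form J) (gradient_form J) =
    E1 J ^+ 2 + E2 J ^+ 2 + E3 J ^+ 2.
  rewrite metric_gradient// /jet_linear /vx /vy /vt /= /E1 /E2 /E3; ring.
rewrite lt0r !addr_ge0 ?sqr_ge0// andbT; apply/eqP => h.
have /andP[/eqP h1 /eqP h3] : (E1 J ^+ 2 + E2 J ^+ 2 == 0) && (E3 J ^+ 2 == 0).
  by rewrite -paddr_eq0 ?addr_ge0 ?sqr_ge0//; apply/eqP.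
have /andP[/eqP h2 /eqP h4] : (E1 J ^+ 2 == 0) && (E2 J ^+ 2 == 0).
  by rewrite -paddr_eq0 ?sqr_ge0//; apply/eqP.
have k1 : E1 J = 0 by apply/eqP; rewrite -sqrf_eq0 h2.
have k2 : E2 J = 0 by apply/eqP; rewrite -sqrf_eq0 h4.
have k3 : E3 J = 0 by apply/eqP; rewrite -sqrf_eq0 h3.
move: Q; rewrite /level_curvature -/(E1 J) -/(E2 J) -/(E3 J) k1 k2 k3.
by rewrite !(expr0n, mul0r, mulr0, addr0, subr0) ltxx.
Qed.

(** The triple (y a, y b, c + 2 tau a) is the vector a E_1 + b E_2 + c E_3; the Christoffel term
    turns second derivatives into the covariant Hessian. *)
Lemma bformE J a b c a' b' c' : y != 0 ->
  let u := (y * a, y * b, c + 2 * tau * a) in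
  let v := (y * a', y * b', c' + 2 * tau * a') in
  jet_bilinear J u v - jet_linear J (christoffel_form u v)
  = bform J a b c a' b' c'.
Proof.
move=> y0 /=.
rewrite /jet_bilinear /jet_linear /bform /bAA /bBB /bCC /bAB /bAC /bBC /E1 /E2.
rewrite /christoffel_form /vx /vy /vt /=.
by field.
Qed.

Lemma metric_formE a b c a' b' c' : y != 0 ->
  let u := (y * a, y * b, c + 2 * tau * a) in
  let v := (y * a', y * b', c' + 2 * tau * a') in
  metric_form u v = a * a' + b * b' + c * c'.
Proof. by move=> y0; rewrite /metric_form /vx /vy /vt /=; field. Qed.

Lemma frame_decomp u : y != 0 -> exists a b c,
  u = (y * a, y * b, c + 2 * tau * a).
Proof.
case: u => -[p q] r y0; exists (p / y), (q / y), (r - 2 * tau * (p / y)).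
by congr (_, _, _); field.
Qed.

(* [B] is the Hessian, and the expression is the trace of B on the span of u and
   v multiplied by the Gram determinant of (u, v). *)
Lemma tangential_trace_gt0 J u v : y != 0 ->
  jet_linear J u = 0 -> jet_linear J v = 0 ->
  0 < metric_form u u * metric_form v v - metric_form u v ^+ 2 ->
  0 < level_curvature tau y J ->
  let B u v := jet_bilinear J u v - jet_linear J (christoffel_form u v) in
  0 < metric_form v v * B u u - metric_form u v * (B u v + B v u)
      + metric_form u u * B v v.
Proof.
move=> y0; have [a [b [c ->]]] := frame_decomp u y0.
have [a' [b' [c' ->]]] := frame_decomp v y0.
move=> Lu Lv; rewrite !metric_formE// => detN Q; rewrite /= !bformE//.
have nu : a * E1 J + b * E2 J + c * E3 J = 0.
  by rewrite -Lu /jet_linear /vx /vy /vt /= /E1 /E2 /E3; ring.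
have nv : a' * E1 J + b' * E2 J + c' * E3 J = 0.
  by rewrite -Lv /jet_linear /vx /vy /vt /= /E1 /E2 /E3; ring.
have := metric_gradient_gt0 y0 Q.
have -> : metric_form (gradient_form J) (gradient_form J) =
    E1 J ^+ 2 + E2 J ^+ 2 + E3 J ^+ 2.
  rewrite metric_gradient// /jet_linear /vx /vy /vt /= /E1 /E2 /E3; ring.
set D := (X in 0 < X) => D0.
have QE : level_curvature tau y J = D * (bAA J + bBB J + bCC J)
    - bform J (E1 J) (E2 J) (E3 J) (E1 J) (E2 J) (E3 J).
  rewrite /level_curvature /D /bform /bAA /bBB /bCC /bAB /bAC /bBC /E1 /E2 /E3.
  by field.
rewrite QE in Q; move: Q {QE}.
rewrite /bform; move: (bAA J) (bBB J) (bCC J) (bAB J) (bAC J) (bBC J).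
move: (E1 J) (E2 J) (E3 J) @D D0 nu nv => n1 n2 n3 D D0 nu nv A B C AB AC BC Q.
(* N is the cross product of the two tangent vectors in the frame. It and the differential n are
   both orthogonal to the plane, whence D N = l n with l = N . n. *)
set N1 := b * c' - c * b'; set N2 := c * a' - a * c'; set N3 := a * b' - b * a'.
set l := N1 * n1 + N2 * n2 + N3 * n3.
have k1 : D * N1 = l * n1.
  apply/eqP; rewrite -subr_eq0; apply/eqP.
  transitivity ((b * n3 - c * n2) * (a' * n1 + b' * n2 + c' * n3)
     - (b' * n3 - c' * n2) * (a * n1 + b * n2 + c * n3)); last by rewrite nu nv !mulr0 subr0.
  by rewrite /D /l /N1 /N2 /N3; ring.
have k2 : D * N2 = l * n2.
  apply/eqP; rewrite -subr_eq0; apply/eqP.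
  transitivity ((c * n1 - a * n3) * (a' * n1 + b' * n2 + c' * n3)
     - (c' * n1 - a' * n3) * (a * n1 + b * n2 + c * n3)); last by rewrite nu nv !mulr0 subr0.
  by rewrite /D /l /N1 /N2 /N3; ring.
have k3 : D * N3 = l * n3.
  apply/eqP; rewrite -subr_eq0; apply/eqP.
  transitivity ((a * n2 - b * n1) * (a' * n1 + b' * n2 + c' * n3)
     - (a' * n2 - b' * n1) * (a * n1 + b * n2 + c * n3)); last by rewrite nu nv !mulr0 subr0.
  by rewrite /D /l /N1 /N2 /N3; ring.
(* Lagrange's identity: the Gram determinant is |N|^2. *)
have dE : (a * a + b * b + c * c) * (a' * a' + b' * b' + c' * c') -
    (a * a' + b * b' + c * c') ^+ 2 = N1 ^+ 2 + N2 ^+ 2 + N3 ^+ 2.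
  by rewrite /N1 /N2 /N3; ring.
rewrite dE in detN.
have l0 : l != 0.
  apply/eqP => l0; rewrite l0 !mul0r in k1 k2 k3.
  move: k1 k2 k3 => /eqP + /eqP + /eqP.
  rewrite !mulf_eq0 !(gt_eqF D0) /= => /eqP k1 /eqP k2 /eqP k3.
  by rewrite k1 k2 k3 expr0n !addr0 ltxx in detN.
rewrite -(pmulr_rgt0 _ (exprn_gt0 2 D0)).
set W := (X in 0 < _ * X).
(* W is |N|^2 tr B - B (N, N); substituting D N = l n shows that it is (l / D)^2 times the level
   curvature. *)
suff -> : D ^+ 2 * W = l ^+ 2 * (D * (A + B + C) - (A * (n1 * n1) + B * (n2 * n2) +
  C * (n3 * n3) + AB * (n1 * n2 + n2 * n1) + AC * (n1 * n3 + n3 * n1) + BC * (n2 * n3 + n3 * n2))).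
  by rewrite mulr_gt0// exprn_even_gt0.
transitivity (((D * N1) ^+ 2 + (D * N2) ^+ 2 + (D * N3) ^+ 2) * (A + B + C)
 - (A * (D * N1) ^+ 2 + B * (D * N2) ^+ 2 + C * (D * N3) ^+ 2
  + 2 * AB * (D * N1) * (D * N2) + 2 * AC * (D * N1) * (D * N3) + 2 * BC * (D * N2) * (D * N3))).
  by move: D {D0 k1 k2 k3 Q} => D; rewrite /W /N1 /N2 /N3; ring.
by rewrite k1 k2 k3 /D; ring.
Qed.

End Contact.

(** * Positive level curvature of the two barriers *)

Section Barriers.
Variable R : realType.
Implicit Types tau x y : R.

(* For F = y u(t) - k x^2, with u1, u2 the derivatives of u. *)
Definition catenoid_jet (k x y u u1 u2 : R) : jet R :=
  Jet (- (2 * k * x)) u (y * u1) (- (2 * k)) 0 (y * u2) 0 0 u1.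

(** For u = 1 / cos (om t) one has u u'' - 2 u'^2 = om^2 u^2, so the equality holds with s = (1 + 4
    tau^2) om^2 - 1. The last hypothesis says that the terms produced by k do not use up this
    margin. *)
Lemma catenoid_curvature_gt0 tau (k x y u u1 u2 s : R) :
  0 < y -> 0 < u -> 0 <= u2 ->
  (1 + 4 * tau ^+ 2) * (u * u2 - 2 * u1 ^+ 2) = (1 + s) * u ^+ 2 ->
  6 * `|tau * u1 * (2 * k * x)| + (2 * k * x) ^+ 2
    + 2 * k * y * (u ^+ 2 + u1 ^+ 2) / u < s * u ^+ 2 ->
  0 < level_curvature tau y (catenoid_jet k x y u u1 u2).
Proof.
move=> y0 u0 u20 hu small.
set e := 2 * k * x in small *.
have -> : level_curvature tau y (catenoid_jet k x y u u1 u2) =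
  y ^+ 3 * (u * ((1 + 4 * tau ^+ 2) * (u * u2 - 2 * u1 ^+ 2) - u ^+ 2)
    + u2 * e ^+ 2 + u * (6 * (tau * u1 * e) - e ^+ 2
       - 2 * k * y * (u ^+ 2 + u1 ^+ 2) / u)).
  rewrite /level_curvature /= /e; field; exact: lt0r_neq0.
rewrite hu mulr_gt0 ?exprn_gt0//.
have h1 : 0 <= u2 * e ^+ 2 by rewrite mulr_ge0 ?sqr_ge0.
have h2 : - `|tau * u1 * e| <= tau * u1 * e by rewrite lerNl -normrN ler_norm.
set q := 2 * k * y * (u ^+ 2 + u1 ^+ 2) / u in small *.
have : 0 < u * (s * u ^+ 2 + (6 * (tau * u1 * e) - e ^+ 2 - q)).
  rewrite mulr_gt0//; lra.
by move=> h; apply: (lt_le_trans h); rewrite -subr_ge0; apply: le_trans h1 _; rewrite le_eqVlt; apply/orP; left; apply/eqP; ring.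
Qed.

(* J is the jet of e t - ep ln (1 + z) for z = N y / (M x^2 + y^2), with
   g = ep z / (1 + z), p = - 2 M x y / (M x^2 + y^2) and
   n = (M x^2 - y^2) / (M x^2 + y^2). *)
Lemma log_barrier_curvature_gt0 tau (y e g n p ep : R) (J : jet R) :
  let M := 1 + 4 * tau ^+ 2 in
  let K := M * (1 - n) * (1 + 2 * n) in
  0 < g -> g <= ep -> 0 < ep -> ep <= 24^-1 -> e ^+ 2 = 1 -> p ^+ 2 + M * n ^+ 2 = M ->
  y != 0 ->
  y * jx J = - (g * p) -> y * jy J = - (g * n) -> jt J = e ->
  y ^+ 2 * jxx J = - (g * K - g ^+ 2 * p ^+ 2 / ep) ->
  y ^+ 2 * jyy J = - (- (g * (K / M)) - g ^+ 2 * n ^+ 2 / ep) ->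
  y ^+ 2 * jxy J = - (g * (p * (2 * n - 1)) - g ^+ 2 * (p * n) / ep) ->
  jtt J = 0 -> jxt J = 0 -> jyt J = 0 ->
  0 < level_curvature tau y J.
Proof.
move=> M K g0 gep ep0 ep24 e2 hpn y0 hx hy ht hxx hyy hxy htt hxt hyt.
have M1 : 1 <= M by rewrite lerDl mulr_ge0 ?sqr_ge0.
have M0 : M != 0 by rewrite gt_eqF// (lt_le_trans ltr01).
pose a := 2 * tau * e - g * p.
(* The part linear in g cancels. M / ep comes from the squared first derivatives of the logarithm,
   through p^2 + M n^2 = M, and has to dominate the rest. *)
have -> : level_curvature tau y J = g ^+ 2 * (M / ep
   - g * n ^+ 2 * K + (1 - n) * (1 + 2 * n) * (- (4 * tau * e * p) + g * p ^+ 2)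
   - 2 * (a * p) * n * (2 * n - 1) + (- (a * p) * n + g * n ^+ 3)).
  have e11 : y ^+ 2 * jxx J + 4 * tau * y * jxt J + 4 * tau ^+ 2 * jtt J =
    - (g * K - g ^+ 2 * p ^+ 2 / ep) by rewrite hxx hxt htt !mulr0 !addr0.
  have e12 : y * (y * jxy J + 2 * tau * jyt J) =
    - (g * (p * (2 * n - 1)) - g ^+ 2 * (p * n) / ep).
    by rewrite hyt mulr0 addr0 mulrA -expr2 hxy.
  have e1 : y * jx J + 2 * tau * jt J = a by rewrite hx ht /a; ring.
  rewrite /level_curvature e11 e12 e1 hx hy ht hyy htt hxt hyt.
  have -> : M / ep = (p ^+ 2 + M * n ^+ 2) / ep by rewrite hpn.
  rewrite e2 !(mulr0, addr0).
  set tau2 := 4 * tau ^+ 2.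
  have hK : K / M = (1 - n) * (1 + 2 * n) by rewrite /K; field.
  rewrite hK.
  have -> : M = 1 + 4 * tau ^+ 2 * e ^+ 2 by rewrite e2 mulr1.
  have -> : K = (1 + 4 * tau ^+ 2 * e ^+ 2) * (1 - n) * (1 + 2 * n).
    by rewrite e2 mulr1.
  by rewrite /a; field; rewrite gt_eqF.
rewrite mulr_gt0 ?exprn_gt0//.
have n1 : n ^+ 2 <= 1.
  have : M * n ^+ 2 <= M * 1 by rewrite mulr1 -[leRHS]hpn lerDr sqr_ge0.
  by rewrite ler_pM2l// (lt_le_trans ltr01).
have p1 : p ^+ 2 <= M.
  by rewrite -[leRHS]hpn lerDl mulr_ge0 ?sqr_ge0// (le_trans ler01).
have nn : `|n| <= 1 by rewrite -(@ler_pXn2r _ 2)// ?nnegrE// real_normK ?num_real// expr1n.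
have [na nb] : -1 <= n /\ n <= 1 by move: nn; rewrite ler_norml => /andP.
have g1 : g <= 1 by rewrite (le_trans gep)// (le_trans ep24)// invf_le1// ler1n.
pose w := (1 - n) * (1 + 2 * n).
have hw : `|w| <= 2 by rewrite ler_norml /w; apply/andP; split; nra.
pose q := 2 * tau * e.
have hq : q ^+ 2 <= M by rewrite /q exprMn e2 mulr1 exprMn -natrX lerDr.
have hqp : `|q * p| <= M.
  have h1 := sqr_ge0 (q - p); have h2 := sqr_ge0 (q + p).
  rewrite sqrrB in h1; rewrite sqrrD in h2.
  by rewrite ler_norml; apply/andP; split; lra.
have hgp : `|g * p ^+ 2| <= M.
  rewrite ger0_norm; last exact: mulr_ge0 (ltW g0) (sqr_ge0 _).
  by rewrite -[leRHS]mul1r; apply: ler_pM => //; [exact: ltW|exact: sqr_ge0].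
have hap : `|a * p| <= 2 * M.
  have -> : a * p = q * p - g * p ^+ 2 by rewrite /a /q; ring.
  by rewrite (le_trans (ler_normB _ _))// mulr_natl mulr2n lerD.
have M0' : 0 <= M by rewrite (le_trans ler01).
have t1 : `|g * n ^+ 2 * K| <= 2 * M.
  have -> : g * n ^+ 2 * K = g * n ^+ 2 * M * w by rewrite /K /w; ring.
  have gn : `|g * n ^+ 2| <= 1.
    rewrite normrM normrX -[leRHS]mulr1; apply: ler_pM => //.
      by rewrite gtr0_norm.
    exact: exprn_ile1.
  have gnM : `|g * n ^+ 2 * M| <= M.
    by rewrite normrM (ger0_norm M0') -[leRHS]mul1r ler_wpM2r.
  by rewrite normrM [leRHS]mulrC; apply: ler_pM.
have t2 : `|w * (- (4 * tau * e * p) + g * p ^+ 2)| <= 2 * (3 * M).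
  rewrite normrM; apply: ler_pM => //.
  have -> : 4 * tau * e * p = 2 * (q * p) by rewrite /q; ring.
  rewrite (le_trans (ler_normD _ _))// normrN normrM (ger0_norm (ler0n _ 2)).
  have -> : 3 * M = 2 * M + M by ring.
  by rewrite lerD// ler_wpM2l.
have t3 : `|2 * (a * p) * n * (2 * n - 1)| <= 12 * M.
  have -> : 2 * (a * p) * n * (2 * n - 1) = (a * p) * (2 * n * (2 * n - 1)) by ring.
  have -> : 12 * M = 2 * M * 6 by ring.
  by rewrite normrM; apply: ler_pM => //; rewrite ler_norml; apply/andP; split; nra.
have t4 : `|- (a * p) * n| <= 2 * M.
  by rewrite mulNr normrN normrM -[leRHS]mulr1; apply: ler_pM.
have t5 : `|g * n ^+ 3| <= M.
  apply: le_trans M1; rewrite normrM normrX -[leRHS]mulr1; apply: ler_pM => //.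
    by rewrite gtr0_norm.
  exact: exprn_ile1.
(* The five bounds above add up to 23 M, which is why 1/24 is small enough for ep. *)
have t6 : 24 * M <= M / ep.
  rewrite mulrC ler_wpM2l// -[leLHS]invrK lef_pV2 ?posrE// invr_gt0; lra.
move: t1 t2 t3 t4 t5; rewrite !ler_norml -/w.
move=> /andP[_ t1] /andP[t2 _] /andP[_ t3] /andP[t4 _] /andP[t5 _].
lra.
Qed.

End Barriers.

(** * Second-order jets along curves *)

Section TwoJets.
Variable R : realType.
Implicit Types (c f g : R -> R) (a b d : R).

(* c is twice differentiable at 0, with c 0 = a, c' 0 = b and c'' 0 = d. *)
Definition curve_jet c a b d :=
  c 0 = a /\ exists c', [/\ \forall s \near (0 : R), is_derive s (1 : R) c (c' s),
    c' 0 = b & is_derive (0 : R) 1 c' d].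

Lemma curve_jet_eq c a b d a' b' d' : curve_jet c a b d ->
  a = a' -> b = b' -> d = d' -> curve_jet c a' b' d'.
Proof. by move=> + <- <- <-. Qed.

Lemma curve_jet_cst a : curve_jet (fun=> a) a 0 0.
Proof.
split=> //; exists (fun=> 0); split => //; last exact: is_derive_cst.
by near=> s; exact: is_derive_cst.
Unshelve. all: by end_near. Qed.

Lemma curve_jetD f g a b d a' b' d' :
  curve_jet f a b d -> curve_jet g a' b' d' ->
  curve_jet (fun s => f s + g s) (a + a') (b + b') (d + d').
Proof.
move=> [f0 [f1 [nf <- df]]] [g0 [g1 [ng <- dg]]].
split; first by rewrite f0 g0.
exists (f1 + g1); split => //; last exact: is_deriveD.
by near=> s; apply: is_deriveD; [near: s; exact: nf|near: s; exact: ng].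
Unshelve. all: by end_near. Qed.

Lemma curve_jetM f g a b d a' b' d' :
  curve_jet f a b d -> curve_jet g a' b' d' ->
  curve_jet (fun s => f s * g s) (a * a') (a * b' + a' * b)
    (a * d' + 2 * b * b' + a' * d).
Proof.
move=> [f0 [f1 [nf f10 df]]] [g0 [g1 [ng g10 dg]]].
split; first by rewrite f0 g0.
have df0 : is_derive (0 : R) 1 f (f1 0) by exact: nbhs_singleton nf.
have dg0 : is_derive (0 : R) 1 g (g1 0) by exact: nbhs_singleton ng.
exists (f * g1 + g * f1); split.
- near=> s.
  have h1 : is_derive s 1 f (f1 s) by near: s; exact: nf.
  have h2 : is_derive s 1 g (g1 s) by near: s; exact: ng.
  by apply: is_derive_eq (is_deriveM h1 h2) _.
- by rewrite /GRing.add /GRing.mul /= f0 g0 f10 g10.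
- apply: is_derive_eq (is_deriveD (is_deriveM df0 dg) (is_deriveM dg0 df)) _.
  by rewrite /GRing.scale /= f0 g0 f10 g10; ring.
Unshelve. all: by end_near. Qed.

Lemma curve_jetZ k f a b d : curve_jet f a b d ->
  curve_jet (fun s => k * f s) (k * a) (k * b) (k * d).
Proof.
move=> hf; apply: curve_jet_eq (curve_jetM (curve_jet_cst k) hf) _ _ _; ring.
Qed.

Lemma curve_jetN f a b d : curve_jet f a b d ->
  curve_jet (fun s => - f s) (- a) (- b) (- d).
Proof.
move=> hf; have := curve_jetZ (-1) hf; rewrite !mulN1r.
by congr curve_jet; apply/funext => s; rewrite mulN1r.
Qed.

Lemma curve_jetB f g a b d a' b' d' :
  curve_jet f a b d -> curve_jet g a' b' d' ->
  curve_jet (fun s => f s - g s) (a - a') (b - b') (d - d').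
Proof. by move=> hf hg; exact: curve_jetD hf (curve_jetN hg). Qed.

Lemma curve_jet_comp (phi phi1 : R -> R) phi2 c a b d :
  (\forall r \near a, is_derive r (1 : R) phi (phi1 r)) -> is_derive a 1 phi1 phi2 ->
  curve_jet c a b d ->
  curve_jet (fun s => phi (c s)) (phi a) (phi1 a * b)
    (phi2 * b ^+ 2 + phi1 a * d).
Proof.
move=> nphi dphi [c0 [c1 [nc c10 dc]]].
have dc0 : is_derive (0 : R) 1 c (c1 0) by exact: nbhs_singleton nc.
have cc : {for (0 : R), continuous c}.
  by apply: differentiable_continuous; apply/derivable1_diffP; exact: ex_derive.
have nphic : \forall s \near (0 : R), is_derive (c s) (1 : R) phi (phi1 (c s)).
  by apply: (cc (fun r => is_derive r (1 : R) phi (phi1 r))); rewrite c0.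
split; first by rewrite c0.
exists ((phi1 \o c) * c1); split.
- near=> s.
  have h1 : is_derive s 1 c (c1 s) by near: s; exact: nc.
  have h2 : is_derive (c s) 1 phi (phi1 (c s)).
    by near: s; exact: nphic.
  by apply: is_derive_eq (is_derive1_comp h2 h1) _.
- by rewrite /GRing.mul /= c0 c10.
- have h2 : is_derive (c 0) 1 phi1 phi2 by rewrite c0.
  apply: is_derive_eq (is_deriveM (is_derive1_comp h2 dc0) dc) _.
  by rewrite /GRing.scale /= c0 c10; ring.
Unshelve. all: by end_near. Qed.

Lemma curve_jetV f a b d : a != 0 -> curve_jet f a b d ->
  curve_jet (fun s => (f s)^-1) a^-1 (- b / a ^+ 2)
    (2 * b ^+ 2 / a ^+ 3 - d / a ^+ 2).
Proof.
move=> a0 hf.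
have dV (r : R) : r != 0 -> is_derive r (1 : R) (@GRing.inv R) (- r ^- 2).
  move=> r0; apply: is_derive_eq (is_deriveV (f := id) r0 (is_derive_id r 1)) _.
  by rewrite /GRing.scale /= mulr1.
apply: curve_jet_eq (@curve_jet_comp _ (fun r => - r ^- 2) (2 * a ^- 3) _ _ _ _ _ _ hf) _ _ _.
- near=> r; apply: dV; near: r; exact: open_neq.
- have h : is_derive a 1 (fun r : R => r ^- 2) (- (a ^- 4) * (2 * a)).
    have h2 : is_derive a 1 (fun r : R => r ^+ 2) (2 * a).
      have -> : (fun r : R => r ^+ 2) = (id : R -> R) * id by apply/funext.
      apply: is_derive_eq (is_deriveM (is_derive_id a 1) (is_derive_id a 1)) _.
      by rewrite /GRing.scale /= mulr1 mulr_natl.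
    have h3 : a ^+ 2 != 0 by rewrite expf_neq0.
    apply: is_derive_eq (@is_deriveV _ (fun r : R => r ^+ 2) a _ 1 h3 h2) _.
    by rewrite /GRing.scale /= -exprM.
  by apply: is_derive_eq (is_deriveN h) _; field.
- by [].
- by field.
- by field.
Unshelve. all: by end_near. Qed.

Lemma curve_jet_sqr f a b d : curve_jet f a b d ->
  curve_jet (fun s => f s ^+ 2) (a ^+ 2) (2 * a * b) (2 * a * d + 2 * b ^+ 2).
Proof.
by move=> hf; apply: curve_jet_eq (curve_jetM hf hf) _ _ _; ring.
Qed.

Lemma curve_jet_atan f a b d : curve_jet f a b d ->
  curve_jet (fun s => atan (f s)) (atan a) (b / (1 + a ^+ 2))
    (d / (1 + a ^+ 2) - 2 * a * b ^+ 2 / (1 + a ^+ 2) ^+ 2).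
Proof.
have a0 : 1 + a ^+ 2 != 0 by rewrite gt_eqF// ltr_wpDr ?sqr_ge0.
move=> hf; apply: curve_jet_eq (@curve_jet_comp atan (fun r => (1 + r ^+ 2)^-1)
  (- (2 * a) / (1 + a ^+ 2) ^+ 2) _ _ _ _ _ _ hf) _ _ _.
- by near=> r; exact: is_derive1_atan.
- have h2 : is_derive a 1 (fun r : R => 1 + r ^+ 2) (2 * a).
    have -> : (fun r : R => 1 + r ^+ 2) = cst 1 + (id : R -> R) * id by apply/funext.
    have h3 : is_derive a 1 (cst 1 : R -> R) 0 by exact: is_derive_cst.
    have h4 := is_deriveM (is_derive_id a 1) (is_derive_id a 1).
    apply: is_derive_eq (is_deriveD h3 h4) _.
    by rewrite /GRing.scale /= mulr1 mulr_natl add0r.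
  apply: is_derive_eq (@is_deriveV _ (fun r : R => 1 + r ^+ 2) a _ 1 a0 h2) _.
  by rewrite /GRing.scale /=; field.
- by [].
- by field.
- by field.
Unshelve. all: by end_near. Qed.

Lemma curve_jet_ln f a b d : 0 < a -> curve_jet f a b d ->
  curve_jet (fun s => ln (f s)) (ln a) (b / a) (d / a - b ^+ 2 / a ^+ 2).
Proof.
move=> a0 hf; have an0 := lt0r_neq0 a0.
apply: curve_jet_eq (@curve_jet_comp (@ln R) (@GRing.inv R)
  (- a ^- 2) _ _ _ _ _ _ hf) _ _ _.
- near=> r; apply: is_derive1_ln; near: r; exact: lt_nbhsr.
- apply: is_derive_eq (is_deriveV (f := id) an0 (is_derive_id a 1)) _.
  by rewrite /GRing.scale /= mulr1.
- by [].
- by field.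
- by field.
Unshelve. all: by end_near. Qed.

Lemma curve_jet_cos f a b d : curve_jet f a b d ->
  curve_jet (fun s => cos (f s)) (cos a) (- sin a * b)
    (- cos a * b ^+ 2 - sin a * d).
Proof.
move=> hf; apply: curve_jet_eq (@curve_jet_comp (@cos R) (fun r => - sin r)
  (- cos a) _ _ _ _ _ _ hf) _ _ _.
- by near=> r; exact: is_derive_cos.
- by [].
- by [].
- by ring.
Unshelve. all: by end_near. Qed.

(** As c' is only known to be differentiable at 0, the case d > 0 is refuted by the mean value
    theorem: c' would be positive just to the right of 0, hence c > c 0 there. *)
Lemma curve_jet_max c a b d : curve_jet c a b d ->
  (\forall s \near (0 : R), c s <= c 0) -> b = 0 /\ d <= 0.
Proof.
move=> [c0 [c1 [nc c10 dc]]] cmax.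
have dc0 : is_derive (0 : R) 1 c (c1 0) by exact: nbhs_singleton nc.
have /nbhs_ballP[e /= e0 he] : \forall s \near (0 : R), is_derive s (1 : R) c (c1 s) /\ c s <= c 0.
  by apply: filterS2 nc cmax => s.
have inball (s : R) : `|s| < e -> is_derive s (1 : R) c (c1 s) /\ c s <= c 0.
  by move=> se; apply: he; rewrite /ball /= sub0r normrN.
have b0 : b = 0.
  have h : is_derive (0 : R) 1 c 0.
    apply: (@derive1_at_max _ c (- e) e 0); first by rewrite ge0_cp//; exact: ltW.
    - move=> t; rewrite in_itv /= => te.
      by have [] := inball t; rewrite ?ltr_norml// => -[].
    - by rewrite in_itv /= oppr_lt0 e0.
    - move=> t; rewrite in_itv /= => te.
      by have [] := inball t; rewrite ?ltr_norml.
  by rewrite -c10 -(@derive_val _ _ _ _ _ _ _ dc0) (@derive_val _ _ _ _ _ _ _ h).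
split=> //; rewrite leNgt; apply/negP => d0.
have [D0 dE] := dc.
have : (fun h : R => h^-1 *: ((c1 \o shift 0) (h *: 1) - c1 0)) @ 0^' --> d.
  by rewrite -dE; exact: D0.
move/cvgr_gt => /(_ _ d0).
rewrite near_withinE => /nbhs_ballP[r /= r0 hr].
pose s := Num.min e r / 2.
have s0 : 0 < s by rewrite divr_gt0// lt_min e0 r0.
have se : s < e.
  have : Num.min e r <= e by rewrite ge_min lexx.
  rewrite /s; have : 0 < Num.min e r by rewrite lt_min e0 r0.
  lra.
have sr : s < r.
  have : Num.min e r <= r by rewrite ge_min lexx orbT.
  rewrite /s; have : 0 < Num.min e r by rewrite lt_min e0 r0.
  lra.
have [||x xs] := @MVT _ c c1 0 s s0.
- move=> x; rewrite in_itv /= => /andP[x0 xs].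
  suff : `|x| < e by move=> /inball[].
  by rewrite gtr0_norm// (lt_trans xs).
- apply: derivable_within_continuous => x; rewrite in_itv /= => /andP[x0 xs].
  suff : `|x| < e by move=> /inball[[]].
  by rewrite ger0_norm// (le_lt_trans xs).
move: xs; rewrite in_itv /= => /andP[x0 xs].
have c1x : 0 < c1 x.
  have := hr x; rewrite /ball /= sub0r normrN gtr0_norm// => /(_ (lt_trans xs sr)).
  rewrite gt_eqF// => /(_ isT).
  rewrite /GRing.scale /= mulr1 addr0 c10 b0 subr0 pmulr_rgt0// invr_gt0//.
have [_ cs] := inball s ltac:(by rewrite gtr0_norm).
rewrite subr0 => h.
have : 0 < c s - c 0 by rewrite h mulr_gt0.
by rewrite subr_gt0 ltNge cs.
Qed.

End TwoJets.

Section BarrierJets.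
Variable R : realType.
Implicit Types (F : R -> R -> R -> R) (J : jet R) (tau x y t : R).

(* Second order differentiability tested along all curves, which is all that the
   chain rule requires. *)
Definition has_jet F x y t J :=
  forall cx cy ct x1 x2 y1 y2 t1 t2,
    curve_jet cx x x1 x2 -> curve_jet cy y y1 y2 -> curve_jet ct t t1 t2 ->
    curve_jet (fun s => F (cx s) (cy s) (ct s)) (F x y t)
      (jet_linear J (x1, y1, t1))
      (jet_bilinear J (x1, y1, t1) (x1, y1, t1) + jet_linear J (x2, y2, t2)).

Definition catenoid_barrier (k x2 om tm x y t : R) :=
  y / cos (om * (t - tm)) - k * (x - x2) ^+ 2.

Lemma has_jet_catenoid k x2 om tm x y t :
  let c := cos (om * (t - tm)) in let s := sin (om * (t - tm)) in
  c != 0 ->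
  has_jet (catenoid_barrier k x2 om tm) x y t
    (catenoid_jet k (x - x2) y c^-1 (om * s / c ^+ 2)
       (om ^+ 2 * (c^-1 + 2 * s ^+ 2 / c ^+ 3))).
Proof.
move=> c s c0 cx cy ct x1 x2' y1 y2 t1 t2 hx hy ht.
have h1 := curve_jetV c0 (curve_jet_cos (curve_jetZ om (curve_jetB ht (curve_jet_cst tm)))).
have h2 := curve_jetZ k (curve_jet_sqr (curve_jetB hx (curve_jet_cst x2))).
apply: curve_jet_eq (curve_jetB (curve_jetM hy h1) h2) _ _ _ => //;
  rewrite /jet_linear /jet_bilinear /vx /vy /vt /= -/c -/s; by field.
Qed.

Definition log_barrier (M e N x y t : R) :=
  e * t - 24^-1 * ln (1 + N * (y / (M * x ^+ 2 + y ^+ 2))).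

Definition log_jet (M e N x y : R) : jet R :=
  let S := M * x ^+ 2 + y ^+ 2 in
  let z := N * (y / S) in
  let zx := N * (- (2 * M * x * y) / S ^+ 2) in
  let zy := N * ((M * x ^+ 2 - y ^+ 2) / S ^+ 2) in
  let zxx := N * (M * y * (6 * M * x ^+ 2 - 2 * y ^+ 2) / S ^+ 3) in
  let zyy := N * (y * (2 * y ^+ 2 - 6 * M * x ^+ 2) / S ^+ 3) in
  let zxy := N * (2 * M * x * (3 * y ^+ 2 - M * x ^+ 2) / S ^+ 3) in
  let ep := 24^-1 in
  Jet (- (ep * (zx / (1 + z)))) (- (ep * (zy / (1 + z)))) e
    (- (ep * (zxx / (1 + z) - zx ^+ 2 / (1 + z) ^+ 2)))
    (- (ep * (zyy / (1 + z) - zy ^+ 2 / (1 + z) ^+ 2))) 0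
    (- (ep * (zxy / (1 + z) - zx * zy / (1 + z) ^+ 2))) 0 0.

Lemma has_jet_log M e N x y t : 0 < y -> 0 < M -> 0 < N ->
  has_jet (log_barrier M e N) x y t (log_jet M e N x y).
Proof.
move=> y0 M0 N0 cx cy ct x1 x2 y1 y2 t1 t2 hx hy ht.
have S0 : 0 < M * x ^+ 2 + y ^+ 2.
  by rewrite ltr_wpDl ?exprn_gt0// mulr_ge0 ?sqr_ge0// ltW.
have z0 : 0 < 1 + N * (y / (M * x ^+ 2 + y ^+ 2)).
  by rewrite ltr_wpDl// mulr_gt0// divr_gt0.
have hS := curve_jetD (curve_jetZ M (curve_jet_sqr hx)) (curve_jet_sqr hy).
have hz := curve_jetD (curve_jet_cst 1)
  (curve_jetZ N (curve_jetM hy (curve_jetV (lt0r_neq0 S0) hS))).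
have hl := curve_jetZ (24^-1) (curve_jet_ln z0 hz).
have z0' : M * x ^+ 2 + y ^+ 2 + N * y != 0.
  by rewrite gt_eqF// ltr_wpDr// mulr_ge0// ltW.
have S0' := lt0r_neq0 S0.
apply: curve_jet_eq (curve_jetB (curve_jetZ e ht) hl) _ _ _ => //;
  rewrite /jet_linear /jet_bilinear /vx /vy /vt /=; field.
all: by rewrite ?z0' ?S0'.
Qed.

(** Positivity for every N > 0 is the point: N is later taken large to absorb the twist of the
    inversion. *)
Lemma log_jet_curvature_gt0 tau (e N x y : R) : 0 < y -> 0 < N -> e ^+ 2 = 1 ->
  0 < level_curvature tau y (log_jet (1 + 4 * tau ^+ 2) e N x y).
Proof.
move=> y0 N0 e2; set M := 1 + 4 * tau ^+ 2.
have M0 : 0 < M by apply: ltr_wpDr => //; exact: mulr_ge0 (ler0n _ _) (sqr_ge0 _).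
have S0 : 0 < M * x ^+ 2 + y ^+ 2.
  by rewrite ltr_wpDl ?exprn_gt0// mulr_ge0 ?sqr_ge0// ltW.
have Ny0 : 0 < N * y by rewrite mulr_gt0.
have z0 : 0 < M * x ^+ 2 + y ^+ 2 + N * y by rewrite addr_gt0.
have S0' := lt0r_neq0 S0; have z0' := lt0r_neq0 z0; have M0' := lt0r_neq0 M0.
set S := M * x ^+ 2 + y ^+ 2 in S0 z0 S0' z0'.
apply: (@log_barrier_curvature_gt0 _ tau y e (24^-1 * (N * y / (S + N * y)))
  ((M * x ^+ 2 - y ^+ 2) / S) (- (2 * M * x * y) / S) 24^-1) => //.
- by rewrite mulr_gt0 ?invr_gt0// divr_gt0.
- by rewrite ler_piMr ?invr_ge0// ler_pdivrMr// mul1r lerDr ltW.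
- by rewrite -/M; rewrite /S in S0' *; field.
- exact: lt0r_neq0.
all: by rewrite /log_jet /= -/M /S in S0' z0' *; field; rewrite ?z0' ?S0' ?M0'.
Qed.

(** pi / 2 - atan ((x - x0) / y) is the argument of z - x0 in ]0, pi[, in a form smooth on the whole
    half-plane. *)
Definition inversion F (tau x0 x y t : R) :=
  let r := (x - x0) ^+ 2 + y ^+ 2 in
  F (- (x - x0) / r) (y / r) (t + 4 * tau * (pi / 2 - atan ((x - x0) / y))).

Lemma has_jet_inversion F tau x0 x y t J : 0 < y ->
  let r := (x - x0) ^+ 2 + y ^+ 2 in
  has_jet F (- (x - x0) / r) (y / r)
    (t + 4 * tau * (pi / 2 - atan ((x - x0) / y))) J ->
  has_jet (inversion F tau x0) x y t (inversion_jet tau (x - x0) y J).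
Proof.
move=> y0 r hF cx cy ct x1 x2 y1 y2 t1 t2 hx hy ht.
have r0 : r != 0 by rewrite gt_eqF// ltr_wpDl ?sqr_ge0// exprn_gt0.
have y0' := lt0r_neq0 y0.
have hx' : curve_jet (fun s => cx s - x0) (x - x0) x1 x2.
  by apply: curve_jet_eq (curve_jetB hx (curve_jet_cst x0)) _ _ _; rewrite ?subr0.
have hr := curve_jetV r0 (curve_jetD (curve_jet_sqr hx') (curve_jet_sqr hy)).
have hX := curve_jetM (curve_jetN hx') hr.
have hY := curve_jetM hy hr.
have ha := curve_jet_atan (curve_jetM hx' (curve_jetV y0' hy)).
have hT := curve_jetD ht (curve_jetZ (4 * tau) (curve_jetB (curve_jet_cst (pi / 2)) ha)).
have yr : y ^+ 2 + (x - x0) ^+ 2 != 0 by rewrite addrC.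
apply: curve_jet_eq (hF _ _ _ _ _ _ _ _ _ hX hY hT) _ _ _ => //;
  clear hF hr hX hY; rewrite /r in r0 *; clear r; case: J => fx fy ft fxx fyy ftt fxy fxt fyt;
  rewrite /jet_linear /jet_bilinear /vx /vy /vt /= ; move: (x - x0) r0 yr => w r0 yr; field.
all: by rewrite ?yr ?r0 ?y0'.
Qed.

End BarrierJets.

(** * The maximum principle for minimal surfaces *)

Section LineDerivative.
Variables (R : realType) (V : normedModType R).
Implicit Types (f : V -> R) (p v : V).

Let lineE f p v :
  (fun h : R => h^-1 *: ((fun s : R => f (p + s *: v)) (h *: 1 + 0)
     - (fun s : R => f (p + s *: v)) 0)) =
  (fun h : R => h^-1 *: ((f \o shift p) (h *: v) - f p)).
Proof.
apply/funext => h /=; rewrite scale0r addr0 [h%:A]mulr1 addr0.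
by rewrite [p + _]addrC.
Qed.

Lemma derivable_line f p v :
  derivable f p v <-> derivable (fun s : R => f (p + s *: v)) (0 : R) 1.
Proof. by rewrite /derivable /= -lineE. Qed.

Lemma derive_line f p v :
  'D_v f p = 'D_1 (fun s : R => f (p + s *: v)) (0 : R).
Proof. by rewrite /derive /= -lineE. Qed.

Lemma is_derive_line f p v d : is_derive p v f d <->
  is_derive (0 : R) 1 (fun s : R => f (p + s *: v)) d.
Proof.
split=> -[df dE]; split.
- by apply/derivable_line.
- by rewrite -derive_line.
- by apply/derivable_line.
- by rewrite derive_line.
Qed.

End LineDerivative.

Lemma is_derive_line_at (R : realType) (V : normedModType R) (f : V -> R) (p v : V) (s d : R) : is_derive (p + s *: v) v f d ->
  is_derive s 1 (fun s : R => f (p + s *: v)) d.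
Proof.
move=> /is_derive_line h; apply: (is_derive_line (fun s0 : R => f (p + s0 *: v)) s 1 d).2.
suff -> : (fun h : R => f (p + (s + h *: 1) *: v)) =
  (fun h : R => f (p + s *: v + h *: v)) by [].
by apply/funext => r; rewrite [r%:A]mulr1 scalerDl addrA.
Qed.

Lemma ord3_ind (P : 'I_3 -> Prop) : P 0 -> P 1 -> P 2 -> forall i, P i.
Proof.
move=> P0 P1 P2 [[|[|[|//]]] ilt].
- by have -> : Ordinal ilt = 0 by exact: val_inj.
- by have -> : Ordinal ilt = 1 by exact: val_inj.
- by have -> : Ordinal ilt = 2 by exact: val_inj.
Qed.

Lemma sum_ord3 (V : nmodType) (f : 'I_3 -> V) :
  \sum_i f i = f 0 + f 1 + f 2.
Proof.
rewrite big_ord_recr big_ord_recr big_ord_recr big_ord0 /= add0r.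
by congr (f _ + f _ + f _); exact: val_inj.
Qed.

Lemma sum_ord2 (V : nmodType) (f : 'I_2 -> V) : \sum_i f i = f 0 + f 1.
Proof.
rewrite big_ord_recr big_ord_recr big_ord0 /= add0r.
by congr (f _ + f _); exact: val_inj.
Qed.

(** * The metric and its connection in closed form *)

Section MetricFormulas.
Variables (R : realType) (tau : R).
Implicit Types (p v w : 'rV[R]_3).

Definition coords v : R * R * R := (v 0 0, v 0 1, v 0 2).

Definition metric_entries (y : R) : 'M[R]_3 :=
  \matrix_(i, j) metric_form tau y (coords (delta_mx 0 i)) (coords (delta_mx 0 j)).

Lemma metricE p : 0 < ycoord p -> metric tau p = metric_entries (ycoord p).
Proof.
move=> y0; have y0' := lt0r_neq0 y0.
have lx : lambda_x (xcoord p) (ycoord p) = 0 by rewrite /lambda_x derive1_cst.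
have ly : lambda_y (xcoord p) (ycoord p) = - (ycoord p) ^- 2.
  rewrite /lambda_y derive1E.
  have := @is_deriveV _ id _ _ 1 y0' (is_derive_id (ycoord p) 1).
  by case=> _ /=; rewrite /GRing.scale /= mulr1.
apply/matrixP => i j; rewrite /metric /theta lx ly.
have e (a b : 'I_3) : (delta_mx 0 a : 'rV[R]_3) 0 b = (b == a)%:R.
  by rewrite mxE eqxx.
rewrite !mxE !big_ord1 /metric_form /coords /vx /vy /vt /= /lambda !mxE /=.
by elim/ord3_ind : i; elim/ord3_ind : j; rewrite /=; field.
Qed.

Lemma innerE p v w : 0 < ycoord p ->
  inner tau p v w = metric_form tau (ycoord p) (coords v) (coords w).
Proof.
move=> y0; have y0' := lt0r_neq0 y0; rewrite /inner metricE//.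
rewrite mxE sum_ord3 !mxE !sum_ord3 /metric_entries !mxE.
rewrite /metric_form /coords /vx /vy /vt /= !mxE /=.
by field.
Qed.

Definition cometric_entries (y : R) : 'M[R]_3 := \matrix_(i, j)
  (y ^+ 2 * ((i == 0)%:R * (j == 0)%:R + (i == 1)%:R * (j == 1)%:R)
   + (1 + 4 * tau ^+ 2) * ((i == 2)%:R * (j == 2)%:R)
   + 2 * tau * y * ((i == 0)%:R * (j == 2)%:R + (i == 2)%:R * (j == 0)%:R)).

Lemma invmx_metric p : 0 < ycoord p ->
  invmx (metric tau p) = cometric_entries (ycoord p).
Proof.
move=> y0; have y0' := lt0r_neq0 y0; rewrite metricE//.
have h : metric_entries (ycoord p) *m cometric_entries (ycoord p) = 1%:M.
  apply/matrixP => i j; rewrite !mxE sum_ord3 !mxE /=.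
  rewrite /metric_form /coords /vx /vy /vt /= !mxE /=.
  by elim/ord3_ind : i; elim/ord3_ind : j; rewrite /=; field.
have [u _] := mulmx1_unit h.
by rewrite -[LHS]mulmx1 -h mulKmx.
Qed.

Lemma curve_jet_is_derive (f : R -> R) a b d : curve_jet f a b d ->
  is_derive (0 : R) 1 f b.
Proof. by move=> [_ [f' [nf <- _]]]; exact: nbhs_singleton nf. Qed.

Lemma curve_jet_affine (a b : R) : curve_jet (fun s => a + s * b) a b 0.
Proof.
split; first by rewrite mul0r addr0.
exists (cst b); split => //; last exact: is_derive_cst.
near=> s.
have h1 : is_derive s 1 (fun s : R => s * b) b.
  have -> : (fun s : R => s * b) = (id : R -> R) * cst b by apply/funext.
  apply: is_derive_eq (is_deriveM (is_derive_id s 1) (is_derive_cst b s 1)) _.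
  by rewrite /GRing.scale /= mulr1 mulr0 add0r.
have h2 : is_derive s 1 (cst a : R -> R) 0 by exact: is_derive_cst.
by apply: is_derive_eq (is_deriveD h2 h1) _; rewrite add0r.
Unshelve. all: by end_near. Qed.

Definition dmetric_entries (y : R) : 'M[R]_3 := \matrix_(i, j)
  (- (2 * (1 + 4 * tau ^+ 2) / y ^+ 3) * ((i == 0)%:R * (j == 0)%:R)
   - 2 / y ^+ 3 * ((i == 1)%:R * (j == 1)%:R)
   + 2 * tau / y ^+ 2 * ((i == 0)%:R * (j == 2)%:R + (i == 2)%:R * (j == 0)%:R)).

Lemma ycoord_gt0_near p : 0 < ycoord p -> \near p, 0 < ycoord p.
Proof.
move=> y0; have := @coord_continuous R 1 3 0 1 p.
by move=> /(_ _ (lt_nbhsr y0)).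
Qed.

(** The metric depends on y alone, so only the derivative in y survives; along a coordinate line its
    entries are rational functions of one variable. *)
Lemma partial_metricE i j l p : 0 < ycoord p ->
  partial_metric tau i j l p = (i == 1)%:R * dmetric_entries (ycoord p) j l.
Proof.
move=> y0; have y0' := lt0r_neq0 y0; rewrite /partial_metric.
rewrite (@near_eq_derive _ _ _ _ (fun q => metric_entries (ycoord q) j l)); last first.
  by near=> q; rewrite metricE//; near: q; exact: ycoord_gt0_near.
rewrite derive_line.
set y := ycoord p in y0 y0' *.
pose c : R := (1 == i)%:R.
have -> : (fun s : R => metric_entries (ycoord (p + s *: delta_mx 0 i)) j l) =
  (fun s => ((1 + 4 * tau ^+ 2) * ((0 == j)%:R * (0 == l)%:R) + (1 == j)%:R * (1 == l)%:R)
     * ((y + s * c) ^+ 2)^-1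
   + (((2 == j)%:R * (2 == l)%:R)
   - (2 * tau * ((0 == j)%:R * (2 == l)%:R + (2 == j)%:R * (0 == l)%:R))
     * (y + s * c)^-1)).
  apply/funext => s; rewrite /metric_entries !mxE /metric_form /coords /vx /vy /vt /=.
  have -> : ycoord (p + s *: delta_mx 0 i) = y + s * c by rewrite /ycoord !mxE.
  rewrite !mxE /=.
  by move: ((y + s * c)^-1) ((y + s * c) ^- 2) => a b; ring.
have hy := curve_jet_affine y c.
have y2 : y ^+ 2 != 0 by rewrite expf_neq0.
have := curve_jet_is_derive (curve_jetD (curve_jetZ
  ((1 + 4 * tau ^+ 2) * ((0 == j)%:R * (0 == l)%:R) + (1 == j)%:R * (1 == l)%:R)
    (curve_jetV y2 (curve_jet_sqr hy)))
  (curve_jetB (curve_jet_cst ((2 == j)%:R * (2 == l)%:R)) (curve_jetZ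
   (2 * tau * ((0 == j)%:R * (2 == l)%:R + (2 == j)%:R * (0 == l)%:R))
   (curve_jetV y0' hy)))).
case=> _ ->; rewrite /dmetric_entries !mxE /c.
have E (a b : 'I_3) : (a == b)%:R = (b == a)%:R :> R by rewrite eq_sym.
rewrite (E 1 i) (E 0 j) (E 1 j) (E 2 j) (E 0 l) (E 1 l) (E 2 l).
by field.
Unshelve. all: by end_near. Qed.

Lemma christoffelE k i j p : 0 < ycoord p ->
  christoffel tau k i j p = 2^-1 * \sum_(l < 3) cometric_entries (ycoord p) k l *
    ((i == 1)%:R * dmetric_entries (ycoord p) j l
     + (j == 1)%:R * dmetric_entries (ycoord p) i l
     - (l == 1)%:R * dmetric_entries (ycoord p) i j).
Proof.
move=> y0; rewrite /christoffel invmx_metric//; congr (_ * _).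
by apply: eq_bigr => l _; rewrite !partial_metricE.
Qed.

Definition christoffel_entries (y : R) (k i j : 'I_3) : R :=
  let d (a b : 'I_3) : R := (i == a)%:R * (j == b)%:R in
  let m := 1 + 4 * tau ^+ 2 in
  [:: (2 * tau ^+ 2 - m) / y * (d 0 1 + d 1 0) + tau * (d 1 2 + d 2 1);
      m / y * d 0 0 - tau * (d 0 2 + d 2 0) - y^-1 * d 1 1;
      - (tau * m / y ^+ 2) * (d 0 1 + d 1 0)
        + 2 * tau ^+ 2 / y * (d 1 2 + d 2 1)]`_k.

Lemma christoffel_entriesE k i j p : 0 < ycoord p ->
  christoffel tau k i j p = christoffel_entries (ycoord p) k i j.
Proof.
move=> y0; rewrite christoffelE//; have y0' := lt0r_neq0 y0.
rewrite sum_ord3 /cometric_entries /dmetric_entries !mxE.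
move: (ycoord p) y0' => y y0'.
elim/ord3_ind : k; elim/ord3_ind : i; elim/ord3_ind : j;
  rewrite /christoffel_entries /=; by field.
Qed.

Lemma christoffel_formE p v w : 0 < ycoord p ->
  coords (\row_(k < 3) \sum_(a < 3) \sum_(b < 3)
     christoffel tau k a b p * v 0 a * w 0 b) =
  christoffel_form tau (ycoord p) (coords v) (coords w).
Proof.
move=> y0; have y0' := lt0r_neq0 y0.
have E k : \sum_(a < 3) \sum_(b < 3) christoffel tau k a b p * v 0 a * w 0 b =
  \sum_(a < 3) \sum_(b < 3) christoffel_entries (ycoord p) k a b * v 0 a * w 0 b.
  by do 2 (apply: eq_bigr => ? _); rewrite christoffel_entriesE.
rewrite /coords /christoffel_form /vx /vy /vt /= !mxE !E !sum_ord3.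
rewrite /christoffel_entries /=.
move: (ycoord p) y0' => y y0'.
by congr (_, _, _); field.
Qed.

End MetricFormulas.

(** * Directional derivatives of charts *)

Section DirectionalDerivatives.
Variables (R : realType) (V : normedModType R).
Implicit Types (f : V -> R) (u v w : V) (U : set V).

Lemma continuous_line u v : continuous (fun s : R => u + s *: v).
Proof.
by move=> s; apply: cvgD; [exact: cvg_cst|apply: cvgZr_tmp; exact: cvg_id].
Qed.

Lemma is_deriveZdir f u v (k d : R) : is_derive u v f d ->
  is_derive u (k *: v) f (k * d).
Proof.
move=> /is_derive_line h; apply/is_derive_line.
have -> : (fun s : R => f (u + s *: (k *: v))) =
  (fun s => f (u + s *: v)) \o (fun s => s * k).
  by apply/funext => s /=; rewrite scalerA.
rewrite mulrC; apply: is_derive1_comp; rewrite ?mul0r//.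
have h1 := curve_jet_is_derive (curve_jet_affine 0 k).
have <- : (fun s => 0 + s * k) = (fun s : R => s * k).
  by apply/funext => s; rewrite add0r.
exact: h1.
Qed.

(* Continuity of the derivative in the direction w lets the mean value theorem
   along w replace total differentiability. *)
Lemma deriveDdir f U u v w : open U -> U u ->
  (forall u v, U u -> derivable f u v) -> {for u, continuous ('D_w f)} ->
  'D_(v + w) f u = 'D_v f u + 'D_w f u.
Proof.
move=> oU Uu df cw.
apply/eqP; rewrite -subr_eq0 -normr_le0; apply/ler_addgt0Pr => e e0.
rewrite add0r.
have e2 : 0 < e / 3 by rewrite divr_gt0.
have [dvw _] := (df u (v + w) Uu, tt); have [dv _] := (df u v Uu, tt).
have near1 : \forall h \near (0 : R)^',
    `|'D_(v + w) f u - h^-1 *: (f (h *: (v + w) + u) - f u)| < e / 3.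
  by move: dvw => /cvgrPdist_lt /(_ _ e2).
have near2 : \forall h \near (0 : R)^',
    `|'D_v f u - h^-1 *: (f (h *: v + u) - f u)| < e / 3.
  by move: dv => /cvgrPdist_lt /(_ _ e2).
have near3 : \forall z \near u, U z /\ `|'D_w f u - 'D_w f z| < e / 3.
  apply: filterI; first exact: open_nbhs_nbhs.
  by move: cw => /cvgrPdist_lt /(_ _ e2).
have near4 : \forall p \near ((0 : R), (0 : R)),
    U (u + p.1 *: v + p.2 *: w) /\
    `|'D_w f u - 'D_w f (u + p.1 *: v + p.2 *: w)| < e / 3.
  have c : {for ((0 : R), (0 : R)), continuous (fun p : R * R => u + p.1 *: v + p.2 *: w)}.
    apply: cvgD; first apply: cvgD; first exact: cvg_cst.
      by apply: cvgZr_tmp; exact: cvg_fst.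
    by apply: cvgZr_tmp; exact: cvg_snd.
  apply: (c (fun z => U z /\ `|'D_w f u - 'D_w f z| < e / 3)).
  by rewrite /= !scale0r !addr0.
move: near4 => /nbhs_ballP[r /= r0 hr].
move: near1; rewrite near_withinE => /nbhs_ballP[r1 /= r10 hr1].
move: near2; rewrite near_withinE => /nbhs_ballP[r2 /= r20 hr2].
(* One increment h serves both difference quotients and keeps the segment from u + h v to u + h (v +
   w) where ['D_w f] is within e / 3 of its value at u. *)
pose h := Num.min r (Num.min r1 r2) / 2.
have m0 : 0 < Num.min r (Num.min r1 r2) by rewrite !lt_min r0 r10.
have h0 : 0 < h by rewrite divr_gt0.
have [hr' hr1' hr2'] : [/\ h < r, h < r1 & h < r2].
  have : Num.min r (Num.min r1 r2) <= r /\ Num.min r (Num.min r1 r2) <= r1 /\ Num.min r (Num.min r1 r2) <= r2.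
    by rewrite !ge_min !lexx !orbT.
  rewrite /h; move: (Num.min _ _) m0 => m m0 [? [? ?]]; split; lra.
have H1 := hr1 h; rewrite /ball /= sub0r normrN gtr0_norm// in H1.
have {}H1 := H1 hr1' (lt0r_neq0 h0).
have H2 := hr2 h; rewrite /ball /= sub0r normrN gtr0_norm// in H2.
have {}H2 := H2 hr2' (lt0r_neq0 h0).
have H4 (s : R) : 0 <= s <= h -> U (u + h *: v + s *: w) /\
    `|'D_w f u - 'D_w f (u + h *: v + s *: w)| < e / 3.
  move=> /andP[s0 sh]; apply: (hr (h, s)); split; rewrite /ball /= sub0r normrN.
    by rewrite gtr0_norm.
  by rewrite ger0_norm// (le_lt_trans sh).
have dl (s : R) : 0 <= s <= h ->
  is_derive s (1 : R) (fun s : R => f (u + h *: v + s *: w)) ('D_w f (u + h *: v + s *: w)).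
  move=> /H4[Us _]; apply: is_derive_line_at; apply/derivableP; exact: df.
have [||s] := @MVT _ (fun s : R => f (u + h *: v + s *: w))
    (fun s : R => 'D_w f (u + h *: v + s *: w)) 0 h h0.
- by move=> s; rewrite in_itv /= => /andP[s0 sh]; apply: dl; rewrite !ltW.
- apply: derivable_within_continuous => s; rewrite in_itv /= => sh.
  by have [] := dl s sh.
rewrite in_itv /= => /andP[s0 sh]; rewrite subr0 scale0r addr0 => E.
have [_ H3] := H4 s ltac:(by rewrite !ltW).
move: H1; rewrite (scalerDr h v w).
have -> : h *: v + h *: w + u = u + h *: v + h *: w by rewrite addrC addrA.
have -> : f (u + h *: v + h *: w) =
  'D_w f (u + h *: v + s *: w) * h + f (u + h *: v) by rewrite -E subrK.
move: H2; rewrite (addrC (h *: v) u).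
move: ('D_w f (u + h *: v + s *: w)) H3 => D H3.
rewrite /GRing.scale /=.
have -> : h^-1 * (D * h + f (u + h *: v) - f u) = D + h^-1 * (f (u + h *: v) - f u).
  by field; exact: lt0r_neq0.
move: H3 (h^-1 * _) => + q; rewrite !ltr_norml ler_norml.
move: ('D_(v + w) f u) ('D_v f u) ('D_w f u) => A B C.
move=> /andP[h1 h2] /andP[h3 h4] /andP[h5 h6]; clear -h1 h2 h3 h4 h5 h6.
by apply/andP; split; lra.
Qed.

End DirectionalDerivatives.

Section ChartLines.
Variables (R : realType).
Implicit Types (U : set 'rV[R]_2) (F : 'rV[R]_2 -> 'rV[R]_3).

Lemma is_derive_coord F u v (k : 'I_3) : derivable F u v ->
  is_derive u v (fun u => F u 0 k) ('D_v F u 0 k).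
Proof.
move=> dF; split; first exact: (derivable_mxP F u v).1.
by rewrite derive_mx// mxE.
Qed.

Lemma row2E (v : 'rV[R]_2) : v = v 0 0 *: delta_mx 0 0 + v 0 1 *: delta_mx 0 1.
Proof.
apply/matrixP => i j; rewrite !mxE ord1 /=; case: j => -[|[|//]] ilt.
- have -> : Ordinal ilt = 0 by exact: val_inj.
  by rewrite mulr1 mulr0 addr0.
- have -> : Ordinal ilt = 1 by exact: val_inj.
  by rewrite mulr1 mulr0 add0r.
Qed.

Lemma C1_derive_linear U F u v : open U -> Ck 1 U F -> U u ->
  'D_v F u = v 0 0 *: 'D_(delta_mx 0 0) F u + v 0 1 *: 'D_(delta_mx 0 1) F u.
Proof.
move=> oU [dF cF] Uu; apply/matrixP => i k; rewrite ord1 => {i}.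
have dZ w (c : R) : is_derive u (c *: w) (fun u => F u 0 k) (c * 'D_w F u 0 k).
  by apply: is_deriveZdir; apply: is_derive_coord; exact: dF.
have dE w : 'D_w F u 0 k = 'D_w (fun u => F u 0 k) u.
  by rewrite derive_mx ?mxE//; exact: dF.
rewrite dE {1}(row2E v) (@deriveDdir _ _ _ U)//.
- have E w c := @derive_val _ _ _ _ _ _ _ (dZ w c).
  by rewrite [RHS]mxE; congr (_ + _); rewrite [RHS]mxE; exact: E.
- by move=> w w' Uw; exact: (derivable_mxP F w w').1 (dF _ _ Uw) _ _.
- set w := v 0 1 *: delta_mx 0 1.
  have nE : \forall z \near u, 'D_w F z 0 k = 'D_w (fun u => F u 0 k) z.
    near=> z.
    have Uz : U z by near: z; exact: open_nbhs_nbhs.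
    by rewrite derive_mx ?mxE//; exact: dF.
  have c1 : {for u, continuous (fun z => 'D_w F z 0 k)}.
    have h1 : {for u, continuous ('D_w F)} by exact: cF.
    exact: (continuous_comp h1 (@coord_continuous R 1 3 0 k _)).
  rewrite /prop_for /continuous_at -(nbhs_singleton nE).
  apply: cvg_trans c1; exact: (@near_eq_cvg _ _ (nbhs u) _ _ _ nE).
Unshelve. all: by end_near. Qed.

Definition second (F : 'rV[R]_2 -> 'rV[R]_3) (i j : 'I_2) u : 'rV[R]_3 :=
  'D_(delta_mx 0 i) (tangent F j) u.

Lemma smooth_on_derive U F v : smooth_on U F -> smooth_on U ('D_v F).
Proof. by move=> sF k; have [_ /(_ v)] := sF k.+1. Qed.

Lemma second_derive_quadratic U F u v : open U -> smooth_on U F -> U u ->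
  'D_v ('D_v F) u = v 0 0 ^+ 2 *: second F 0 0 u
    + (v 0 0 * v 0 1) *: (second F 0 1 u + second F 1 0 u)
    + v 0 1 ^+ 2 *: second F 1 1 u.
Proof.
move=> oU sF Uu.
have nE : \near u, 'D_v F u = v 0 0 *: tangent F 0 u + v 0 1 *: tangent F 1 u.
  near=> z.
  have Uz : U z by near: z; exact: open_nbhs_nbhs.
  exact: C1_derive_linear oU (sF 1%N) Uz.
rewrite (near_eq_derive _ nE).
have dT i w : derivable (tangent F i) u w.
  by have [+ _] := smooth_on_derive (delta_mx 0 i) sF 1%N; exact.
have D i : is_derive u v (tangent F i)
    (v 0 0 *: second F 0 i u + v 0 1 *: second F 1 i u).
  split; first exact: dT.
  exact: C1_derive_linear v oU (smooth_on_derive (delta_mx 0 i) sF 1%N) Uu.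
have [_ E] := is_deriveD (is_deriveZ (v 0 0) (D 0)) (is_deriveZ (v 0 1) (D 1)).
apply: (etrans E); clear.
move: (second F 0 0 u) (second F 0 1 u) (second F 1 0 u) (second F 1 1 u).
move: (v 0 0) (v 0 1) => a b A B C D.
rewrite !scalerDr !scalerA -!expr2 (mulrC b a) addrACA !addrA.
by rewrite addrAC.
Unshelve. all: by end_near. Qed.

Lemma curve_jet_chart U F u v k : open U -> smooth_on U F -> U u ->
  curve_jet (fun s : R => F (u + s *: v) 0 k) (F u 0 k) ('D_v F u 0 k)
    ('D_v ('D_v F) u 0 k).
Proof.
move=> oU sF Uu; split; first by rewrite scale0r addr0.
exists (fun s : R => 'D_v F (u + s *: v) 0 k); split.
- have : \forall s \near (0 : R), U (u + s *: v).
    apply: (@continuous_line R _ u v 0 U); rewrite /= scale0r addr0.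
    exact: open_nbhs_nbhs.
  apply: filterS => s Us; apply: (is_derive_line_at (f := fun u => F u 0 k)).
  by apply: is_derive_coord; have [+ _] := sF 1%N; exact.
- by rewrite scale0r addr0.
- apply: (is_derive_line (fun u => 'D_v F u 0 k) u v _).1.
  by apply: is_derive_coord; have [+ _] := smooth_on_derive v sF 1%N; exact.
Qed.

End ChartLines.

Section MetricPositive.
Variables (R : realType) (tau y : R).
Hypothesis y0 : y != 0.
Implicit Types u v : R * R * R.

Lemma metric_form_ge0 u : 0 <= metric_form tau y u u.
Proof.
have [a [b [c ->]]] := frame_decomp tau u y0.
by rewrite metric_formE// -!expr2 !addr_ge0 ?sqr_ge0.
Qed.

Lemma metric_form_eq0 u : metric_form tau y u u = 0 -> u = (0, 0, 0).
Proof.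
have [a [b [c ->]]] := frame_decomp tau u y0.
rewrite metric_formE// -!expr2 => /eqP.
rewrite paddr_eq0 ?addr_ge0 ?sqr_ge0// paddr_eq0 ?sqr_ge0// !sqrf_eq0.
by move=> /andP[/andP[/eqP-> /eqP->] /eqP->]; rewrite !mulr0 addr0.
Qed.

Lemma metric_formC u v : metric_form tau y u v = metric_form tau y v u.
Proof. by rewrite /metric_form; ring. Qed.

End MetricPositive.

(** The explicit matrix is the adjugate of the symmetric matrix with diagonal a, c and off-diagonal
    entry b; with d the inverse determinant, this is a trace against the inverse first fundamental
    form. *)
Lemma mxtrace_adj2 (R : realType) (d a b c : R) (M : 'M[R]_2) :
  \tr ((d *: \matrix_(i, j) (if i == j then (if i == 0 then c else a) else - b)) *m M) =
  d * (c * M 0 0 - b * (M 0 1 + M 1 0) + a * M 1 1).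
Proof. by rewrite /mxtrace sum_ord2 !mxE !sum_ord2 !mxE /=; ring. Qed.

Section CoordsLinear.
Variables (R : realType) (tau y : R) (J : jet R).
Implicit Types v w : 'rV[R]_3.

Lemma coords_eq0 v : coords v = (0, 0, 0) -> v = 0.
Proof.
case=> h0 h1 h2; apply/matrixP => i k; rewrite ord1 [RHS]mxE.
by elim/ord3_ind : k.
Qed.

Lemma jet_linearD v w : jet_linear J (coords (v + w)) =
  jet_linear J (coords v) + jet_linear J (coords w).
Proof. by rewrite /jet_linear /coords /vx /vy /vt /= !mxE; ring. Qed.

Lemma jet_linearZ (a : R) v : jet_linear J (coords (a *: v)) =
  a * jet_linear J (coords v).
Proof. by rewrite /jet_linear /coords /vx /vy /vt /= !mxE; ring. Qed.

Lemma jet_bilinear_comb (a b : R) v w :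
  jet_bilinear J (coords (a *: v + b *: w)) (coords (a *: v + b *: w)) =
  a ^+ 2 * jet_bilinear J (coords v) (coords v)
  + a * b * (jet_bilinear J (coords v) (coords w) + jet_bilinear J (coords w) (coords v))
  + b ^+ 2 * jet_bilinear J (coords w) (coords w).
Proof. by rewrite /jet_bilinear /coords /vx /vy /vt /= !mxE; ring. Qed.

Lemma jet_second_comb (a b : R) v w (y00 y01 y10 y11 : 'rV[R]_3) :
  jet_bilinear J (coords (a *: v + b *: w)) (coords (a *: v + b *: w)) +
  jet_linear J (coords (a ^+ 2 *: y00 + (a * b) *: (y01 + y10) + b ^+ 2 *: y11)) =
  a ^+ 2 * (jet_bilinear J (coords v) (coords v) + jet_linear J (coords y00))
  + a * b * ((jet_bilinear J (coords v) (coords w) + jet_linear J (coords y01))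
    + (jet_bilinear J (coords w) (coords v) + jet_linear J (coords y10)))
  + b ^+ 2 * (jet_bilinear J (coords w) (coords w) + jet_linear J (coords y11)).
Proof.
rewrite jet_bilinear_comb 2!jet_linearD 3!jet_linearZ jet_linearD.
by ring.
Qed.

Lemma metric_form_comb (a b : R) v w :
  metric_form tau y (coords (a *: v + b *: w)) (coords (a *: v + b *: w)) =
  a ^+ 2 * metric_form tau y (coords v) (coords v)
  + 2 * a * b * metric_form tau y (coords v) (coords w)
  + b ^+ 2 * metric_form tau y (coords w) (coords w).
Proof. by rewrite /metric_form /coords /vx /vy /vt /= !mxE; ring. Qed.

(** Gram-Schmidt: - b v + a w is a times the component of w orthogonal to v. This gives the sign of
    the Gram determinant. *)
Lemma metric_form_gram v w :
  let a := metric_form tau y (coords v) (coords v) in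
  let b := metric_form tau y (coords v) (coords w) in
  a * (a * metric_form tau y (coords w) (coords w) - b ^+ 2) =
  metric_form tau y (coords (- b *: v + a *: w)) (coords (- b *: v + a *: w)).
Proof.
rewrite /= metric_form_comb.
move: (metric_form _ _ (coords v) (coords v)) => a.
move: (metric_form _ _ (coords v) (coords w)) => b.
by move: (metric_form _ _ (coords w) (coords w)) => c; ring.
Qed.

Lemma row_free_pair (T : 'I_2 -> 'rV[R]_3) (a b : R) :
  row_free (\matrix_(i < 2) T i) -> a *: T 0 + b *: T 1 = 0 -> a = 0 /\ b = 0.
Proof.
move=> free h; pose w : 'rV[R]_2 := \row_j (if j == 0 then a else b).
have : w *m (\matrix_(i < 2) T i) == 0.
  apply/eqP; rewrite -[RHS]h; apply/matrixP => i k.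
  by rewrite !mxE sum_ord2 !mxE /= ord1.
rewrite (mulmx_free_eq0 _ free) => /eqP w0.
have := congr1 (fun M : 'rV[R]_2 => (M 0 0, M 0 1)) w0.
by rewrite /w !mxE /= => -[].
Qed.

Lemma metric_form_row (c : R) v (n : R * R * R) :
  metric_form tau y (coords v) (coords (c *: \row_l [:: vx n; vy n; vt n]`_l)) =
  c * metric_form tau y (coords v) n.
Proof. by rewrite /metric_form /coords /vx /vy /vt /= !mxE /=; ring. Qed.

Lemma coords_row (n : R * R * R) : coords (\row_l [:: vx n; vy n; vt n]`_l) = n.
Proof. by case: n => -[a b] c; rewrite /coords !mxE. Qed.

End CoordsLinear.

(** * A minimal chart touching a level set *)

Section ChartContact.
Variables (R : realType) (tau : R) (U : set 'rV[R]_2) (F : 'rV[R]_2 -> 'rV[R]_3).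
Variable u : 'rV[R]_2.
Hypotheses (oU : open U) (sF : smooth_on U F) (Uu : U u).
Let y := ycoord (F u).
Hypothesis y0 : 0 < y.
Hypotheses (immF : immersive_at F u) (minF : minimal_at tau F u).

Let e i := coords (tangent F i u).
Let g i j := metric_form tau y (e i) (e j).
Let y0' : y != 0. Proof. exact: lt0r_neq0. Qed.

Let gC i j : g i j = g j i.
Proof. exact: metric_formC. Qed.

Let first_formE i j : first_form tau F u i j = g i j.
Proof. by rewrite /first_form mxE innerE. Qed.

Let tangent_free (a b : R) :
  a *: tangent F 0 u + b *: tangent F 1 u = 0 -> a = 0 /\ b = 0.
Proof. exact: (@row_free_pair R (fun i => tangent F i u) a b immF). Qed.

Let g00_gt0 : 0 < g 0 0.
Proof.
rewrite lt0r metric_form_ge0// andbT; apply/eqP => h.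
have /coords_eq0 h0 := metric_form_eq0 y0' h.
have [|+ _] := @tangent_free 1 0; first by rewrite h0 scaler0 scale0r addr0.
by move/eqP; rewrite oner_eq0.
Qed.

Let det_gt0 : 0 < g 0 0 * g 1 1 - g 0 1 ^+ 2.
Proof.
have E : g 0 0 * (g 0 0 * g 1 1 - g 0 1 ^+ 2) =
    metric_form tau y (coords (- g 0 1 *: tangent F 0 u + g 0 0 *: tangent F 1 u))
     (coords (- g 0 1 *: tangent F 0 u + g 0 0 *: tangent F 1 u)).
  exact: metric_form_gram.
rewrite lt0r -(pmulr_rge0 _ g00_gt0) E metric_form_ge0// andbT; apply/eqP => h.
have h' : metric_form tau y (coords (- g 0 1 *: tangent F 0 u + g 0 0 *: tangent F 1 u))
     (coords (- g 0 1 *: tangent F 0 u + g 0 0 *: tangent F 1 u)) = 0.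
  by rewrite -E h mulr0.
have /coords_eq0 /tangent_free[_ h0] := metric_form_eq0 y0' h'.
by move: g00_gt0; rewrite h0 ltxx.
Qed.

Let invmx_first_form : invmx (first_form tau F u) =
  (g 0 0 * g 1 1 - g 0 1 ^+ 2)^-1 *:
   \matrix_(i, j) (if i == j then (if i == 0 then g 1 1 else g 0 0) else - g 0 1).
Proof.
set B := (X in _ *: X).
have h : first_form tau F u *m ((g 0 0 * g 1 1 - g 0 1 ^+ 2)^-1 *: B) = 1%:M.
  have d0 := lt0r_neq0 det_gt0.
  have e2 (P : 'I_2 -> Prop) : P 0 -> P 1 -> forall i, P i.
    move=> P0 P1 [[|[|//]] ilt].
    - by have -> : Ordinal ilt = 0 by exact: val_inj.
    - by have -> : Ordinal ilt = 1 by exact: val_inj.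
  apply/matrixP => i j; rewrite !mxE sum_ord2 !first_formE !mxE.
  elim/e2 : i; elim/e2 : j; rewrite /= ?(gC 1 0); move: d0;
    by move: (g 0 0) (g 0 1) (g 1 1) => a b c d0; field.
have [t _] := mulmx1_unit h.
by rewrite -[LHS]mulmx1 -h mulKmx.
Qed.

Lemma chart_max_tangent (J : jet R) (Phi : R -> R -> R -> R) i :
  has_jet Phi (xcoord (F u)) (ycoord (F u)) (tcoord (F u)) J ->
  (\forall z \near u, Phi (xcoord (F z)) (ycoord (F z)) (tcoord (F z)) <=
     Phi (xcoord (F u)) (ycoord (F u)) (tcoord (F u))) ->
  jet_linear J (coords (tangent F i u)) = 0.
Proof.
move=> hP hmax.
have c l := curve_jet_chart (delta_mx 0 i) l oU sF Uu.
have := hP _ _ _ _ _ _ _ _ _ (c 0) (c 1) (c 2).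
move/curve_jet_max => -[|+ _].
  have := @continuous_line _ _ u (delta_mx 0 i) 0.
  move=> /(_ (fun z => Phi (xcoord (F z)) (ycoord (F z)) (tcoord (F z)) <=
   Phi (xcoord (F u)) (ycoord (F u)) (tcoord (F u)))).
  rewrite /= !scale0r addr0 => /(_ hmax).
  exact.
exact.
Qed.

Variable J : jet R.
Let L (v : 'rV[R]_3) := jet_linear J (coords v).
Hypothesis tangency : forall i, L (tangent F i u) = 0.
Hypothesis curvature : 0 < level_curvature tau y J.

Let k i j := L (covariant_tangent tau F i j u).

(** By tangency the gradient, which is nonzero, is normal to the surface. For its normalization
    [nu], pairing with [nu] is a multiple of the differential, so the vanishing of the mean
    curvature becomes a statement on the numbers [k i j]. *)
Lemma minimal_gradient_trace : g 1 1 * k 0 0 - g 0 1 * (k 0 1 + k 1 0) + g 0 0 * k 1 1 = 0.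
Proof.
have D0 := metric_gradient_gt0 y0' curvature.
set n := gradient_form tau y J in D0.
set D := metric_form tau y n n in D0.
pose nu : 'rV[R]_3 := (Num.sqrt D)^-1 *: \row_l [:: vx n; vy n; vt n]`_l.
have s0 : Num.sqrt D != 0 by rewrite gt_eqF// sqrtr_gt0.
have nuE (v : 'rV[R]_3) : inner tau (F u) v nu = (Num.sqrt D)^-1 * L v.
  rewrite innerE// -/y /L -(metric_gradient tau J (coords v) y0') -/n.
  exact: metric_form_row.
have nunu : unit_normal tau F u nu.
  split; last by move=> i; rewrite nuE tangency mulr0.
  rewrite nuE.
  have -> : L nu = (Num.sqrt D)^-1 * D.
    by rewrite /L /nu jet_linearZ coords_row -(metric_gradient tau J n y0').
  by rewrite mulrA -invfM -expr2 sqr_sqrtr ?ltW// mulVf// gt_eqF.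
have := minF nunu; rewrite /mean_curvature => /eqP.
rewrite mulf_eq0 invr_eq0 pnatr_eq0 /= => /eqP.
have kE i j : second_form tau F u nu i j = (Num.sqrt D)^-1 * k i j.
  by rewrite mxE; exact: nuE.
rewrite invmx_first_form mxtrace_adj2 !kE.
have d0 := lt0r_neq0 det_gt0.
move: (g 0 0 * g 1 1 - g 0 1 ^+ 2) d0 => d d0.
move: (Num.sqrt D) s0 => s s0.
move: (g 0 0) (g 0 1) (g 1 1) (k 0 0) (k 0 1) (k 1 0) (k 1 1).
move=> a b c k0 k1 k2 k3 /eqP E.
have : d * s * 0 = c * k0 - b * (k1 + k2) + a * k3.
  by rewrite -(eqP E); field; rewrite d0 s0.
by rewrite mulr0.
Qed.

Let q i j := jet_bilinear J (e i) (e j) + L (second F i j u).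

(** The second derivatives [q] of the function along the chart split into its ambient Hessian on the
    tangent plane and the part [k] from the second fundamental form. The trace of the former is
    positive, that of the latter zero. *)
Lemma contact_trace : 0 < g 1 1 * q 0 0 - g 0 1 * (q 0 1 + q 1 0) + g 0 0 * q 1 1.
Proof.
pose B i j := jet_bilinear J (e i) (e j)
  - jet_linear J (christoffel_form tau y (e i) (e j)).
have h : 0 < g 1 1 * B 0 0 - g 0 1 * (B 0 1 + B 1 0) + g 0 0 * B 1 1.
  exact: (tangential_trace_gt0 y0' (tangency 0) (tangency 1) det_gt0 curvature).
have kE i j : k i j = L (second F i j u) + jet_linear J (christoffel_form tau y (e i) (e j)).
  by rewrite /k /L /covariant_tangent jet_linearD christoffel_formE.
have BE i j : B i j = q i j - k i j.
  rewrite kE /B /q; move: (jet_linear J (christoffel_form _ _ _ _)) (L _) (jet_bilinear J _ _) => a b c; ring.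
rewrite !BE in h; move: h minimal_gradient_trace.
move: (g 0 0) (g 0 1) (g 1 1) (k 0 0) (k 0 1) (k 1 0) (k 1 1).
move: (q 0 0) (q 0 1) (q 1 0) (q 1 1) => *; lra.
Qed.

Let V (a b : R) : 'rV[R]_2 := a *: delta_mx 0 0 + b *: delta_mx 0 1.

Lemma no_chart_max (Phi : R -> R -> R -> R) :
  has_jet Phi (xcoord (F u)) (ycoord (F u)) (tcoord (F u)) J ->
  (\forall z \near u, Phi (xcoord (F z)) (ycoord (F z)) (tcoord (F z)) <=
     Phi (xcoord (F u)) (ycoord (F u)) (tcoord (F u))) -> False.
Proof.
move=> hP hmax.
have Q a b : a ^+ 2 * q 0 0 + a * b * (q 0 1 + q 1 0) + b ^+ 2 * q 1 1 <= 0.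
  have c l := curve_jet_chart (V a b) l oU sF Uu.
  have := hP _ _ _ _ _ _ _ _ _ (c 0) (c 1) (c 2).
  move/curve_jet_max => -[|_].
    have := @continuous_line _ _ u (V a b) 0.
    move=> /(_ (fun z => Phi (xcoord (F z)) (ycoord (F z)) (tcoord (F z)) <=
     Phi (xcoord (F u)) (ycoord (F u)) (tcoord (F u)))).
    rewrite /= !scale0r addr0 => /(_ hmax).
    exact.
  pose v1 := 'D_(V a b) F u; pose v2 := 'D_(V a b) ('D_(V a b) F) u.
  change (jet_bilinear J (coords v1) (coords v1) + jet_linear J (coords v2) <= 0 ->
    a ^+ 2 * q 0 0 + a * b * (q 0 1 + q 1 0) + b ^+ 2 * q 1 1 <= 0).
  have Va : V a b 0 0 = a by rewrite !mxE /= mulr1 mulr0 addr0.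
  have Vb : V a b 0 1 = b by rewrite !mxE /= mulr1 mulr0 add0r.
  have -> : v2 = a ^+ 2 *: second F 0 0 u + (a * b) *: (second F 0 1 u + second F 1 0 u)
      + b ^+ 2 *: second F 1 1 u.
    by have := second_derive_quadratic (V a b) oU sF Uu; rewrite Va Vb.
  have -> : v1 = a *: tangent F 0 u + b *: tangent F 1 u.
    by have := C1_derive_linear (V a b) oU (sF 1%N) Uu; rewrite Va Vb.
  by rewrite jet_second_comb.
(* The directions (1, 0) and (- g01, g00) are orthogonal for the first fundamental form; weighted by
   the Gram determinant and by 1, the two values of Q add up to g00 times the trace of
   [contact_trace]. *)
have q00 := Q 1 0.
have q2 := Q (- g 0 1) (g 0 0).
have := contact_trace; rewrite -(pmulr_rgt0 _ g00_gt0) => ct.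
have : (g 0 0 * g 1 1 - g 0 1 ^+ 2) * q 0 0 <= 0.
  by apply: mulr_ge0_le0; [exact: ltW|]; move: q00; rewrite expr1n mul1r expr0n !mul0r mulr0 mul0r !addr0.
move: ct q2; move: (g 0 0) (g 0 1) (g 1 1) (q 0 0) (q 0 1) (q 1 0) (q 1 1).
move=> a b c A B C D ct h1 h2.
have E : a * (c * A - b * (B + C) + a * D) =
  ((- b) ^+ 2 * A + - b * a * (B + C) + a ^+ 2 * D) + (a * c - b ^+ 2) * A by ring.
by move: ct; rewrite E ltNge -[leRHS]addr0 lerD.
Qed.

End ChartContact.

(** * The maximum principle on an immersed surface *)

Section Surface.
Variables (R : realType) (tau : R) (S : topologicalType) (X : S -> 'rV[R]_3).
Hypothesis immX : immersed_surface X.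

Lemma immersed_continuous : continuous X.
Proof.
move=> p; case: immX => _ _ _ /(_ p)[U [W [h [k [F [[oU oW [hUW kWU hk kh] [hc kc] [sF FX _]] Wp]]]]]].
have [Uk _] := kWU _ Wp.
have kcp : {for p, continuous k}.
  by rewrite continuous_open_subspace // in kc; apply: kc; rewrite inE.
have Fc : {for k p, continuous F} by exact: (sF 0%N).
have c1 : {for p, continuous (F \o k)} by exact: continuous_comp kcp Fc.
have E : \forall q \near p, (F \o k) q = X q.
  have : \forall q \near p, W q by exact: open_nbhs_nbhs.
  apply: filterS => q Wq /=; rewrite FX ?inE; last exact: kWU.
  by rewrite /= kh// inE.
rewrite /continuous_at -(nbhs_singleton E).
exact: cvg_trans (near_eq_cvg E) c1.
Qed.

Hypothesis minX : minimal_immersion tau X.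

Lemma minimal_no_max (p : S) (Phi : R -> R -> R -> R) (J : jet R) :
  ~ surface_boundary X p ->
  has_jet Phi (xcoord (X p)) (ycoord (X p)) (tcoord (X p)) J ->
  0 < level_curvature tau (ycoord (X p)) J ->
  ~ (\forall q \near p, Phi (xcoord (X q)) (ycoord (X q)) (tcoord (X q)) <=
     Phi (xcoord (X p)) (ycoord (X p)) (tcoord (X p))).
Proof.
move=> nb hP curv hmax; case: immX => _ _ Xhalf /(_ p).
move=> [U [W [h [k [F [ch Wp]]]]]]; have := ch.
case=> oU oW [hUW kWU hk kh] [hc kc] [sF FX immF].
have [Uk kp0] := kWU _ Wp.
(* Away from [surface_boundary] the chart point is strictly inside the half-plane, so near u the
   extension F is X \o h on a full neighbourhood. *)
have {}kp0 : 0 < k p 0 1.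
  rewrite lt_neqAle eq_sym kp0 andbT; apply/eqP => k0.
  by apply: nb; exists U, W, h, k, F.
set u := k p in Uk kp0.
pose A : set 'rV[R]_2 := U `&` [set u | 0 < u 0 1].
have oA : open A.
  apply: openI => //; apply: (@open_comp _ _ (fun v : 'rV[R]_2 => v 0 1) [set r | 0 < r]).
    by move=> v _; exact: coord_continuous.
  exact: open_gt.
have AU : A `<=` U `&` half_plane (R := R).
  by move=> v [Uv v0]; split => //; exact: ltW.
have Au : A u by [].
have FXA v : A v -> F v = X (h v).
  by move=> Av; rewrite FX// inE; exact: AU.
have hcu : {for u, continuous h}.
  have := continuous_subspaceW AU hc; rewrite continuous_open_subspace// => c.
  by apply: c; rewrite inE.
have hu : h u = p by rewrite /u kh// inE.
have FuX : F u = X p by rewrite FXA// hu.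
have Uu : (U `&` half_plane (R := R)) u by exact: AU.
have y0 : 0 < ycoord (F u) by rewrite FuX; apply: Xhalf; exists p.
have hm : \forall v \near u, Phi (xcoord (F v)) (ycoord (F v)) (tcoord (F v)) <=
     Phi (xcoord (F u)) (ycoord (F u)) (tcoord (F u)).
  have hm : \forall v \near u, Phi (xcoord (X (h v))) (ycoord (X (h v))) (tcoord (X (h v))) <=
     Phi (xcoord (X p)) (ycoord (X p)) (tcoord (X p)).
    apply: (hcu (fun q => Phi (xcoord (X q)) (ycoord (X q)) (tcoord (X q)) <=
     Phi (xcoord (X p)) (ycoord (X p)) (tcoord (X p)))).
    by rewrite /= hu.
  have nA : \forall v \near u, A v by exact: open_nbhs_nbhs.
  by apply: filterS2 hm nA => v + Av; rewrite (FXA _ Av) FuX.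
rewrite -FuX in hP curv.
apply: (@no_chart_max R tau U F u oU sF Uk y0 _ _ J _ curv Phi hP hm).
- by apply: immF; rewrite inE.
- exact: minX ch u Uu.
- by move=> i; exact: (@chart_max_tangent R U F u oU sF Uk J Phi i hP hm).
Qed.

End Surface.

(** * Sweeping a surface by barriers *)

Section Sweep.
Variables (R : realType) (tau : R) (S : topologicalType).
Variables (X Y T : S -> R) (a b d : R).
Hypotheses (cX : continuous X) (cY : continuous Y) (cT : continuous T).
Hypothesis properS : forall x1 x2 y1 y2 t1 t2, 0 < y1 ->
  compact [set q | [/\ x1 <= X q <= x2, y1 <= Y q <= y2 & t1 <= T q <= t2]].
Hypothesis maxS : forall (p : S) (Phi : R -> R -> R -> R) (J : jet R),
  Y p <= d -> has_jet Phi (X p) (Y p) (T p) J -> 0 < level_curvature tau (Y p) J ->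
  ~ (\forall q \near p, Phi (X q) (Y q) (T q) <= Phi (X p) (Y p) (T p)).
Hypothesis YS : forall q, 0 < Y q.
Hypothesis abS : forall q, `|X q| <= d -> Y q <= d -> T q != a /\ T q != b.

Definition sqdist (x : R) (q : S) := (X q - x) ^+ 2 + Y q ^+ 2.

Lemma continuous_sqdist x : continuous (sqdist x).
Proof.
move=> q; apply: cvgD.
  apply: (@continuous_comp _ _ _ (fun q => X q - x) (fun r : R => r ^+ 2)).
    by apply: cvgB; [exact: cX|exact: cvg_cst].
  exact: exprn_continuous.
apply: (@continuous_comp _ _ _ Y (fun r : R => r ^+ 2)); first exact: cY.
exact: exprn_continuous.
Qed.

Lemma sqdist_le x r q : 0 <= r -> sqdist x q <= r ^+ 2 ->
  [/\ x - r <= X q, X q <= x + r & Y q <= r].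
Proof.
move=> r0 h; have := YS q => y0.
have hx : (X q - x) ^+ 2 <= r ^+ 2 by apply: le_trans h; rewrite lerDl sqr_ge0.
have hy : Y q ^+ 2 <= r ^+ 2 by apply: le_trans h; rewrite lerDr sqr_ge0.
have : `|X q - x| <= r.
  by rewrite -(@ler_pXn2r _ 2)// ?nnegrE// real_normK ?num_real.
rewrite ler_norml => /andP[? ?]; split; try lra.
by rewrite -(@ler_pXn2r _ 2)// ?nnegrE// ltW.
Qed.

(* A superlevel set that stays away from the ideal boundary and from the rim is
   compact, so that Phi attains its maximum there, against the maximum
   principle. *)
Lemma sweep x r (Phi : R -> R -> R -> R) c :
  `|x| + r <= d -> 0 < r ->
  (forall q, sqdist x q <= r ^+ 2 -> a <= T q <= b ->
     {for q, continuous (fun q => Phi (X q) (Y q) (T q))}) ->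
  (exists2 y1, 0 < y1 & forall q, sqdist x q <= r ^+ 2 -> a <= T q <= b ->
     c <= Phi (X q) (Y q) (T q) -> y1 <= Y q) ->
  (forall q, sqdist x q = r ^+ 2 -> a <= T q <= b -> Phi (X q) (Y q) (T q) < c) ->
  (forall q, sqdist x q < r ^+ 2 -> a < T q < b -> c <= Phi (X q) (Y q) (T q) ->
     exists2 J, has_jet Phi (X q) (Y q) (T q) J & 0 < level_curvature tau (Y q) J) ->
  forall q, sqdist x q <= r ^+ 2 -> a <= T q <= b -> Phi (X q) (Y q) (T q) < c.
Proof.
move=> xrd r0 cPhi [y1 y10 low] rim curv q qr qT.
rewrite ltNge; apply/negP => qc.
(* By [low], this compact set contains every point of the half-ball and slab at level at least c. *)
pose D := [set q | [/\ sqdist x q <= r ^+ 2, y1 <= Y q & a <= T q <= b]].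
pose f q := Phi (X q) (Y q) (T q).
have inB z : sqdist x z <= r ^+ 2 -> `|X z| <= d /\ Y z <= d.
  move=> /(sqdist_le (ltW r0))[z1 z2 z3]; have := normr_ge0 x; split; last lra.
  move: xrd; have := ler_norm x; have := ler_norm (- x); rewrite normrN ler_norml.
  by move=> *; apply/andP; split; lra.
have cl : forall (g : S -> R) u, continuous g -> closed [set q | g q <= u].
  move=> g u cg; apply: (@preimage_closed _ _ g [set s | s <= u]); last exact: closed_le.
  by move=> s _; exact: cg.
have cl' : forall (g : S -> R) u, continuous g -> closed [set q | u <= g q].
  move=> g u cg; apply: (@preimage_closed _ _ g [set s | u <= s]); last exact: closed_ge.
  by move=> s _; exact: cg.
have Dcl : closed D.
  have -> : D = [set q | sqdist x q <= r ^+ 2] `&` [set q | y1 <= Y q]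
      `&` ([set q | a <= T q] `&` [set q | T q <= b]).
    by apply/seteqP; split => z /= => [[? ? /andP[]]|[[? ?] [? ?]]]//; split=> //; apply/andP.
  apply: closedI; apply: closedI; [apply: cl|apply: cl'|apply: cl'|apply: cl] => //.
  exact: continuous_sqdist.
have Dc : compact D.
  apply: subclosed_compact Dcl (@properS (x - r) (x + r) y1 r a b y10) _ => z.
  by move=> [/(sqdist_le (ltW r0))[z1 z2 z3] z4 z5]; split=> //; apply/andP.
have Dq : D q by split=> //; exact: low.
have fD : {within D, continuous f}.
  apply: continuous_in_subspaceT => z; rewrite inE => -[z1 _ z2].
  exact: cPhi.
have [p /[!inE] Dp pmax] := @compact_EVT_max S R f D (ex_intro _ q Dq) Dc fD.
have fp : c <= f p by apply: (le_trans qc); apply: pmax; rewrite inE.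
case: Dp => p1 p2 p3.
have p1' : sqdist x p < r ^+ 2.
  rewrite lt_neqAle p1 andbT; apply/eqP => p4.
  by have := rim p p4 p3; rewrite ltNge fp.
have [xd yd] := inB _ p1; have [Ta Tb] := abS xd yd.
have p3' : a < T p < b.
  by move: p3 => /andP[? ?]; rewrite !lt_neqAle eq_sym Ta Tb; apply/andP.
have [J hJ cJ] := curv p p1' p3' fp.
apply: (maxS yd hJ cJ).
have n1 : \forall z \near p, sqdist x z < r ^+ 2.
  by apply: (@continuous_sqdist x p [set s | s < r ^+ 2]); exact: lt_nbhsl.
have n2 : \forall z \near p, a < T z.
  by apply: (@cT p [set s | a < s]); apply: lt_nbhsr; case/andP: p3'.
have n3 : \forall z \near p, T z < b.
  by apply: (@cT p [set s | s < b]); apply: lt_nbhsl; case/andP: p3'.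
near=> z.
have z1 : sqdist x z <= r ^+ 2 by rewrite ltW//; near: z.
have z2 : a <= T z <= b.
  by apply/andP; split; rewrite ltW//; near: z.
(* Near p, a point below level c is below [f p]; a point above it lies in D by [low], where p is a
   maximum. *)
have [/le_trans|fz] := leP (Phi (X z) (Y z) (T z)) c; first exact.
apply: pmax; rewrite inE; split => //; apply: low => //; exact: ltW.
Unshelve. all: by end_near. Qed.

End Sweep.

(** * Estimates on the slab and continuity of the barriers *)

Section Trig.
Variable R : realType.
Implicit Types om a b t : R.

Lemma cos_slab om a b t : 0 < om -> a <= b -> om * (b - a) < pi -> a <= t <= b ->
  0 < cos (om * (b - a) / 2) <= cos (om * (t - (a + b) / 2)).
Proof.
move=> om0 ab obpi /andP[at_ tb].
have ba0 : 0 <= om * (b - a) by rewrite mulr_ge0 ?subr_ge0// ltW.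
have hp : 0 < cos (om * (b - a) / 2).
  by apply: cos_gt0_pihalf; have := @pi_gt0 R; move=> p0; apply/andP; split; lra.
rewrite hp /=.
pose s := `|om * (t - (a + b) / 2)|.
have -> : cos (om * (t - (a + b) / 2)) = cos s.
  by rewrite /s; case: (ger0P (om * (t - (a + b) / 2))) => // _; rewrite cosN.
have sle : s <= om * (b - a) / 2.
  rewrite /s normrM gtr0_norm// -mulrA ler_pM2l// ler_norml.
  by apply/andP; split; lra.
have s0 : 0 <= s := normr_ge0 _.
by rewrite leNgt ltr_cos -?leNgt// in_itv /= ?s0; apply/andP; split; lra.
Qed.

Lemma exists_below5 (A B C D E : R) : 0 < A -> 0 < B -> 0 < C -> 0 < D -> 0 < E ->
  exists2 r, 0 < r & [/\ r <= A, r <= B, r <= C, r <= D & r <= E].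
Proof.
move=> A0 B0 C0 D0 E0.
exists (Num.min A (Num.min B (Num.min C (Num.min D E)))).
  by rewrite !lt_min A0 B0 C0 D0.
by split; rewrite !ge_min lexx ?orbT.
Qed.

Lemma sqr_le_norm (x y : R) : `|x| <= y -> x ^+ 2 <= y ^+ 2.
Proof.
move=> h; rewrite -[x ^+ 2]real_normK ?num_real//.
by rewrite ler_pXn2r// nnegrE (le_trans _ h).
Qed.

End Trig.

Section BarrierContinuity.
Variables (R : realType) (S : topologicalType) (q : S) (f g h : S -> R).
Hypotheses (cf : {for q, continuous f}) (cg : {for q, continuous g})
  (ch : {for q, continuous h}).

Lemma continuous_catenoid k x2 om tm : cos (om * (h q - tm)) != 0 ->
  {for q, continuous (fun q => catenoid_barrier k x2 om tm (f q) (g q) (h q))}.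
Proof.
move=> c0; apply: cvgB.
  apply: cvgM => //; apply: cvgV => //.
  apply: continuous_comp; last exact: continuous_cos.
  by apply: cvgM; [exact: cvg_cst|apply: cvgB => //; exact: cvg_cst].
apply: cvgM; first exact: cvg_cst.
apply: (@continuous_comp _ _ _ (fun q => f q - x2) (fun r : R => r ^+ 2)).
  by apply: cvgB => //; exact: cvg_cst.
exact: exprn_continuous.
Qed.

Lemma continuous_log_barrier M e N : 0 < M -> 0 < N -> 0 < g q ->
  {for q, continuous (fun q => log_barrier M e N (f q) (g q) (h q))}.
Proof.
move=> M0 N0 g0.
have S0 : 0 < M * f q ^+ 2 + g q ^+ 2.
  by rewrite ltr_wpDl ?exprn_gt0// mulr_ge0 ?sqr_ge0// ltW.
apply: cvgB; first by apply: cvgM => //; exact: cvg_cst.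
apply: cvgM; first exact: cvg_cst.
apply: (@continuous_comp _ _ _ (fun q => 1 + N * (g q / (M * f q ^+ 2 + g q ^+ 2))) (@ln R)).
  apply: cvgD; first exact: cvg_cst.
  apply: cvgM; first exact: cvg_cst.
  apply: cvgM => //; apply: cvgV; first exact: lt0r_neq0.
  apply: cvgD.
    apply: cvgM; first exact: cvg_cst.
    apply: (@continuous_comp _ _ _ f (fun r : R => r ^+ 2)) => //.
    exact: exprn_continuous.
  apply: (@continuous_comp _ _ _ g (fun r : R => r ^+ 2)) => //.
  exact: exprn_continuous.
by apply: continuous_ln; rewrite ltr_wpDl// mulr_gt0// divr_gt0.
Qed.

End BarrierContinuity.

(** * The last sweep: a quadratically thin surface *)

Section ThinSurface.
Variables (R : realType) (tau : R) (S : topologicalType).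
Variables (X Y T : S -> R) (a b d : R).
Hypotheses (cX : continuous X) (cY : continuous Y) (cT : continuous T).
Hypothesis properS : forall x1 x2 y1 y2 t1 t2, 0 < y1 ->
  compact [set q | [/\ x1 <= X q <= x2, y1 <= Y q <= y2 & t1 <= T q <= t2]].
Hypothesis maxS : forall (p : S) (Phi : R -> R -> R -> R) (J : jet R),
  Y p <= d -> has_jet Phi (X p) (Y p) (T p) J -> 0 < level_curvature tau (Y p) J ->
  ~ (\forall q \near p, Phi (X q) (Y q) (T q) <= Phi (X p) (Y p) (T p)).
Hypothesis YS : forall q, 0 < Y q.
Hypothesis abS : forall q, `|X q| <= d -> Y q <= d -> T q != a /\ T q != b.
Hypotheses (d0 : 0 < d) (ab : a < b).
Variable om : R.
Hypotheses (om0 : 0 < om) (ompi : om * (b - a) < pi)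
  (omM : 1 < (1 + 4 * tau ^+ 2) * om ^+ 2).

(** The barrier is positive at a point p close to the line. On the rim of a half-disc of radius r
    around the foot of p, Y is of order r^2 and so is the penalty k (x - x2)^2; taking k a large
    enough multiple of C makes the barrier negative there. The curvature terms due to k are of order
    r, hence harmless for small r. *)
Lemma thin_surface_away C rho0 : 0 < C -> 0 < rho0 ->
  (forall q, sqdist X Y 0 q <= rho0 ^+ 2 -> a <= T q <= b ->
     Y q <= C * sqdist X Y 0 q) ->
  exists2 e, 0 < e & forall q, a < T q < b -> `|X q| < e -> e <= Y q.
Proof.
move=> C0 rho00 thin.
pose M := 1 + 4 * tau ^+ 2.
pose tm := (a + b) / 2.
pose c0 := cos (om * (b - a) / 2).
pose u0 := c0^-1.
have cs t : a <= t <= b -> 0 < c0 <= cos (om * (t - tm)).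
  by move=> h; apply: cos_slab => //; exact: ltW.
have aab : a <= a <= b by rewrite lexx ltW.
have c00 : 0 < c0 by case/andP: (cs _ aab).
have u00 : 0 < u0 by rewrite invr_gt0.
pose s := M * om ^+ 2 - 1.
have s0 : 0 < s by rewrite subr_gt0.
(* On the rim Y / cos is at most 8 C u0 r^2, against a penalty of at least 3/4 k r^2 = 12 C u0
   r^2. *)
pose k := 16 * C * u0.
have k0 : 0 < k by rewrite !mulr_gt0.
(* For r <= 1, K r bounds the k-terms in the last hypothesis of [catenoid_curvature_gt0]. *)
pose K := 12 * `|tau| * om * u0 ^+ 2 * k + 4 * k ^+ 2 + k * (u0 ^+ 2 + om ^+ 2 * u0 ^+ 4).
have K0 : 0 < K.
  rewrite ltr_wpDr//; last by rewrite ltr_wpDl ?mulr_gt0 ?exprn_gt0// !mulr_ge0// ?ltW// ?exprn_gt0.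
  by rewrite !mulr_ge0 ?addr_ge0 ?mulr_ge0 ?exprn_ge0// ltW.
(* The five bounds, in order: the half-disc stays where [abS] and [maxS] apply; [thin] applies on
   it; Y <= C (4 r^2 + r Y) can be solved into Y <= 8 C r^2 <= r / 2; r^2 <= r; K r <= s / 2. *)
have [||||| r r0 [r1 r2 r3 r4 r5]] :=
  @exists_below5 _ (d / 2) (rho0 / 3) (16 * C)^-1 1 (s / (2 * K)).
- by rewrite divr_gt0.
- by rewrite divr_gt0.
- by rewrite invr_gt0 mulr_gt0.
- exact: ltr01.
- by rewrite divr_gt0// mulr_gt0.
exists (r / 2) => [|p pT pX]; first by rewrite divr_gt0.
rewrite leNgt; apply/negP => pY.
have rC : 16 * C * r <= 1 by rewrite -ler_pdivlMl ?mulr_gt0// mulr1.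
pose x2 := X p.
have thin2 q : sqdist X Y x2 q <= r ^+ 2 -> a <= T q <= b -> Y q <= 8 * C * r ^+ 2.
  move=> qr qT; have [q1 q2 q3] := sqdist_le YS (ltW r0) qr.
  have qX : `|X q| <= 2 * r.
    by move: pX; rewrite /x2 in q1 q2; rewrite ltr_norml => /andP[? ?]; rewrite ler_norml; apply/andP; split; lra.
  have qX2 : X q ^+ 2 <= 4 * r ^+ 2.
    have -> : 4 * r ^+ 2 = (2 * r) ^+ 2 by rewrite exprMn -natrX.
    by apply: sqr_le_norm.
  have qYY : Y q ^+ 2 <= r * Y q by rewrite expr2 ler_wpM2r// ltW.
  have qs : sqdist X Y 0 q <= 4 * r ^+ 2 + r * Y q.
    by rewrite /sqdist subr0 lerD.
  have h1 : Y q <= C * (4 * r ^+ 2 + r * Y q).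
    apply: (le_trans (thin q _ qT)); last by rewrite ler_pM2l.
    apply: (le_trans qs).
    have h : r * Y q <= r ^+ 2 by rewrite expr2 ler_pM2l.
    have r2' : r ^+ 2 <= (rho0 / 3) ^+ 2 by rewrite ler_pXn2r// ?nnegrE ltW// divr_gt0.
    have : (rho0 / 3) ^+ 2 = rho0 ^+ 2 / 9 by field.
    have : 0 < rho0 ^+ 2 by rewrite exprn_gt0.
    lra.
  have h2 : C * r * Y q <= Y q / 16.
    rewrite mulrC ler_pM2l//; lra.
  have := YS q; lra.
have pT' : a <= T p <= b by case/andP: pT => *; rewrite !ltW.
have cp : 0 < cos (om * (T p - tm)).
  by have /andP[h1 h2] := cs _ pT'; exact: lt_le_trans h2.
pose c := catenoid_barrier k x2 om tm (X p) (Y p) (T p).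
have cE : c = Y p / cos (om * (T p - tm)).
  by rewrite /c /catenoid_barrier subrr expr0n mulr0 subr0.
have c_gt0 : 0 < c by rewrite cE divr_gt0.
have pr : sqdist X Y x2 p <= r ^+ 2.
  have Ypr : Y p <= r by move: pY; lra.
  by rewrite /sqdist subrr expr0n add0r; apply: sqr_le_norm; rewrite gtr0_norm.
suff : c < c by rewrite ltxx.
apply: (@sweep _ tau _ X Y T a b d cX cY cT properS maxS YS abS x2 r
  (catenoid_barrier k x2 om tm) c) => //.
- rewrite /x2; lra.
- move=> q _ qT; apply: continuous_catenoid.
  + exact: cX.
  + exact: cY.
  + exact: cT.
  + by have /andP[h1 h2] := cs _ qT; rewrite gt_eqF// (lt_le_trans h1).
(* As c > 0 and cos >= c0, the inequality Y / cos >= c keeps the superlevel set at height at least c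
   c0. *)
- exists (c * c0) => [|q _ qT]; first by rewrite mulr_gt0.
  have /andP[h1 h2] := cs _ qT => qc; rewrite -ler_pdivlMr//.
  apply: (le_trans qc); rewrite /catenoid_barrier.
  apply: (@le_trans _ _ (Y q / cos (om * (T q - tm)))).
    by rewrite gerBl// mulr_ge0 ?sqr_ge0// ltW.
  by rewrite ler_pM2l// lef_pV2// posrE (lt_le_trans h1).
- move=> q qr qT; apply: lt_trans c_gt0.
  have /andP[h1 h2] := cs _ qT.
  have qr' : sqdist X Y x2 q <= r ^+ 2 by rewrite qr.
  have hY := thin2 q qr' qT.
  have Yr : Y q <= r / 2.
    apply: (le_trans hY); rewrite expr2 mulrA -[leRHS]mulrC ler_pM2r//; lra.
  have hX : 3 / 4 * r ^+ 2 <= (X q - x2) ^+ 2.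
    have : Y q ^+ 2 <= (r / 2) ^+ 2 by rewrite ler_pXn2r// ?nnegrE ltW// divr_gt0.
    have -> : (r / 2) ^+ 2 = r ^+ 2 / 4 by field.
    by move: qr; rewrite /sqdist => ? ?; lra.
  have hu : Y q / cos (om * (T q - tm)) <= 8 * C * r ^+ 2 * u0.
    apply: ler_pM => //; first exact: ltW.
      by rewrite invr_ge0 (le_trans (ltW h1)).
    by rewrite lef_pV2// posrE (lt_le_trans h1).
  have hk : k * (3 / 4 * r ^+ 2) <= k * (X q - x2) ^+ 2 by rewrite ler_pM2l.
  have : 0 < C * u0 * r ^+ 2 by rewrite !mulr_gt0 ?exprn_gt0.
  by move: hk hu; rewrite /catenoid_barrier /k => *; lra.
- move=> q qr qT _.
  have qT' : a <= T q <= b by case/andP: qT => *; rewrite !ltW.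
  have /andP[h1 h2] := cs _ qT'.
  set cc := cos (om * (T q - tm)) in h2 *; set sn := sin (om * (T q - tm)).
  have cc0 : 0 < cc by exact: lt_le_trans h2.
  exists (catenoid_jet k (X q - x2) (Y q) cc^-1 (om * sn / cc ^+ 2)
       (om ^+ 2 * (cc^-1 + 2 * sn ^+ 2 / cc ^+ 3))).
    by apply: has_jet_catenoid; exact: lt0r_neq0.
  have ccn := lt0r_neq0 cc0.
  apply: (@catenoid_curvature_gt0 _ _ _ _ _ _ _ _ s) => //.
  + by rewrite invr_gt0.
  + apply: mulr_ge0; first exact: sqr_ge0.
    apply: addr_ge0; first by rewrite invr_ge0 ltW.
    apply: divr_ge0; last by apply: exprn_ge0; exact: ltW.
    by apply: mulr_ge0 => //; exact: sqr_ge0.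
  + by rewrite -/M /s; field.
  have [q1 q2 q3] := sqdist_le YS (ltW r0) (ltW qr).
  have hX : `|X q - x2| <= r by rewrite ler_norml; apply/andP; split; lra.
  have uu0 : cc^-1 <= u0 by rewrite lef_pV2 ?posrE.
  have u1 : 1 <= cc^-1 by rewrite -[leLHS]invr1 lef_pV2 ?posrE// cos_le1.
  have sn1 : `|sn| <= 1 by rewrite ler_norml sin_geN1 sin_le1.
  have hu1 : `|om * sn / cc ^+ 2| <= om * u0 ^+ 2.
    rewrite -mulrA normrM gtr0_norm// ler_pM2l// normrM -[leRHS]mul1r.
    apply: ler_pM => //; rewrite -exprVn normrX.
    have zu : `|cc^-1| <= u0 by rewrite gtr0_norm ?invr_gt0.
    by rewrite ler_pXn2r// nnegrE ltW.
  move: (om * sn / cc ^+ 2) hu1 => v hv.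
  have u00' := ltW u00.
  have v2 : v ^+ 2 <= om ^+ 2 * u0 ^+ 4.
    have -> : om ^+ 2 * u0 ^+ 4 = (om * u0 ^+ 2) ^+ 2 by ring.
    by apply: sqr_le_norm.
  have hY : Y q <= r.
    by [].
  set x := X q - x2 in hX *; set z := cc^-1 in uu0 u1 *.
  have z0 : 0 < z by rewrite invr_gt0.
  have tv : `|tau * v * (2 * k * x)| <= `|tau| * (om * u0 ^+ 2) * (2 * k * r).
    rewrite normrM; apply: ler_pM => //.
      by rewrite normrM ler_wpM2l.
    by rewrite normrM gtr0_norm ?mulr_gt0// ler_pM2l ?mulr_gt0.
  have xk : (2 * k * x) ^+ 2 <= 4 * k ^+ 2 * r.
    have -> : (2 * k * x) ^+ 2 = 4 * k ^+ 2 * x ^+ 2 by ring.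
    apply: ler_wpM2l; first by rewrite mulr_ge0 ?sqr_ge0.
    apply: (le_trans (sqr_le_norm hX)).
    by rewrite expr2 -[leRHS]mulr1 ler_pM2l.
  have yk : 2 * k * Y q * (z ^+ 2 + v ^+ 2) / z <= k * (u0 ^+ 2 + om ^+ 2 * u0 ^+ 4) * r.
    have hY2 := thin2 q (ltW qr) qT'.
    have hY3 : Y q <= r / 2.
      apply: (le_trans hY2).
      by rewrite expr2 mulrA -[leRHS]mulrC ler_pM2r//; lra.
    have zv : (z ^+ 2 + v ^+ 2) / z <= u0 ^+ 2 + om ^+ 2 * u0 ^+ 4.
      rewrite ler_pdivrMr//; apply: (@le_trans _ _ (u0 ^+ 2 + om ^+ 2 * u0 ^+ 4)).
        by apply: lerD => //; rewrite ler_pXn2r// nnegrE ltW.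
      apply: ler_peMr => //; apply: addr_ge0; first exact: sqr_ge0.
      by apply: mulr_ge0; [exact: sqr_ge0|exact: exprn_ge0].
    have zv0 : 0 <= (z ^+ 2 + v ^+ 2) / z.
      by apply: divr_ge0; [apply: addr_ge0; exact: sqr_ge0|exact: ltW].
    have -> : 2 * k * Y q * (z ^+ 2 + v ^+ 2) / z = (2 * k * Y q) * ((z ^+ 2 + v ^+ 2) / z).
      by rewrite [RHS]mulrA.
    have -> : k * (u0 ^+ 2 + om ^+ 2 * u0 ^+ 4) * r = (k * r) * (u0 ^+ 2 + om ^+ 2 * u0 ^+ 4).
      by rewrite [LHS]mulrAC.
    apply: ler_pM => //.
      by apply: mulr_ge0; [apply: mulr_ge0 => //; exact: ltW|exact: ltW].
    have -> : 2 * k * Y q = k * (2 * Y q) by ring.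
    by rewrite ler_pM2l//; lra.
  have z2 : s <= s * z ^+ 2.
    by rewrite ler_peMr ?(ltW s0)// exprn_ege1.
  have Kr : K * r <= s / 2.
    by move: r5; rewrite invfM mulrA ler_pdivlMr// mulrC.
  move: tv xk yk Kr z2 s0; rewrite /K.
  set A := `|tau * v * _|; set B := (2 * k * x) ^+ 2; set C' := _ / z.
  move=> tv xk yk Kr z2 s0'.
  have E : (12 * `|tau| * om * u0 ^+ 2 * k + 4 * k ^+ 2 + k * (u0 ^+ 2 + om ^+ 2 * u0 ^+ 4)) * r
    = 6 * (`|tau| * (om * u0 ^+ 2) * (2 * k * r)) + 4 * k ^+ 2 * r +
      k * (u0 ^+ 2 + om ^+ 2 * u0 ^+ 4) * r by ring.
  rewrite E in Kr; lra.
Qed.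

End ThinSurface.

(** * Coordinates inverted at an ideal point *)

Section InversionContinuity.
Variables (R : realType) (tau : R) (S : topologicalType) (X Y T : S -> R).
Hypotheses (cX : continuous X) (cY : continuous Y) (cT : continuous T).
Hypothesis YS : forall q, 0 < Y q.
Variable x : R.

(** Height after inversion at x: the correction is 4 tau arg (z - x), of size less than 4 |tau| pi
    unless tau = 0. *)
Definition star_t q := T q + 4 * tau * (pi / 2 - atan ((X q - x) / Y q)).

Lemma sqdist_gt0 q : 0 < sqdist X Y x q.
Proof. by rewrite ltr_wpDl ?sqr_ge0// exprn_gt0. Qed.

Lemma continuous_star_x : continuous (fun q => - (X q - x) / sqdist X Y x q).
Proof.
move=> q; apply: cvgM.
  by apply: cvgN; apply: cvgB; [exact: cX|exact: cvg_cst].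
by apply: cvgV; [rewrite gt_eqF// sqdist_gt0|exact: continuous_sqdist].
Qed.

Lemma continuous_star_y : continuous (fun q => Y q / sqdist X Y x q).
Proof.
move=> q; apply: cvgM; first exact: cY.
by apply: cvgV; [rewrite gt_eqF// sqdist_gt0|exact: continuous_sqdist].
Qed.

Lemma continuous_star_t : continuous star_t.
Proof.
move=> q; apply: cvgD; first exact: cT.
apply: cvgM; first exact: cvg_cst.
apply: cvgB; first exact: cvg_cst.
apply: (@continuous_comp _ _ _ (fun q => (X q - x) / Y q) (@atan R)); last exact: continuous_atan.
apply: cvgM; first by apply: cvgB; [exact: cX|exact: cvg_cst].
by apply: cvgV; [rewrite gt_eqF|exact: cY].
Qed.

End InversionContinuity.

(** * The second sweep: the quadratic bound on y *)

Section HoroballBound.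
Variables (R : realType) (tau : R) (S : topologicalType).
Variables (X Y T : S -> R) (a b d : R).
Hypotheses (cX : continuous X) (cY : continuous Y) (cT : continuous T).
Hypothesis properS : forall x1 x2 y1 y2 t1 t2, 0 < y1 ->
  compact [set q | [/\ x1 <= X q <= x2, y1 <= Y q <= y2 & t1 <= T q <= t2]].
Hypothesis maxS : forall (p : S) (Phi : R -> R -> R -> R) (J : jet R),
  Y p <= d -> has_jet Phi (X p) (Y p) (T p) J -> 0 < level_curvature tau (Y p) J ->
  ~ (\forall q \near p, Phi (X q) (Y q) (T q) <= Phi (X p) (Y p) (T p)).
Hypothesis YS : forall q, 0 < Y q.
Hypothesis abS : forall q, `|X q| <= d -> Y q <= d -> T q != a /\ T q != b.
Hypothesis leftS : forall x, x < 0 -> exists2 y, 0 < y &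
  forall q, - d <= X q <= x -> a <= T q <= b -> y <= Y q.
Variables (om a' b' rho : R).
Hypotheses (om0 : 0 < om) (ab' : a' <= b') (ompi : om * (b' - a') < pi)
  (omM : 1 < (1 + 4 * tau ^+ 2) * om ^+ 2).
Hypotheses (rho0 : 0 < rho) (rhod : rho * 2 <= d).
Hypothesis twist : forall x, - rho <= x < 0 -> forall q,
  sqdist X Y x q <= rho ^+ 2 -> a <= T q <= b -> a' <= star_t tau X Y T x q <= b'.

(** Y / |z - x|^2, the y-coordinate after inversion, is constant on horocycles at x. On the rim the
    barrier is at most 1 / (rho c0), half the level used; neither depends on x. *)
Lemma horoball_bound_at x : - rho <= x < 0 -> forall q,
  sqdist X Y x q <= rho ^+ 2 -> a <= T q <= b ->
  Y q <= 2 / (rho * cos (om * (b' - a') / 2)) * sqdist X Y x q.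
Proof.
move=> xr; set c0 := cos _.
have rhod' := rhod; have rho0' := rho0.
pose tm := (a' + b') / 2.
have cs t : a' <= t <= b' -> 0 < c0 <= cos (om * (t - tm)).
  by move=> h; apply: cos_slab.
have aab : a' <= a' <= b' by rewrite lexx.
have c00 : 0 < c0 by case/andP: (cs _ aab).
pose c := 2 / (rho * c0).
have cgt0 : 0 < c by rewrite divr_gt0// mulr_gt0.
pose Phi := inversion (catenoid_barrier 0 0 om tm) tau x.
have PhiE q : Phi (X q) (Y q) (T q) =
    Y q / sqdist X Y x q / cos (om * (star_t tau X Y T x q - tm)).
  by rewrite /Phi /inversion /catenoid_barrier mul0r subr0.
have qpos q : 0 < sqdist X Y x q by exact: sqdist_gt0.
have [x1 x2] := andP xr.
have nx : `|x| <= rho by rewrite ltr0_norm//; lra.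
have main q : sqdist X Y x q <= rho ^+ 2 -> a <= T q <= b -> Phi (X q) (Y q) (T q) < c.
  move: q; apply: (@sweep _ tau _ X Y T a b d cX cY cT properS maxS YS abS x rho Phi c) => //.
  - by apply: (le_trans _ rhod); rewrite mulr_natr mulr2n lerD2r.
  - move=> q qr qT.
    apply: (@continuous_catenoid _ _ q (fun q => - (X q - x) / sqdist X Y x q)
       (fun q => Y q / sqdist X Y x q) (star_t tau X Y T x)).
    + exact: continuous_star_x.
    + exact: continuous_star_y.
    + exact: continuous_star_t.
    + have /andP[h1 h2] := cs _ (twist xr qr qT).
      by rewrite gt_eqF// (lt_le_trans h1).
  (* The pole x lies to the left of x / 2, where [leftS] bounds Y from below. To the right, |z - x|
     >= - x / 2, so the level c forces Y >= c c0 x^2 / 4. *)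
  - have x20 : x / 2 < 0 by lra.
    have [y y0 hy] := leftS x20.
    exists (Num.min y (c * c0 * (x ^+ 2 / 4))).
      have x20p : 0 < x ^+ 2 by rewrite exprn_even_gt0//= lt_eqF.
      by rewrite lt_min y0; apply: mulr_gt0; [exact: mulr_gt0|exact: divr_gt0].
    move=> q qr qT qc; rewrite ge_min.
    have [q1 q2 q3] := sqdist_le YS (ltW rho0) qr.
    have [h|h] := leP (X q) (x / 2).
      by rewrite hy//; apply/andP; split; lra.
    apply/orP; right.
    have /andP[h1 h2] := cs _ (twist xr qr qT).
    have h3 : c * c0 <= Y q / sqdist X Y x q.
      rewrite -ler_pdivlMr//; apply: (le_trans qc); rewrite PhiE.
      rewrite ler_pM2l; last exact: divr_gt0.
      by rewrite lef_pV2// posrE (lt_le_trans h1).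
    have h4 : c * c0 * sqdist X Y x q <= Y q by rewrite -ler_pdivlMr.
    apply: le_trans h4; rewrite ler_pM2l; last exact: mulr_gt0.
    apply: (@le_trans _ _ ((X q - x) ^+ 2)); last by rewrite lerDl sqr_ge0.
    have -> : x ^+ 2 / 4 = (- x / 2) ^+ 2 by field.
    by rewrite ler_pXn2r// ?nnegrE; lra.
  - move=> q qr qT.
    have qr' : sqdist X Y x q <= rho ^+ 2 by rewrite qr.
    have /andP[h1 h2] := cs _ (twist xr qr' qT).
    have [q1 q2 q3] := sqdist_le YS (ltW rho0) qr'.
    rewrite PhiE qr.
    apply: (@le_lt_trans _ _ (rho / rho ^+ 2 / c0)).
      apply: ler_pM.
      - by rewrite divr_ge0 ?sqr_ge0// ltW.
      - by rewrite invr_ge0 (le_trans (ltW h1)).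
      - by rewrite ler_pM2r// invr_gt0 exprn_gt0.
      - by rewrite lef_pV2// posrE (lt_le_trans h1).
    rewrite /c; have -> : rho / rho ^+ 2 / c0 = (rho * c0)^-1.
      by field; rewrite !gt_eqF.
    by rewrite ltr_pMl ?ltr1n//; rewrite invr_gt0; exact: mulr_gt0.
  - move=> q qr qT _.
    have qT' : a <= T q <= b by case/andP: qT => *; rewrite !ltW.
    have /andP[h1 h2] := cs _ (twist xr (ltW qr) qT').
    set cc := cos _ in h2; pose sn := sin (om * (star_t tau X Y T x q - tm)).
    have cc0 : 0 < cc by exact: lt_le_trans h2.
    have ccn := lt0r_neq0 cc0.
    pose X' := - (X q - x) / sqdist X Y x q; pose Y' := Y q / sqdist X Y x q.
    exists (inversion_jet tau (X q - x) (Y q) (catenoid_jet 0 (X' - 0) Y' cc^-1 (om * sn / cc ^+ 2)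
       (om ^+ 2 * (cc^-1 + 2 * sn ^+ 2 / cc ^+ 3)))).
      by apply: has_jet_inversion => //; apply: has_jet_catenoid.
    rewrite level_curvature_inversion//.
    apply: (@catenoid_curvature_gt0 _ _ _ _ _ _ _ _ ((1 + 4 * tau ^+ 2) * om ^+ 2 - 1)).
    + by apply: divr_gt0; [exact: YS|exact: qpos].
    + by rewrite invr_gt0.
    + apply: mulr_ge0; first exact: sqr_ge0.
      apply: addr_ge0; first by rewrite invr_ge0 ltW.
      apply: divr_ge0; last by apply: exprn_ge0; exact: ltW.
      by apply: mulr_ge0 => //; exact: sqr_ge0.
    + by field.
    + rewrite !(mulr0, mul0r) normr0 expr0n /= !(mulr0, addr0).
      by rewrite mulr_gt0 ?subr_gt0 ?exprn_gt0 ?invr_gt0.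
move=> q qr qT; have := main q qr qT; rewrite PhiE => h.
have /andP[h1 h2] := cs _ (twist xr qr qT).
rewrite -ler_pdivrMr//; apply: le_trans (ltW h).
rewrite ler_pMr; last exact: divr_gt0.
rewrite -[leLHS]invr1 lef_pV2 ?cos_le1// ?posrE//.
exact: lt_le_trans h2.
Qed.

(** The bound at - e passes to the limit e -> 0 because its constant does not depend on e. *)
Lemma horoball_bound : exists C r, [/\ 0 < C, 0 < r &
  forall q, sqdist X Y 0 q <= r ^+ 2 -> a <= T q <= b -> Y q <= C * sqdist X Y 0 q].
Proof.
have rhod' := rhod; have rho0' := rho0.
pose C := 2 / (rho * cos (om * (b' - a') / 2)).
have aab : a' <= a' <= b' by rewrite lexx.
have c00 : 0 < cos (om * (b' - a') / 2) by case/andP: (cos_slab om0 ab' ompi aab).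
have C0 : 0 < C by rewrite divr_gt0// mulr_gt0.
have r20 : 0 < rho / 2 by rewrite divr_gt0.
exists C, (rho / 2); split => // q qr qT.
have [q1 q2 q3] := sqdist_le YS (ltW r20) qr.
rewrite leNgt; apply/negP => h.
pose g := Y q - C * sqdist X Y 0 q.
have g0 : 0 < g by rewrite subr_gt0.
(* Moving the pole from 0 to - e changes C |z - x|^2 by at most 2 C e rho <= g / 2, half of the
   supposed excess. *)
pose e := Num.min (rho / 2) (g / (4 * C * rho)).
have e0 : 0 < e.
  by rewrite lt_min r20; apply: divr_gt0 => //; apply: mulr_gt0 => //; apply: mulr_gt0.
have [e1 e2] : e <= rho / 2 /\ e <= g / (4 * C * rho) by split; rewrite ge_min lexx ?orbT.
have er : - rho <= - e < 0 by apply/andP; split; lra.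
have sE : sqdist X Y (- e) q = sqdist X Y 0 q + 2 * e * X q + e ^+ 2.
  by rewrite /sqdist; ring.
have ex : e * X q <= e * (rho / 2) by rewrite ler_pM2l//; lra.
have ee : e ^+ 2 <= e * (rho / 2) by rewrite expr2 ler_pM2l.
have er2 : e * (rho / 2) <= rho ^+ 2 / 4.
  have -> : rho ^+ 2 / 4 = rho / 2 * (rho / 2) by field.
  by rewrite ler_pM2r.
have qr' : sqdist X Y (- e) q <= rho ^+ 2.
  have E : (rho / 2) ^+ 2 = rho ^+ 2 / 4 by field.
  by rewrite sE; rewrite E in qr; lra.
have := horoball_bound_at er qr' qT; rewrite -/C sE => h2.
have er0 : 0 < e * rho by exact: mulr_gt0.
have h3 : C * (2 * e * X q + e ^+ 2) <= C * (e * (2 * rho)).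
  by rewrite ler_pM2l//; lra.
have h4 : C * (e * (2 * rho)) <= g / 2.
  have -> : g / 2 = C * (g / (4 * C * rho) * (2 * rho)).
    by field; rewrite !gt_eqF.
  by rewrite ler_pM2l// ler_pM2r// mulr_gt0.
move: h2; rewrite -addrA mulrDr -/g => h2.
have : g <= g / 2 by rewrite {1}/g; lra.
lra.
Qed.

End HoroballBound.

Lemma atan_near_pihalf (R : realType) (e : R) : 0 < e ->
  exists2 w0, 1 <= w0 & forall w, w0 <= w -> pi / 2 - atan w < e.
Proof.
move=> e0; have := @cvgy_atan R => /cvgrPdist_lt /(_ _ e0) [A [Ar hA]].
exists (Num.max 1 (A + 1)) => [|w]; first by rewrite le_max lexx.
rewrite ge_max => /andP[_ wA].
have Aw : A < w by rewrite (lt_le_trans _ wA)// ltrDl.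
by have := hA w Aw; rewrite ltr_norml => /andP[].
Qed.

(** * The first sweep: the height after inversion *)

Section TwistBound.
Variables (R : realType) (tau : R) (S : topologicalType).
Variables (X Y T : S -> R) (a b d : R).
Hypotheses (cX : continuous X) (cY : continuous Y) (cT : continuous T).
Hypothesis properS : forall x1 x2 y1 y2 t1 t2, 0 < y1 ->
  compact [set q | [/\ x1 <= X q <= x2, y1 <= Y q <= y2 & t1 <= T q <= t2]].
Hypothesis maxS : forall (p : S) (Phi : R -> R -> R -> R) (J : jet R),
  Y p <= d -> has_jet Phi (X p) (Y p) (T p) J -> 0 < level_curvature tau (Y p) J ->
  ~ (\forall q \near p, Phi (X q) (Y q) (T q) <= Phi (X p) (Y p) (T p)).
Hypothesis YS : forall q, 0 < Y q.
Hypothesis abS : forall q, `|X q| <= d -> Y q <= d -> T q != a /\ T q != b.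
Hypothesis leftS : forall x, x < 0 -> exists2 y, 0 < y &
  forall q, - d <= X q <= x -> a <= T q <= b -> y <= Y q.
Hypothesis d0 : 0 < d.
Variable ep : R.
Hypothesis ep0 : 0 < ep.

Let A := 4 * `|tau|.
Let M := 1 + 4 * tau ^+ 2.
Let M1 : 1 <= M.
Proof. by rewrite lerDl; apply: mulr_ge0 => //; exact: sqr_ge0. Qed.
Let M0 : 0 < M. Proof. exact: lt_le_trans M1. Qed.
Let A0 : 0 <= A. Proof. exact: mulr_ge0. Qed.

(** Value of y' / (M x'^2 + y'^2) at the inverted point. It lies between Y / M and Y for every x,
    whence the uniformity in x. *)
Let H x q := Y q * sqdist X Y x q / (M * (X q - x) ^+ 2 + Y q ^+ 2).

Let den_gt0 x q : 0 < M * (X q - x) ^+ 2 + Y q ^+ 2.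
Proof. by apply: ltr_wpDl; [apply: mulr_ge0; [exact: ltW|exact: sqr_ge0]|exact: exprn_gt0]. Qed.

Let H_ge x q : Y q / M <= H x q.
Proof.
rewrite /H ler_pdivlMr// mulrAC -mulrA ler_pM2l// ler_pdivrMr// /sqdist.
have -> : ((X q - x) ^+ 2 + Y q ^+ 2) * M = M * (X q - x) ^+ 2 + M * Y q ^+ 2.
  by rewrite mulrDl !(mulrC M).
by rewrite lerD2l; apply: ler_peMl => //; exact: sqr_ge0.
Qed.

Let H_le x q : H x q <= Y q.
Proof.
rewrite /H ler_pdivrMr// ler_pM2l// /sqdist lerD2r.
by apply: ler_peMl => //; exact: sqr_ge0.
Qed.

(** On the rim of a half-disc of fixed radius, either Y is small, and then the point is far to the
    right of x with small argument, or Y is bounded below, and a large N makes the logarithm exceed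
    the whole twist. Close to x the logarithm is itself small, since H <= Y. *)
Lemma twist_bound : exists rho, [/\ 0 < rho, rho * 2 <= d &
  forall x, - rho <= x < 0 -> forall q,
  sqdist X Y x q <= rho ^+ 2 -> a <= T q <= b ->
  a - ep <= star_t tau X Y T x q <= b + ep].
Proof.
have ep0' := ep0; have d0' := d0; have A0' := A0.
have pi0 := @pi_gt0 R.
have ea0 : 0 < ep / (2 * (A + 1)) by apply: divr_gt0 => //; apply: mulr_gt0 => //; exact: ltr_wpDl.
have [W W1 hW] := atan_near_pihalf ea0.
have W0 : 0 < W by exact: lt_le_trans W1.
have {}hW w : W <= w -> A * (pi / 2 - atan w) <= ep / 2.
  move=> /hW h; apply: (@le_trans _ _ ((A + 1) * (ep / (2 * (A + 1))))).
    by apply: ler_pM => //; [rewrite subr_ge0 ltW// atan_ltpi2|rewrite lerDl|exact: ltW].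
  by rewrite le_eqVlt; apply/orP; left; apply/eqP; field; rewrite gt_eqF// ltr_wpDl.
pose r := d / 2.
have r0 : 0 < r by exact: divr_gt0.
have d8 : - (d / 8) < 0 by lra.
have [y' y'0 hy'] := leftS d8.
(* On the rim, Y < y3 forces X > - d / 8 by [hy'], then X - x >= d / 4, and so (X - x) / Y >= W. *)
pose y3 := Num.min y' (Num.min (d / 8) (d / (4 * W))).
have y30 : 0 < y3.
  by rewrite !lt_min y'0; apply/andP; split => //; apply/andP; split; apply: divr_gt0 => //; exact: mulr_gt0.
have [y3a y3b y3c] : [/\ y3 <= y', y3 <= d / 8 & y3 <= d / (4 * W)].
  by split; rewrite !ge_min lexx ?orbT.
(* Chosen so that Y >= y3, hence H >= y3 / M, gives ln (1 + N H) / 24 >= A pi, the largest possible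
   twist. *)
pose N := M / y3 * expR (24 * (A * pi)).
have N0 : 0 < N by apply: mulr_gt0; [exact: divr_gt0|exact: expR_gt0].
have theta_pos x q : 0 < pi / 2 - atan ((X q - x) / Y q) by rewrite subr_gt0 atan_ltpi2.
have theta_lt x q : pi / 2 - atan ((X q - x) / Y q) < pi.
  by have := atan_gtNpi2 ((X q - x) / Y q); lra.
(* The maximum of e t on [a, b]: b for e = 1 and - a for e = - 1. *)
pose Be e := e * (a + b) / 2 + (b - a) / 2.
have star_le e x q : e = 1 \/ e = -1 -> a <= T q <= b ->
    e * star_t tau X Y T x q <= Be e + A * (pi / 2 - atan ((X q - x) / Y q)).
  move=> he /andP[Ta Tb]; rewrite /star_t mulrDr.
  have h1 : e * T q <= Be e by rewrite /Be; case: he => ->; lra.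
  apply: lerD => //; rewrite mulrA ler_pM2r// /A.
  have h2 := ler_norm tau; have h3 := ler_norm (- tau); rewrite normrN in h3.
  by case: he => ->; lra.
have key e : e = 1 \/ e = -1 -> forall x, - (d / 4) <= x < 0 -> forall q,
    sqdist X Y x q <= r ^+ 2 -> a <= T q <= b ->
    e * star_t tau X Y T x q < Be e + 3 / 4 * ep + 24^-1 * ln (1 + N * H x q).
  move=> he x /andP[x1 x2].
  pose Phi := inversion (log_barrier M e N) tau x.
  have PhiE q : Phi (X q) (Y q) (T q) = e * star_t tau X Y T x q - 24^-1 * ln (1 + N * H x q).
    rewrite /Phi /inversion /log_barrier -/(sqdist X Y x q) -/(star_t tau X Y T x q).
    have s0 := lt0r_neq0 (sqdist_gt0 X YS x q).
    have dn0 := lt0r_neq0 (den_gt0 x q).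
    congr (_ - _ * ln (1 + N * _)); rewrite /H; field.
    by rewrite dn0 s0.
  have lnH q : 0 <= ln (1 + N * H x q).
    apply: ln_ge0; rewrite lerDl; apply: mulr_ge0; first exact: ltW.
    by apply: le_trans (H_ge x q); apply: divr_ge0; exact: ltW.
  suff main : forall q, sqdist X Y x q <= r ^+ 2 -> a <= T q <= b -> Phi (X q) (Y q) (T q) < Be e + 3 / 4 * ep.
    by move=> q qr qT; have := main q qr qT; rewrite PhiE ltrBlDr.
  have small q : a <= T q <= b -> W <= (X q - x) / Y q -> Phi (X q) (Y q) (T q) < Be e + 3 / 4 * ep.
    move=> qT /hW h; have h2 := star_le e x q he qT; have h3 := lnH q.
    by rewrite PhiE; lra.
  apply: (@sweep _ tau _ X Y T a b d cX cY cT properS maxS YS abS x r Phi) => //.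
  - by rewrite ltr0_norm// /r; lra.
  - move=> q qr qT.
    apply: (@continuous_log_barrier _ _ q (fun q => - (X q - x) / sqdist X Y x q)
       (fun q => Y q / sqdist X Y x q) (star_t tau X Y T x)) => //.
    + exact: continuous_star_x.
    + exact: continuous_star_y.
    + exact: continuous_star_t.
    + by apply: divr_gt0; [exact: YS|exact: sqdist_gt0].
  - have x20 : x / 2 < 0 by lra.
    have [y y0 hy] := leftS x20.
    (* Right of x / 2 one has X - x > - x / 2; below this height the slope then exceeds W, and
       [small] puts the point under the level. *)
    exists (Num.min y (- x / 2 / W)).
      by rewrite lt_min y0; apply: divr_gt0 => //; lra.
    move=> q qr qT qc; rewrite ge_min.
    have [q1 q2 q3] := sqdist_le YS (ltW r0) qr.
    have [h|h] := leP (X q) (x / 2).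
      by rewrite hy//; apply/andP; split=> //; rewrite /r in q1; lra.
    apply/orP; right; rewrite leNgt; apply/negP => h2.
    move: qc; rewrite leNgt small// ler_pdivlMr//.
    by move: h2; rewrite ltr_pdivlMr// mulrC => h2; lra.
  - move=> q qr qT.
    have qr' : sqdist X Y x q <= r ^+ 2 by rewrite qr.
    have [q1 q2 q3] := sqdist_le YS (ltW r0) qr'.
    have [hY|hY] := ltP (Y q) y3.
      apply: small => //.
      have hX : - (d / 8) < X q.
        rewrite ltNge; apply/negP => hX.
        have : y' <= Y q by apply: hy' => //; apply/andP; split=> //; rewrite /r in q1; lra.
        by rewrite leNgt (lt_le_trans hY).
      have hXx : d / 4 <= X q - x.
        rewrite leNgt; apply/negP => h.
        have : (X q - x) ^+ 2 <= (d / 4) ^+ 2.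
          by apply: sqr_le_norm; rewrite ler_norml; apply/andP; split; lra.
        have : Y q ^+ 2 <= (d / 8) ^+ 2.
          by apply: sqr_le_norm; rewrite gtr0_norm//; lra.
        have E1 : (d / 4) ^+ 2 = d ^+ 2 / 16 by field.
        have E2 : (d / 8) ^+ 2 = d ^+ 2 / 64 by field.
        have E3 : r ^+ 2 = d ^+ 2 / 4 by rewrite /r; field.
        have : 0 < d ^+ 2 by exact: exprn_gt0.
        by move: qr; rewrite /sqdist E1 E2 E3 => *; lra.
      rewrite ler_pdivlMr//; apply: le_trans hXx.
      apply: (@le_trans _ _ (W * (d / (4 * W)))).
        by rewrite ler_pM2l//; apply: le_trans y3c; exact: ltW.
      by rewrite le_eqVlt; apply/orP; left; apply/eqP; field; rewrite gt_eqF.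
    have hH : y3 / M <= H x q.
      by apply: le_trans (H_ge x q); rewrite ler_pM2r// invr_gt0.
    have hN : expR (24 * (A * pi)) <= N * H x q.
      apply: (@le_trans _ _ (N * (y3 / M))); last by rewrite ler_pM2l.
      by rewrite /N le_eqVlt; apply/orP; left; apply/eqP; field; rewrite !gt_eqF.
    have hl : 24 * (A * pi) <= ln (1 + N * H x q).
      rewrite -[leLHS]expRK ler_ln ?posrE ?expR_gt0//.
        by apply: (le_trans hN); rewrite lerDr.
      by apply: lt_le_trans (expR_gt0 (24 * (A * pi))) _; apply: (le_trans hN); rewrite lerDr.
    have h2 := star_le e x q he qT.
    have h3 : A * (pi / 2 - atan ((X q - x) / Y q)) <= A * pi.
      by apply: ler_wpM2l => //; apply: ltW.
    by rewrite PhiE; lra.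
  - move=> q qr qT _.
    pose X' := - (X q - x) / sqdist X Y x q; pose Y' := Y q / sqdist X Y x q.
    have Y'0 : 0 < Y' by apply: divr_gt0; [exact: YS|exact: sqdist_gt0].
    exists (inversion_jet tau (X q - x) (Y q) (log_jet M e N X' Y')).
      by apply: has_jet_inversion => //; apply: has_jet_log.
    rewrite level_curvature_inversion//; apply: log_jet_curvature_gt0 => //.
    by case: he => ->; rewrite ?sqrrN expr1n.
(* As H <= Y <= rho, the second bound gives ln (1 + N H) / 24 <= 6 ep / 24 = ep / 4, the part of ep
   left over by [key]. *)
exists (Num.min (d / 4) (6 * ep / N)).
set rho := Num.min _ _.
have rho0 : 0 < rho by rewrite lt_min; apply/andP; split; apply: divr_gt0 => //; exact: mulr_gt0.
have [rho1 rho2] : rho <= d / 4 /\ rho <= 6 * ep / N by split; rewrite ge_min lexx ?orbT.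
split => //; first lra.
move=> x /andP[x1 x2] q qr qT.
have x12 : - (d / 4) <= x < 0 by apply/andP; split; lra.
have qr' : sqdist X Y x q <= r ^+ 2.
  by apply: (le_trans qr); apply: sqr_le_norm; rewrite gtr0_norm// /r; lra.
have [q1 q2 q3] := sqdist_le YS (ltW rho0) qr.
have lnN : 24^-1 * ln (1 + N * H x q) <= ep / 4.
  have NH : N * H x q <= 6 * ep.
    rewrite mulrC -ler_pdivlMr//; apply: (le_trans (H_le x q)).
    exact: le_trans rho2.
  have NH0 : 0 <= N * H x q.
    apply: mulr_ge0; first exact: ltW.
    by apply: le_trans (H_ge x q); apply: divr_ge0; exact: ltW.
  have := @le_ln1Dx R (N * H x q); have -> : -1 < N * H x q by rewrite (lt_le_trans _ NH0).
  by move=> /(_ isT); lra.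
have k1 := key 1 (or_introl erefl) x x12 q qr' qT.
have k2 := key (-1) (or_intror erefl) x x12 q qr' qT.
by rewrite /Be in k1 k2; apply/andP; split; lra.
Qed.

End TwistBound.

(** * Combination of the three sweeps *)

Section OneSided.
Variables (R : realType) (tau : R) (S : topologicalType).
Variables (X Y T : S -> R) (a b d : R).

Lemma one_sided_away :
  continuous X -> continuous Y -> continuous T ->
  (forall x1 x2 y1 y2 t1 t2, 0 < y1 ->
    compact [set q | [/\ x1 <= X q <= x2, y1 <= Y q <= y2 & t1 <= T q <= t2]]) ->
  (forall (p : S) (Phi : R -> R -> R -> R) (J : jet R),
    Y p <= d -> has_jet Phi (X p) (Y p) (T p) J -> 0 < level_curvature tau (Y p) J ->
    ~ (\forall q \near p, Phi (X q) (Y q) (T q) <= Phi (X p) (Y p) (T p))) ->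
  (forall q, 0 < Y q) ->
  (forall q, `|X q| <= d -> Y q <= d -> T q != a /\ T q != b) ->
  (forall x, x < 0 -> exists2 y, 0 < y &
    forall q, - d <= X q <= x -> a <= T q <= b -> y <= Y q) ->
  0 < d -> a < b -> b - a < Num.sqrt (1 + 4 * tau ^+ 2) * pi ->
  exists2 e, 0 < e & forall q, a < T q < b -> `|X q| < e -> e <= Y q.
Proof.
move=> cX cY cT properS maxS YS abS leftS d0 ab abpi.
have pi0 := @pi_gt0 R.
have M0 : 0 < 1 + 4 * tau ^+ 2 by apply: ltr_pwDl => //; apply: mulr_ge0 => //; exact: sqr_ge0.
set m := Num.sqrt (1 + 4 * tau ^+ 2) in abpi.
have m0 : 0 < m by rewrite sqrtr_gt0.
have m2 : m ^+ 2 = 1 + 4 * tau ^+ 2 by rewrite sqr_sqrtr// ltW.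
(* A quarter of the spare width: enlarging [a, b] by ep at both ends uses up half of it. *)
pose ep := (m * pi - (b - a)) / 4.
have ep0 : 0 < ep by apply: divr_gt0 => //; rewrite subr_gt0.
pose L := b - a + 2 * ep.
have L0 : 0 < L by rewrite /L; lra.
have Lm : L < m * pi by rewrite /L /ep; lra.
(* pi / om is the midpoint of L and m pi, which gives both om L < pi and om m > 1. *)
pose om := 2 * pi / (L + m * pi).
have mp0 : 0 < m * pi by exact: mulr_gt0.
have s0 : 0 < L + m * pi by exact: addr_gt0.
have om0 : 0 < om by apply: divr_gt0 => //; exact: mulr_gt0.
have omL : om * L < pi.
  have -> : om * L = pi * (2 * L / (L + m * pi)).
    by rewrite /om; ring.
  by rewrite -[ltRHS]mulr1 ltr_pM2l// ltr_pdivrMr// mul1r; lra.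
have omm : 1 < om * m.
  have -> : om * m = 2 * (m * pi) / (L + m * pi) by rewrite /om; ring.
  by rewrite ltr_pdivlMr// mul1r; lra.
have omM : 1 < (1 + 4 * tau ^+ 2) * om ^+ 2.
  by rewrite -m2 -exprMn mulrC exprn_egt1.
have [rho [rho0 rhod tw]] := twist_bound cX cY cT properS maxS YS abS leftS d0 ep0.
have ab' : a - ep <= b + ep by lra.
have omL' : om * (b + ep - (a - ep)) < pi.
  by have -> : b + ep - (a - ep) = L by rewrite /L; ring.
have [C [r [C0 r0 thin]]] := horoball_bound cX cY cT properS maxS YS abS leftS
  om0 ab' omL' omM rho0 rhod tw.
have omab : om * (b - a) < pi.
  by apply: le_lt_trans omL; rewrite ler_pM2l// /L; lra.
exact: (@thin_surface_away _ tau _ X Y T a b d cX cY cT properS maxS YS abS d0 ab om om0 omab omM C r C0 r0 thin).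
Qed.

End OneSided.

(** * Curves in the asymptotic boundary *)

(* lra stops at equations between points of a topological space. *)
Ltac lra_in R := repeat match goal with H : @eq ?A _ _ |- _ =>
  tryif unify A (Real.sort R) then fail else clear H end; lra.

Section Paths.
Variables (R : realType) (T : topologicalType).
Implicit Types c e : R -> T.

Lemma extend_path c : {within `[0, 1], continuous c} ->
  exists2 c', continuous c' & {in `[0, 1], c' =1 c}.
Proof.
move=> /subspace_continuousP cc.
pose k (t : R) := Num.max 0 (Num.min t 1).
have k01 t : k t \in `[0 : R, 1].
  by rewrite in_itv /= /k le_max lexx /= ge_max ler01 ge_min lexx orbT.
have ck : continuous k.
  move=> t; apply: (@continuous_max R R^o (fun=> 0) (fun t => Num.min t 1)) => //.
    exact: cst_continuous.
  by apply: (@continuous_min R R^o id (fun=> 1)) => //; exact: cst_continuous.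
exists (c \o k); last first.
  move=> t; rewrite in_itv /= => /andP[t0 t1].
  by rewrite /= /k (min_idPl t1) (max_idPr t0).
move=> t U /= cU.
have /= h := cc (k t) (k01 t) U cU.
have : \forall s \near t, `[0, 1]%classic (k s) -> U (c (k s)) by exact: ck h.
by apply: filterS => s; apply; exact: k01.
Qed.

Lemma continuous_glue (f g : R -> T) (m : R) : continuous f -> continuous g ->
  f m = g m -> continuous (fun t => if t <= m then f t else g t).
Proof.
move=> cf cg fg t; have [tm|mt|tm] := ltgtP t m; rewrite /continuous_at.
- rewrite (ltW tm); apply: (cvg_trans _ (cf t)); apply: near_eq_cvg.
  have : \forall s \near t, s < m by exact: lt_nbhsl.
  by apply: filterS => s /ltW ->.
- rewrite [t <= m]leNgt mt /=; apply: (cvg_trans _ (cg t)); apply: near_eq_cvg.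
  have : \forall s \near t, m < s by exact: lt_nbhsr.
  by apply: filterS => s ms; rewrite leNgt ms.
- rewrite tm lexx => U fU.
  have gU : nbhs (g m) U by rewrite -fg.
  have h1 : \forall s \near m, U (f s) by exact: cf fU.
  have h2 : \forall s \near m, U (g s) by exact: cg gU.
  apply: (@filterS2 _ _ _ _ _ _ _ h1 h2) => s fs gs /=; by case: ifP.
Qed.

(** The base point is where the parameter of a loop jumps; shifting by half a turn moves it away
    from a prescribed point p. *)
Lemma rebase_loop e p : {within `[0, 1], continuous e} -> e 0 = e 1 ->
  {in `[0, 1[ &, injective e} ->
  exists e', [/\ continuous e', e' 0 = e' 1, {in `[0, 1[ &, injective e'},
    e @` `[0, 1] = e' @` `[0, 1] & e' 0 != p].
Proof.
move=> /extend_path[e1 c1 e1E] e01 inje.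
have E0 : (0 : R) \in `[0, 1] by rewrite in_itv /= lexx ler01.
have E1 : (1 : R) \in `[0, 1] by rewrite in_itv /= lexx ler01.
have e101 : e1 0 = e1 1 by rewrite !e1E.
have inj1 : {in `[0, 1[ &, injective e1}.
  move=> x y x01 y01; rewrite !e1E; first exact: inje.
  - by move: y01; rewrite !in_itv /= => /andP[-> /ltW].
  - by move: x01; rewrite !in_itv /= => /andP[-> /ltW].
have im1 : e @` `[0, 1] = e1 @` `[0, 1].
  by apply/seteqP; split => _ [u u01 <-]; exists u => //; rewrite e1E.
rewrite im1; clear inje im1 e01 e1E.
have [e1p|e1p] := pselect (e1 0 = p); last by exists e1; split => //; apply/eqP.
pose h : R := 2^-1.
pose e2 t := if t <= h then e1 (t + h) else e1 (t - h).
have hh : h + h = 1 by rewrite /h; lra_in R.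
have h0 : 0 < h by rewrite /h; lra_in R.
exists e2; split.
- apply: continuous_glue.
  + by move=> t; apply: continuous_comp; [apply: cvgD => //; exact: cvg_cst|exact: c1].
  + by move=> t; apply: continuous_comp; [apply: cvgB => //; exact: cvg_cst|exact: c1].
  + by rewrite subrr hh.
- rewrite /e2 ltW// add0r; case: ifPn => h1; first by exfalso; lra_in R.
  by congr e1; lra_in R.
- have v t : t \in `[0, 1[ -> exists2 u, u \in `[0, 1[ & e2 t = e1 u /\
      ((t <= h /\ (u = t + h \/ t = h /\ u = 0)) \/ (h < t /\ u = t - h)).
    rewrite in_itv /= => /andP[t0 t1]; rewrite /e2; case: (ltgtP t h) => th.
    + by exists (t + h); [rewrite in_itv /=; lra_in R|split => //; left; split => //; left].
    + by exists (t - h); [rewrite in_itv /=; lra_in R|split => //; right].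
    + exists 0; first by rewrite in_itv /= lexx ltr01.
      by split; [rewrite th hh|left; split => //; right].
  move=> s t s01 t01 est.
  have [u u01 [eu hu]] := v s s01; have [w w01 [ew hw]] := v t t01.
  have uw : u = w by apply: inj1 => //; rewrite -eu -ew.
  move: s01 t01; rewrite !in_itv /=; subst w.
  clear est eu ew.
  case: hu => [[a1 [a2|[a2 a3]]]|[a1 a2]]; case: hw => [[b1 [b2|[b2 b3]]]|[b1 b2]];
    by lra_in R.
- apply/seteqP; split => _ [u u01 <-]; move: u01; rewrite /= in_itv /= => /andP[u0 u1].
  + have [uh|hu] := ltP u h.
      exists (u + h); first by rewrite /= in_itv /=; lra_in R.
      rewrite /e2; case: ifPn => th; last by congr e1; lra_in R.
      by have -> : u = 0 by [lra_in R]; rewrite e101 add0r; congr e1.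
    exists (u - h); first by rewrite /= in_itv /=; lra_in R.
    by rewrite /e2 ifT; [congr e1; lra_in R|lra_in R].
  + rewrite /e2; case: ifPn => th; [exists (u + h)|exists (u - h)] => //.
      by rewrite /= in_itv /=; lra_in R.
    by move: th; rewrite -ltNge /= in_itv /=; lra_in R.
- rewrite /e2 ltW// add0r -e1p; apply/eqP => /inj1; rewrite !in_itv /= lexx ltr01.
  by move=> H; have := H (ltac:(by rewrite /h; lra_in R)) isT; lra_in R.
Qed.

Hypothesis hT : hausdorff_space T.

Lemma path_closed e a b : continuous e -> closed (e @` `[a, b]).
Proof.
move=> ce; apply: compact_closed => //.
by apply: continuous_compact; [exact: continuous_subspaceT|exact: segment_compact].
Qed.

Lemma closed_nbhs_setC (K : set T) p : closed K -> ~ K p -> nbhs p (~` K).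
Proof. by move=> cK Kp; apply: open_nbhs_nbhs; split => //; exact: closed_openC. Qed.

(** Away from the base point, the arc lifts to a parameter [psi] of the loop that is continuous and
    injective, hence monotone. So [psi s] lies strictly between [psi l] and [psi r], and nearby
    points of the loop have their parameter in this interval. *)
Lemma loop_arc_nbhs e c l r : continuous e -> e 0 = e 1 ->
  {in `[0, 1[ &, injective e} ->
  continuous c -> {in `[l, r] &, injective c} ->
  (forall s, s \in `[l, r] -> (e @` `[0, 1]) (c s) /\ c s != e 0) ->
  forall s, s \in `]l, r[ -> exists2 U, nbhs (c s) U &
    forall q, U q -> (e @` `[0, 1]) q -> (c @` `[l, r]) q.
Proof.
move=> ce e01 inje cc injc cK s slr.
have /choice[psi hpsi] : forall s, exists u, s \in `[l, r] ->
    (u \in `]0, 1[) /\ e u = c s.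
  move=> t; have [tlr|tlr] := boolP (t \in `[l, r]); last by exists 0.
  have [[u /= u01 ue] ne] := cK _ tlr; exists u => _; split => //.
  move: u01; rewrite !in_itv /= !le_eqVlt => /andP[/orP[/eqP u0|->]].
    by move: ne; rewrite -ue -u0 eqxx.
  by move=> /orP[/eqP u1|->//]; move: ne; rewrite -ue u1 e01 eqxx.
have far t a b : t \in `[l, r] -> a < psi t < b ->
    ~ (e @` `[0, a] `|` e @` `[b, 1]) (c t).
  move=> tlr /andP[ap pb].
  have [+ pe] := hpsi _ tlr; rewrite in_itv /= => /andP[p0 p1].
  have main v : v \in `[0, 1] -> e v = c t -> v = psi t.
    rewrite in_itv /= => /andP[v0]; rewrite le_eqVlt => /orP[/eqP v1|v1] ev.
      have /inje : e 0 = e (psi t) by rewrite e01 -v1 ev pe.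
      by rewrite !in_itv /= lexx ltr01 (ltW p0) p1 => /(_ isT isT) z0; move: p0; rewrite -z0 ltxx.
    by apply: inje; rewrite ?in_itv /= ?v0 ?v1 ?p1 ?(ltW p0)// ev.
  move=> [] [v /=]; rewrite in_itv /= => /andP[v0 v1] /main h.
    by have := h (ltac:(by rewrite in_itv /= v0 (le_trans v1)// ltW// (lt_trans ap))); lra_in R.
  by have := h (ltac:(by rewrite in_itv /= v1 (le_trans _ v0)// ltW// (lt_trans _ pb))); lra_in R.
have Fcl a b : closed (e @` `[0, a] `|` e @` `[b, 1]).
  by apply: closedU; exact: path_closed.
(* If [psi t'] were eps away from [psi t], then c t' would lie in a closed set that misses c t. *)
have cpsi : {within `[l, r], continuous psi}.
  apply/subspace_continuousP => t tlr.
  apply/cvgrPdist_lt => eps eps0.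
  have : nbhs (c t) (~` (e @` `[0, psi t - eps] `|` e @` `[psi t + eps, 1])).
    by apply: closed_nbhs_setC => //; apply: far => //; lra_in R.
  move=> /cc nF; rewrite near_withinE.
  have {nF} : \forall t' \near t,
    ~ (e @` `[0, psi t - eps] `|` e @` `[psi t + eps, 1]) (c t') by exact: nF.
  apply: filterS => t' h t'lr.
  have [+ pe] := hpsi _ t'lr; rewrite in_itv /= => /andP[p0 p1].
  rewrite ltr_norml; apply/andP; split; rewrite ltNge; apply/negP => h1; apply: h.
    have {}h1 : psi t - psi t' <= - eps := h1.
    by right; exists (psi t') => //=; rewrite in_itv /=; lra_in R.
  have {}h1 : eps <= psi t - psi t' := h1.
  by left; exists (psi t') => //=; rewrite in_itv /=; lra_in R.
have injpsi : {in `[l, r] &, injective psi}.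
  move=> t t' tlr t'lr tt'; apply: injc => //.
  by rewrite -(hpsi _ tlr).2 -(hpsi _ t'lr).2 tt'.
have lr : l < r by move: slr; rewrite in_itv /= => /andP[]; exact: lt_trans.
have [Il Ir Is] : [/\ l \in `[l, r], r \in `[l, r] & s \in `[l, r]].
  move: slr; rewrite !in_itv /= !lexx (ltW lr) => /andP[a b].
  by rewrite (ltW a) (ltW b).
have btw : Num.min (psi l) (psi r) < psi s < Num.max (psi l) (psi r).
  move: slr; rewrite in_itv /= => /andP[ls sr].
  have [mono|mono] := itv_continuous_inj_mono cpsi injpsi.
    have h1 : psi l < psi s by exact: mono.
    have h2 : psi s < psi r by exact: mono.
    by rewrite gt_min h1 /= lt_max h2 orbT.
  have h1 : psi s < psi l by exact: mono.
  have h2 : psi r < psi s by exact: mono.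
  by rewrite gt_min h2 orbT /= lt_max h1.
(* What remains of the loop has parameters between [psi l] and [psi r]; by the intermediate value
   theorem [psi] takes all of them. *)
exists (~` (e @` `[0, Num.min (psi l) (psi r)] `|` e @` `[Num.max (psi l) (psi r), 1])).
  by apply: closed_nbhs_setC => //; exact: far.
move=> q nq [u /= u01 ueq].
have : Num.min (psi l) (psi r) <= u <= Num.max (psi l) (psi r).
  move: u01; rewrite in_itv /= => /andP[u0 u1].
  apply/andP; split; rewrite leNgt; apply/negP => h; apply: nq.
    by left; exists u => //=; rewrite in_itv /= u0 ltW.
  by right; exists u => //=; rewrite in_itv /= u1 andbT ltW.
move=> /(IVT (ltW lr) cpsi)[t tlr ptu].
by exists t => //; rewrite -(hpsi _ tlr).2 ptu.
Qed.

(** The other components are finitely many closed sets and can be avoided near c s; this reduces to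
    one loop, rebased away from c s, and a short piece of the arc. *)
Lemma arc_nbhs (n : nat) (C : 'I_n -> set T) c :
  (forall i, exists e : R -> T, [/\ {within `[0, 1], continuous e}, e 0 = e 1,
     {in `[0, 1[ &, injective e} & C i = e @` `[0, 1]]) ->
  trivIset setT C -> continuous c -> {in `[0, 1] &, injective c} ->
  c @` `[0, 1] `<=` \bigcup_i C i ->
  forall s, s \in `]0, 1[ -> exists2 U, nbhs (c s) U &
    forall q, U q -> (\bigcup_i C i) q -> (c @` `[0, 1]) q.
Proof.
move=> hC trC cc injc cC s s01.
have s01' : s \in `[0, 1] by move: s01; rewrite !in_itv /= => /andP[/ltW -> /ltW].
have Ccl i : closed (C i).
  have [e [/extend_path[e' ce' e'e] _ _ ->]] := hC i.
  suff -> : e @` `[0, 1] = e' @` `[0, 1] by exact: path_closed.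
  by apply/seteqP; split => _ [u u01 <-]; exists u => //; rewrite e'e.
have [i _ Ci] : (\bigcup_i C i) (c s) by apply: cC; exists s.
have [e0 [ce0 e01 inje Ce]] := hC i.
have [e [ce {}e01 {}inje Cee ecs]] := rebase_loop (c s) ce0 e01 inje.
pose V := ~` (\bigcup_(j in [set j | j != i]) C j) `&` ~` [set e 0].
have V1 : nbhs (c s) (~` (\bigcup_(j in [set j | j != i]) C j)).
  apply: closed_nbhs_setC; first by apply: closed_bigcup => //; exact: finite_finset.
  move=> [j /= ji Cj]; move: ji => /eqP; apply.
  by apply: trC => //; exists (c s).
have V2 : nbhs (c s) (~` [set e 0]).
  apply: closed_nbhs_setC; first exact: accessible_closed_set1 (hausdorff_accessible hT) _.
  by move=> /= h; move: ecs; rewrite h eqxx.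
have VV : nbhs (c s) V by exact: filterI.
have /nbhs_ballP[eta /= eta0 heta] := cc s V VV.
move: s01; rewrite in_itv /= => /andP[s0 s1].
pose l := Num.max 0 (s - eta / 2); pose r := Num.min 1 (s + eta / 2).
have [l0 r1 lr] : [/\ 0 <= l, r <= 1 & s \in `]l, r[].
  split; [by rewrite /l le_max lexx|by rewrite /r ge_min lexx|].
  rewrite in_itv /= /l /r gt_max lt_min s0 s1 /=.
  by apply/andP; split; lra_in R.
have lrV t : t \in `[l, r] -> t \in `[0, 1] /\ V (c t).
  rewrite !in_itv /= => /andP[lt tr]; split; first by rewrite (le_trans l0)//= (le_trans tr).
  apply: heta; rewrite /ball /= ltr_norml.
  move: lt tr; rewrite /l /r ge_max le_min => /andP[_ ?] /andP[_ ?]; lra_in R.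
have [] := @loop_arc_nbhs e c l r ce e01 inje cc _ _ s lr.
- by move=> x y /lrV[x01 _] /lrV[y01 _]; exact: injc.
- move=> t /lrV[t01 [Vt1 Vt2]]; split; last by apply/eqP.
  rewrite -Cee -Ce.
  have [j _ Cj] : (\bigcup_i C i) (c t) by apply: cC; exists t.
  have [<-//|ji] := eqVneq j i.
  by exfalso; apply: Vt1; exists j.
move=> U nU hU; exists (U `&` V); first exact: filterI.
move=> q [Uq [Vq _]] [j _ Cj].
have ji : j = i by apply/eqP/negPn/negP => ji; apply: Vq; exists j.
have [] := hU q Uq; first by rewrite -Cee -Ce -ji.
by move=> t /= tlr <-; exists t => //=; have [] := lrV t tlr.
Qed.

End Paths.

(** * Topology of the product compactification *)

Lemma nbhs_setX (U V : topologicalType) (x : U) (y : V) (A : set U) (B : set V) :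
  nbhs x A -> nbhs y B -> nbhs (x, y) (A `*` B).
Proof. by move=> xA yB; exists (A, B). Qed.

Lemma hausdorff_prod (U V : topologicalType) :
  hausdorff_space U -> hausdorff_space V -> hausdorff_space (U * V)%type.
Proof.
move=> hU hV [p1 p2] [q1 q2] cl; congr pair.
  apply: hU => A B pA qB.
  have [z [[/= Az _] [/= Bz _]]] := cl (A `*` setT) (B `*` setT)
    (nbhs_setX pA (@filterT _ _ _)) (nbhs_setX qB (@filterT _ _ _)).
  by exists z.1.
apply: hV => A B pA qB.
have [z [[/= _ Az] [/= _ Bz]]] := cl (setT `*` A) (setT `*` B)
  (nbhs_setX (@filterT _ _ _) pA) (nbhs_setX (@filterT _ _ _) qB).
by exists z.2.
Qed.

Section Ambient.
Variable R : realType.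

Lemma ambient_hausdorff : hausdorff_space (ambient R).
Proof.
have hRR : hausdorff_space (R * R)%type by apply: hausdorff_prod; exact: Rhausdorff.
apply: hausdorff_prod; last exact: ereal_hausdorff.
apply: one_point_compactification_hausdorff => //.
have nb (z : R) : nbhs z `[z - 1, z + 1]%classic.
  apply: (@filterS _ _ _ _ _ _ (nbhsx_ballx z 1 ltr01)) => w.
  by rewrite /ball /= ltr_norml in_itv /=; lra.
have cpt (p : R * R) : compact (`[p.1 - 1, p.1 + 1] `*` `[p.2 - 1, p.2 + 1]).
  by apply: compact_setX; exact: segment_compact.
move=> p _; exists (`[p.1 - 1, p.1 + 1] `*` `[p.2 - 1, p.2 + 1]).
  by rewrite withinET; case: p => x y; exact: nbhs_setX.
by split => //; apply: compact_closed.
Qed.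

Lemma vertical_nbhs x t (U : set (ambient R)) : nbhs (vertical_point x t) U ->
  exists2 e, 0 < e & forall x' y' t', `|x' - x| < e -> `|y'| < e ->
    `|t' - t| < e -> U (planar_point x' y', t'%:E).
Proof.
move=> [[A B] /= [nA nB] ABU].
have {nA} : nbhs (x, 0 : R) (Some @^-1` A) by exact: nA.
move=> [[A1 A2] /= [/nbhs_ballP[e1 /= e10 h1] /nbhs_ballP[e2 /= e20 h2]] hA].
have {nB} : nbhs t (EFin @^-1` B) by exact: nB.
move=> /nbhs_ballP[e3 /= e30 h3].
exists (Num.min e1 (Num.min e2 e3)); first by rewrite !lt_min e10 e20.
move=> x' y' t'; rewrite !lt_min => /and3P[a1 a2 a3] /and3P[b1 b2 b3] /and3P[c1 c2 c3].
apply: ABU; split => /=; last by apply: h3; rewrite /ball /= distrC.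
apply: (hA (x', y')); split; [apply: h1|apply: h2].
  by rewrite /ball /= distrC.
by rewrite /ball /= sub0r normrN.
Qed.

Lemma vertical_box_nbhs (x t e : R) : 0 < e -> nbhs (vertical_point x t)
  [set q : ambient R | exists x' y' t' : R, [/\ `|x' - x| < e, `|y'| < e, `|t' - t| < e &
    q = (planar_point x' y', t'%:E)]].
Proof.
move=> e0.
have n1 : nbhs (planar_point x 0) (Some @` (ball x e `*` ball (0 : R) e)).
  by apply: one_point_compactification_some_nbhs; apply: nbhs_setX; exact: nbhsx_ballx.
have n2 : nbhs t%:E (EFin @` ball t e).
  apply/nbhs_EFin; apply: (@filterS _ _ _ _ _ _ (nbhsx_ballx t e e0)) => t' h.
  by exists t'.
apply: (@filterS _ _ _ _ _ _ (nbhs_setX n1 n2)) => -[q1 q2] [/= [[x' y'] [/= a b] <-] [t' c <-]].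
exists x', y', t'; split => //.
- by rewrite distrC.
- by move: b; rewrite /ball /= sub0r normrN.
- by rewrite distrC.
Qed.

End Ambient.

(** * A window around a point of the curve on the line *)

Section Window.
Variable R : realType.

Lemma norm_sign (s : R) : s ^+ 2 = 1 -> `|s| = 1.
Proof. by move=> s2; apply/eqP; rewrite -sqrp_eq1// real_normK ?num_real// s2. Qed.

(** The supremum s of the points of [t0, t1] outside A' belongs to A', as A' is closed. Near s the
    sets A and A' agree, so a point outside A' slightly below s is outside A as well. *)
Lemma gap_below (A A' : set R) (t0 t1 : R) : closed A' -> A' t1 -> ~ A' t0 -> t0 < t1 ->
  (forall t, A' t -> exists2 e, 0 < e & forall t', `|t' - t| < e -> A t' -> A' t') ->
  exists a, [/\ t0 < a < t1, ~ A a & forall t, a <= t <= t1 -> A t -> A' t].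
Proof.
move=> cA' A1 A0 t01 loc.
have away t : ~ A' t -> exists2 e, 0 < e & forall t', `|t' - t| < e -> ~ A' t'.
  move=> /(closed_nbhs_setC cA')/nbhs_ballP[e /= e0 h]; exists e => // t' t'e.
  by apply: h; rewrite /ball /= distrC.
have [e0 e00 he0] := away _ A0.
(* Starting above t0, still outside A', makes t0 < a strict. *)
pose u0 := t0 + e0 / 2.
have u0A : ~ A' u0 by apply: he0; rewrite /u0 addrAC subrr add0r ger0_norm; lra.
have u01 : u0 < t1.
  rewrite ltNge; apply/negP => h; apply: (he0 t1) => //.
  by rewrite ger0_norm; rewrite /u0 in h; lra.
pose E := [set t | u0 <= t <= t1 /\ ~ A' t].
have supE : has_sup E.
  split; first by exists u0; split => //; rewrite lexx ltW.
  by exists t1 => t [/andP[]].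
pose s := sup E.
have s1 : s <= t1 by apply: ge_sup; [case: supE|move=> t [/andP[]]].
have s0 : u0 <= s by apply: sup_upper_bound => //; split => //; rewrite lexx ltW.
have after t : s < t <= t1 -> A' t.
  move=> /andP[st tt1]; apply: contrapT => nA.
  have : t <= s by apply: sup_upper_bound => //; split => //; rewrite tt1 (le_trans s0)// ltW.
  by rewrite leNgt st.
have As : A' s.
  apply: contrapT => nA; have [e ee0 he] := away _ nA.
  have st1 : s < t1 by rewrite lt_neqAle s1 andbT; apply/eqP => st1; apply: nA; rewrite st1.
  pose w := Num.min t1 (s + e / 2).
  have [w1 w2] : w <= t1 /\ w <= s + e / 2 by split; rewrite ge_min lexx ?orbT.
  have sw : s < w by rewrite lt_min st1 /= ltrDl divr_gt0.
  by apply: (he w); [rewrite ger0_norm; lra|apply: after; rewrite sw w1].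
have [e ee0 he] := loc _ As.
have [a Ea sa] := sup_adherent ee0 supE.
have {}sa : s - e < a := sa.
have [/andP[u0a at1] nA'a] := Ea.
have as_ : a <= s by exact: sup_upper_bound.
have as' : a < s by rewrite lt_neqAle as_ andbT; apply/eqP => h; apply: nA'a; rewrite h.
exists a; split.
- by rewrite (lt_le_trans as' s1) andbT (lt_le_trans _ u0a)// /u0; lra.
- by move=> Aa; apply: nA'a; apply: he => //; rewrite ler0_norm; lra.
- move=> t /andP[ta tt1] At; have [ts|st] := leP t s.
    by apply: he => //; rewrite ler0_norm; lra.
  by apply: after; rewrite st.
Qed.

Lemma segment_uniform (a b : R) (P : R -> R -> Prop) :
  (forall e e' t, e' <= e -> P e t -> P e' t) ->
  (forall t, a <= t <= b -> exists2 e, 0 < e & forall t', `|t' - t| < e -> P e t') ->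
  exists2 e, 0 < e & forall t, a <= t <= b -> P e t.
Proof.
move=> monoP loc.
have ncov : near_covering `[a, b]%classic.
  by apply/compact_near_coveringP; exact: segment_compact.
have [] := ncov R ((0 : R)^'+) P _.
  move=> t /=; rewrite in_itv /= => /loc[e e0 he].
  exists (ball t e, [set e' | e' <= e]); last first.
    by move=> [t' e'] /= [t1 e1]; apply: monoP e1 _; apply: he; rewrite distrC.
  by split; [exact: nbhsx_ballx|exact: nbhs_right_le].
move=> /= e e0 h; exists (e / 2); first exact: divr_gt0.
move=> t tab; apply: (h (e / 2)); rewrite /= ?divr_gt0//.
by rewrite sub0r normrN ger0_norm; lra.
Qed.

(** Heights a and b outside [Gamma] exist because [Gamma'] avoids the ends of the slab and is open
    in [Gamma] near the line. Between them [Gamma] meets the line only in [Gamma'], so the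
    one-sidedness of [Gamma'] passes to [Gamma] near the line; compactness of [a, b] makes this
    uniform. *)
Lemma curve_window (ell : R) (Gamma : set (ambient R))
    (hGamma : asymptotic_curve Gamma)
    (x0 : R) (Gamma' : set (ambient R)) (p q : ambient R)
    (harc : is_arc Gamma' p q) (hsub : Gamma' `<=` Gamma)
    (hmeet : Gamma' `&` vertical_line x0 !=set0)
    (hends : ~ vertical_line x0 p /\ ~ vertical_line x0 q)
    (hside : one_side x0 Gamma')
    (hslab : exists t0 : R, Gamma' `<=` vertical_slab t0 (t0 + ell)) :
  exists s a b t1 d, [/\ s ^+ 2 = 1, 0 < d /\ b - a < ell,
    a < t1 < b /\ Gamma (vertical_point x0 t1),
    (forall x t, - d <= s * (x - x0) < 0 -> a <= t <= b ->
      ~ Gamma (vertical_point x t)) &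
    (forall x, `|x - x0| <= d ->
      ~ Gamma (vertical_point x a) /\ ~ Gamma (vertical_point x b))].
Proof.
have hT := @ambient_hausdorff R.
case: hGamma => n [C [hC trC GC _]].
case: harc => c0 [/extend_path[c cc c0c] injc0 G'c0 c0p c1q].
have G'c : Gamma' = c @` `[0, 1].
  by rewrite G'c0; apply/seteqP; split => _ [u u01 <-]; exists u => //; rewrite c0c.
have injc : {in `[0, 1] &, injective c}.
  by move=> u v u01 v01; rewrite !c0c//; exact: injc0.
have cp : c 0 = p by rewrite c0c// in_itv /= lexx ler01.
have cq : c 1 = q by rewrite c0c// in_itv /= lexx ler01.
have clG' : closed Gamma' by rewrite G'c; exact: path_closed.
have clG : closed Gamma.
  rewrite GC; apply: closed_bigcup; [exact: finite_finset|move=> i _].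
  have [e [/extend_path[e' ce' e'e] _ _ ->]] := hC i.
  suff -> : e @` `[0, 1] = e' @` `[0, 1] by exact: path_closed.
  by apply/seteqP; split => _ [u u01 <-]; exists u => //; rewrite e'e.
have vinj x t x' t' : vertical_point x t = vertical_point x' t' -> x = x' /\ t = t'.
  by case.
have local t : Gamma' (vertical_point x0 t) -> exists2 e, 0 < e & forall x' t',
    `|x' - x0| < e -> `|t' - t| < e -> Gamma (vertical_point x' t') ->
    Gamma' (vertical_point x' t').
  rewrite {1}G'c => -[u /= u01 cu].
  have u01' : u \in `]0, 1[.
    move: u01; rewrite !in_itv /= !le_eqVlt => /andP[/orP[/eqP u0|->] /orP[/eqP u1|->]] //=;
    exfalso; case: hends => hp hq; first [by apply: hp; exists t => //; rewrite -cp u0 cu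
      |by apply: hq; exists t => //; rewrite -cq -u1 cu].
  have [] := @arc_nbhs R _ hT n C c hC trC cc injc _ u u01'.
    by rewrite -G'c -GC.
  move=> U; rewrite cu => /vertical_nbhs[e e0 he] hU; exists e => // x' t' h1 h2 h3.
  by rewrite G'c; apply: hU; [apply: he; rewrite ?normr0|rewrite -GC].
have away x t : ~ Gamma (vertical_point x t) -> exists2 e, 0 < e & forall x' t',
    `|x' - x| < e -> `|t' - t| < e -> ~ Gamma (vertical_point x' t').
  move=> /(closed_nbhs_setC clG)/vertical_nbhs[e e0 he]; exists e => // x' t' h1 h2.
  by apply: he; rewrite ?normr0.
have [w [G'1 [t1 _ wE]]] := hmeet; rewrite -wE in G'1; clear w wE.
have [t0 slab] := hslab.
have slabt t : Gamma' (vertical_point x0 t) -> t0 < t < t0 + ell.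
  by move=> /slab[x [t' [h /vinj[_ ->]]]].
pose A := [set t | Gamma (vertical_point x0 t)].
pose A' := [set t | Gamma' (vertical_point x0 t)].
have clA' : closed A'.
  apply: (@preimage_closed _ _ (vertical_point x0)) clG' => t _ U /vertical_nbhs[e e0 he].
  apply/nbhs_ballP; exists e => //= t' tt'; apply: he; rewrite ?subrr ?normr0//.
  by rewrite distrC.
have locA t : A' t -> exists2 e, 0 < e & forall t', `|t' - t| < e -> A t' -> A' t'.
  move=> /local[e e0 he]; exists e => // t' h1 h2; apply: he => //.
  by rewrite subrr normr0.
have [t01 t1l] := andP (slabt _ G'1).
have [a [/andP[t0a at1] nAa ha]] := @gap_below A A' t0 t1 clA' G'1
  (fun h => ltac:(by have := slabt _ h; rewrite ltxx)) t01 locA.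
have [b [t1b btl nAb hb]] : exists b, [/\ t1 < b, b < t0 + ell, ~ A b &
    forall t, t1 <= t <= b -> A t -> A' t].
  (* The upper height is a lower one for the reflected heights. *)
  have [] := @gap_below (-%R @^-1` A) (-%R @^-1` A') (- (t0 + ell)) (- t1).
  - by apply: preimage_closed clA' => t _; exact: opp_continuous.
  - by rewrite /= opprK.
  - by rewrite /= opprK => /slabt; rewrite ltxx andbF.
  - by rewrite ltrN2.
  - move=> t /locA[e e0 he]; exists e => // t' h; apply: he.
    by rewrite -opprD normrN.
  move=> b [/andP[b1 b2] nb hb]; exists (- b); split => //; first lra_in R.
  - lra_in R.
  - by move=> t /andP[? ?] At; rewrite -[t]opprK; apply: (hb (- t)); rewrite /= ?opprK//; lra_in R.
have hab t : a <= t <= b -> A t -> A' t.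
  move=> /andP[at_ tb]; have [tt1|t1t] := leP t t1; first by apply: ha; rewrite at_.
  by apply: hb; rewrite tb (ltW t1t).
(* The sign s orients x so that the free side is s (x - x0) < 0. *)
have [s [s2 sside]] : exists s, s ^+ 2 = 1 /\
    forall x t, s * (x - x0) < 0 -> ~ Gamma' (vertical_point x t).
  case: hside => hs; [exists (- 1)|exists 1]; split; rewrite ?sqrrN ?expr1n// => x t sx;
    by move=> /hs[x' [t' [xx' /vinj[xE _]]]]; subst x'; lra_in R.
pose P e t := (forall x, - e <= s * (x - x0) < 0 -> ~ Gamma (vertical_point x t)) /\
   (t = a \/ t = b -> forall x, `|x - x0| <= e -> ~ Gamma (vertical_point x t)).
have sx x : `|x - x0| = `|s * (x - x0)|.
  by rewrite normrM (norm_sign s2) mul1r.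
have [d d0 hd] : exists2 e, 0 < e & forall t, a <= t <= b -> P e t.
  apply: segment_uniform.
    move=> e e' t ee' [h1 h2]; split => [x h|tab x h].
      by apply: h1; move: h => /andP[h3 h4]; rewrite h4 andbT; lra_in R.
    by apply: h2 => //; lra_in R.
  (* If t is the height of a point of [Gamma] on the line, then t differs from a and b, and the
     radius is taken small enough to exclude both; otherwise a whole neighbourhood is free. *)
  move=> t tab; have [At|nAt] := pselect (A t).
    have [e e0 he] := local _ (hab _ tab At).
    have ta : t <> a by move=> ta; apply: nAa; rewrite -ta.
    have tb : t <> b by move=> tb; apply: nAb; rewrite -tb.
    pose r := Num.min (e / 2) (Num.min `|t - a| `|t - b|).
    have [r1 r2 r3] : [/\ r <= e / 2, r <= `|t - a| & r <= `|t - b|].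
      by split; rewrite !ge_min lexx ?orbT.
    have r0 : 0 < r.
      by rewrite !lt_min !normr_gt0 !subr_eq0 divr_gt0//=; apply/andP; split; apply/eqP.
    exists r => // t' h; split.
      move=> x /andP[x1 x2] G; apply: (sside x t') => //.
      by apply: he => //; [rewrite sx ltr0_norm; lra_in R|lra_in R].
    by move=> [] E; subst t'; move: h; rewrite distrC; lra_in R.
  have [e e0 he] := away _ _ nAt.
  exists (e / 2); first exact: divr_gt0.
  move=> t' h; split => [x /andP[h1 h2]|_ x hx].
    by apply: he; [rewrite sx ltr0_norm; lra_in R|lra_in R].
  by apply: he; lra_in R.
exists s, a, b, t1, d; split => //.
- by split => //; lra_in R.
- by rewrite at1 t1b; split => //; apply: hsub.
- by move=> x t xd tab; apply: (hd t tab).1.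
- have ab : a <= b by lra_in R.
  by move=> x xd; split; [apply: (hd a _).2|apply: (hd b _).2] => //; rewrite ?lexx ?ab//; [left|right].
Qed.

End Window.

(** * Conclusion *)

Section Reflection.
Variable R : realType.

Definition scale_jet (s : R) (J : jet R) : jet R :=
  Jet (s * jx J) (jy J) (jt J) (s ^+ 2 * jxx J) (jyy J) (jtt J)
    (s * jxy J) (s * jxt J) (jyt J).

Lemma has_jet_scale (F : R -> R -> R -> R) s x0 x y t J :
  has_jet F (s * (x - x0)) y t J ->
  has_jet (fun x y t => F (s * (x - x0)) y t) x y t (scale_jet s J).
Proof.
move=> hF cx cy ct x1 x2 y1 y2 t1 t2 hx hy ht.
have hx' := curve_jetZ s (curve_jetB hx (curve_jet_cst x0)).
apply: curve_jet_eq (hF _ _ _ _ _ _ _ _ _ hx' hy ht) _ _ _ => //; case: J {hF} => *;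
  rewrite /jet_linear /jet_bilinear /vx /vy /vt /=; ring.
Qed.

(** The reflection x -> - x is an isometry onto the space with parameter - tau, whence s tau. *)
Lemma level_curvature_scale (s tau y : R) (J : jet R) : s ^+ 2 = 1 ->
  level_curvature tau y (scale_jet s J) = level_curvature (s * tau) y J.
Proof.
rewrite /level_curvature /scale_jet /=.
by move/eqP; rewrite sqrf_eq1 => /orP[]/eqP ->; ring.
Qed.

End Reflection.

Section LowerBound.
Variables (R : realType) (S : topologicalType) (Y : S -> R).

Lemma compact_pos_lower_bound (B : set S) : continuous Y -> (forall q, 0 < Y q) ->
  compact B -> exists2 y, 0 < y & forall q, B q -> y <= Y q.
Proof.
move=> cY Y0 /compact_near_coveringP/(_ R (0 : R)^'+ (fun e q => e <= Y q) _)[].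
  move=> q _; have q2 : 0 < Y q / 2 by exact: divr_gt0.
  exists ([set q' | Y q / 2 < Y q'], [set e | e <= Y q / 2]); last first.
    by move=> [q' e] /= [h1 h2]; exact: le_trans (ltW h1).
  have q3 : Y q / 2 < Y q by rewrite ltr_pdivrMr// ltr_pMr// ltr1n.
  by split => /=; [exact: (cY q _ (lt_nbhsr q3))|exact: nbhs_right_le].
move=> e /= e0 h; exists (e / 2); first exact: divr_gt0.
move=> q Bq; apply: (h (e / 2)) => //=; last exact: divr_gt0.
by rewrite sub0r normrN ger0_norm ?divr_ge0 ?ltW// ltr_pdivrMr// ltr_pMr// ltr1n.
Qed.

End LowerBound.

(** * Asymptotic boundary and properness in coordinates *)

Section Boundary.
Variables (R : realType) (S : topologicalType) (X : S -> 'rV[R]_3).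
Hypothesis half : range X `<=` half_space (R := R).

Lemma vertical_point_asymptotic (x t : R) : asymptotic_space (vertical_point x t).
Proof.
split; first by right; right; exists x.
by move=> [[x' [y' [y0 []]]] _ y'0]; move: y0; rewrite y'0 ltxx.
Qed.

Lemma far_from_vertical (x t : R) :
  ~ asymptotic_boundary (range X) (vertical_point x t) ->
  exists2 e, 0 < e & forall q, `|xcoord (X q) - x| < e ->
    `|tcoord (X q) - t| < e -> e <= ycoord (X q).
Proof.
move=> nG; apply: contrapT => nfree; apply: nG; split.
  exact: vertical_point_asymptotic.
move=> U /vertical_nbhs[e e0 he]; apply: contrapT => nU; apply: nfree.
exists e => // q qx qt; rewrite leNgt; apply/negP => qy; apply: nU.
have y0 : 0 < ycoord (X q) by apply: half; exists q.
exists (embed (X q)); split; last by apply: he => //; rewrite gtr0_norm.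
  by apply/eqP => -[_ h _]; move: y0; rewrite h ltxx.
by exists (X q) => //; exists q.
Qed.

Lemma near_vertical (x t e : R) : 0 < e ->
  asymptotic_boundary (range X) (vertical_point x t) ->
  exists q, [/\ `|xcoord (X q) - x| < e, ycoord (X q) < e & `|tcoord (X q) - t| < e].
Proof.
move=> e0 [_ /(_ _ (vertical_box_nbhs x t e0))[_ [_ [_ [q _ <-] <-]]]].
move=> [x' [y' [t' [h1 h2 h3 [ex ey et]]]]]; exists q; rewrite ex ey et; split => //.
exact: le_lt_trans (ler_norm _) h2.
Qed.

(** Compactness of the rectangle makes the local bounds of [far_from_vertical] uniform. *)
Lemma rectangle_lower_bound (s x0 u1 u2 t1 t2 : R) : s ^+ 2 = 1 ->
  (forall u t, u1 <= u <= u2 -> t1 <= t <= t2 ->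
    ~ asymptotic_boundary (range X) (vertical_point (x0 + s * u) t)) ->
  exists2 y, 0 < y & forall q, u1 <= s * (xcoord (X q) - x0) <= u2 ->
    t1 <= tcoord (X q) <= t2 -> y <= ycoord (X q).
Proof.
move=> s2 free.
have ncov : near_covering (`[u1, u2] `*` `[t1, t2]).
  by apply/compact_near_coveringP; apply: compact_setX; exact: segment_compact.
have s1 := norm_sign s2.
have [] := ncov R ((0 : R)^'+) (fun e w => forall q, s * (xcoord (X q) - x0) = w.1 ->
    tcoord (X q) = w.2 -> e <= ycoord (X q)) _.
  move=> [u t] /= [+ +]; rewrite !in_itv /= => hu ht.
  have [e e0 he] := far_from_vertical (free _ _ hu ht).
  exists ([set w | ball u e w.1 /\ ball t e w.2], [set e' | e' <= e]).
    split; last exact: nbhs_right_le.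
    by apply: nbhs_setX; exact: nbhsx_ballx.
  move=> [[u' t'] e'] /= [[b1 b2] e'e] q qu qt; apply: le_trans e'e _; apply: he.
    have -> : xcoord (X q) - (x0 + s * u) = s * (u' - u).
      have -> : xcoord (X q) = x0 + s ^+ 2 * (xcoord (X q) - x0) by rewrite s2; ring.
      by rewrite -qu; ring.
    by rewrite normrM s1 mul1r distrC.
  by rewrite qt distrC.
move=> /= e e0 h; exists (e / 2); first exact: divr_gt0.
move=> q qu qt; apply: (h (e / 2) _ _ (s * (xcoord (X q) - x0), tcoord (X q))) => //=.
- by rewrite sub0r normrN ger0_norm; lra.
- by rewrite divr_gt0.
Qed.

Hypothesis cX : continuous X.

Lemma continuous_entry (j : 'I_3) : continuous (fun q => X q 0 j).
Proof.
move=> q; apply: (@continuous_comp _ _ _ X (fun v : 'rV[R]_3 => v 0 j)); first exact: cX.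
exact: coord_continuous.
Qed.

(** As y1 > 0, the box is a compact part of the open half-space, to which properness applies. *)
Lemma compact_box (s x0 x1 x2 y1 y2 t1 t2 : R) : proper_immersion X ->
  s ^+ 2 = 1 -> 0 < y1 ->
  compact [set q | [/\ x1 <= s * (xcoord (X q) - x0) <= x2,
    y1 <= ycoord (X q) <= y2 & t1 <= tcoord (X q) <= t2]].
Proof.
move=> prop s2 y10.
have s1 := norm_sign s2.
pose M := `|x1| + `|x2|.
pose A (j : 'I_3) : set R := if j == 0 then `[x0 - M, x0 + M]%classic
  else if j == 1 then `[y1, y2]%classic else `[t1, t2]%classic.
have cA : compact [set v : 'rV[R]_3 | forall j, A j (v ord0 j)].
  by apply: rV_compact => j; rewrite /A; case: ifP => _; [|case: ifP => _]; exact: segment_compact.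
apply: (@subclosed_compact _ _ (X @^-1` [set v : 'rV[R]_3 | forall j, A j (v ord0 j)])).
- have -> : [set q | [/\ x1 <= s * (xcoord (X q) - x0) <= x2,
      y1 <= ycoord (X q) <= y2 & t1 <= tcoord (X q) <= t2]] =
      ((fun q => s * (xcoord (X q) - x0)) @^-1` `[x1, x2]) `&`
      ((fun q => ycoord (X q)) @^-1` `[y1, y2]) `&`
      ((fun q => tcoord (X q)) @^-1` `[t1, t2]).
    by apply/seteqP; split => q /=; rewrite !in_itv /=; [case|case; case].
  apply: closedI; [apply: closedI|]; apply: preimage_closed; try exact: itv_closed.
  + move=> q _; apply: cvgM; first exact: cvg_cst.
    by apply: cvgB; [exact: continuous_entry|exact: cvg_cst].
  + by move=> q _; exact: continuous_entry.
  + by move=> q _; exact: continuous_entry.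
- apply: prop => //; move=> v /(_ 1); rewrite /A /= in_itv /= => /andP[h _].
  exact: lt_le_trans h.
- move=> q [qx qy qt] j; rewrite /A.
  have [->|j0] := eqVneq j 0.
    have : `|xcoord (X q) - x0| <= M.
      rewrite -[leLHS]mul1r -s1 -normrM ler_norml.
      have [h1 h2] := andP qx; rewrite /M.
      have := ler_norm x2; have := ler_norm (- x1); rewrite normrN.
      by have := normr_ge0 x1; have := normr_ge0 x2; lra.
    by rewrite ler_distl /= in_itv.
  have [->|j1] := eqVneq j 1; first by rewrite /= in_itv.
  have -> : j = 2; last by rewrite /= in_itv.
  by case: j j0 j1 => -[|[|[|//]]] h // _ _; apply/val_inj.
Qed.

End Boundary.

Theorem theorem1p1 (R : realType) (tau : R) (Gamma : set (ambient R))
    (hGamma : asymptotic_curve Gamma)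
    (x0 : R) (Gamma' : set (ambient R)) (p q : ambient R)
    (harc : is_arc Gamma' p q) (hsub : Gamma' `<=` Gamma)
    (hmeet : Gamma' `&` vertical_line x0 !=set0)
    (hends : ~ vertical_line x0 p /\ ~ vertical_line x0 q)
    (hside : one_side x0 Gamma')
    (hslab : exists t0 : R,
       Gamma' `<=` vertical_slab t0 (t0 + Num.sqrt (1 + 4 * tau ^+ 2) * pi)) :
  ~ exists (S : topologicalType) (X : S -> 'rV[R]_3),
      properly_immersed_minimal_surface tau X /\
      asymptotic_boundary (range X) = Gamma.
Proof.
move=> [S [X [[immX minX propX cptB] XG]]].
have [s [a [b [t1 [d [s2 [d0 bal] [/andP[at1 t1b] Gt1] left_free ab_free]]]]]] :=
  curve_window hGamma harc hsub hmeet hends hside hslab.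
have s1 := norm_sign s2.
rewrite -XG in Gt1 left_free ab_free; clear XG.
have cX := immersed_continuous immX.
have half : range X `<=` half_space (R := R) by case: immX.
have cc := continuous_entry cX.
have Ypos r : 0 < ycoord (X r) by apply: half; exists r.
(* The finite boundary is compact, hence stays above height yb; barriers used below that height do
   not meet it. *)
have [yb yb0 hyb] := compact_pos_lower_bound (cc 1) Ypos cptB.
have sxx u : s * (x0 + s * u - x0) = u.
  by have -> : s * (x0 + s * u - x0) = s ^+ 2 * u by [ring]; rewrite s2 mul1r.
have ab : a < b by exact: lt_trans t1b.
have [ya ya0 hya] : exists2 y, 0 < y & forall q, - d <= s * (xcoord (X q) - x0) <= d ->
    a <= tcoord (X q) <= a -> y <= ycoord (X q).
  apply: rectangle_lower_bound => // u t ud /andP[ta at_].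
  have -> : t = a by apply/eqP; rewrite eq_le ta at_.
  apply: (ab_free _ _).1.
  by rewrite addrAC subrr add0r normrM s1 mul1r ler_norml.
have [yb' yb'0 hyb'] : exists2 y, 0 < y & forall q, - d <= s * (xcoord (X q) - x0) <= d ->
    b <= tcoord (X q) <= b -> y <= ycoord (X q).
  apply: rectangle_lower_bound => // u t ud /andP[ta at_].
  have -> : t = b by apply/eqP; rewrite eq_le ta at_.
  apply: (ab_free _ _).2.
  by rewrite addrAC subrr add0r normrM s1 mul1r ler_norml.
(* Below height d', S has no finite boundary and, for |x - x0| <= d', does not meet the heights a
   and b. The halves make these inequalities strict. *)
pose d' := Num.min d (Num.min (yb / 2) (Num.min (ya / 2) (yb' / 2))).
have d'0 : 0 < d' by rewrite !lt_min d0 !divr_gt0.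
have [d'1 d'2 d'3 d'4] : [/\ d' <= d, d' <= yb / 2, d' <= ya / 2 & d' <= yb' / 2].
  by split; rewrite !ge_min lexx ?orbT.
have [e e0 he] : exists2 e, 0 < e & forall q, a < tcoord (X q) < b ->
    `|s * (xcoord (X q) - x0)| < e -> e <= ycoord (X q).
  apply: (@one_sided_away R (s * tau) S (fun q => s * (xcoord (X q) - x0))
    (fun q => ycoord (X q)) (fun q => tcoord (X q)) a b d') => //.
  - move=> r; apply: cvgM; first exact: cvg_cst.
    by apply: cvgB; [exact: cc|exact: cvg_cst].
  - exact: cc.
  - exact: cc.
  - by move=> *; exact: compact_box.
  - move=> r Phi J rd hPhi curv.
    apply: (@minimal_no_max R tau S X immX minX r
      (fun x y t => Phi (s * (x - x0)) y t) (scale_jet s J)).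
    + move=> /hyb h; have {}h : yb <= ycoord (X r) := h.
      by have {}rd : ycoord (X r) <= d' := rd; lra.
    + exact: has_jet_scale.
    + by rewrite level_curvature_scale.
  - move=> r; rewrite ler_norml => /andP[r1 r2] r3.
    have rd : - d <= s * (xcoord (X r) - x0) <= d by apply/andP; split; lra.
    split; apply/eqP => rt.
      by have := hya r rd; rewrite rt lexx => /(_ isT); lra.
    by have := hyb' r rd; rewrite rt lexx => /(_ isT); lra.
  - move=> x x_lt0; apply: rectangle_lower_bound => // u t /andP[u1 u2] tab.
    by apply: left_free => //; rewrite sxx; apply/andP; split; lra.
  - by rewrite exprMn s2 mul1r.
(* A point of S this close to the point of [Gamma] at height t1 lies between the heights a and b,
   and below e. *)
pose e' := Num.min e (Num.min (t1 - a) (b - t1)).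
have e'0 : 0 < e' by rewrite !lt_min e0 !subr_gt0 at1 t1b.
have [e'1 e'2 e'3] : [/\ e' <= e, e' <= t1 - a & e' <= b - t1].
  by split; rewrite !ge_min lexx ?orbT.
have [r [r1 r2 r3]] := near_vertical e'0 Gt1.
have := he r; rewrite normrM s1 mul1r => /(_ _ (lt_le_trans r1 e'1)) h.
move: r3; rewrite ltr_norml => /andP[r3 r4].
have /h : a < tcoord (X r) < b by apply/andP; split; lra.
lra.
Qed.
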